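(* Let $(v_N)_{N\ge2}$ be a deterministic sequence of unit vectors $v_N\in\mathbb{C}^N$. Let $\mathbf{A}_N=\{A_N^k:k\in K\}$ and $\mathbf{B}_N=\{B_N^k:k\in K\}$ ($N\ge2$) be deterministic families of $N\times N$ complex matrices, uniformly bounded in operator norm. Assume there are linear functionals $\psi_{\mathbf{A}},\omega_{\mathbf{A}},\varphi_{\mathbf{A}}$ on $\mathbb{C}\langle X_k:k\in K\rangle$ and $\psi_{\mathbf{B}},\omega_{\mathbf{B}},\varphi_{\mathbf{B}}$ on $\mathbb{C}\langle Y_k:k\in K\rangle$ such that for every polynomial $P$ in the corresponding algebra, as $N\to\infty$, $$\psi_{\mathbf{A}_N}(P)=\psi_{\mathbf{A}}(P)+\tfrac1N\omega_{\mathbf{A}}(P)+o(1/N),\qquad \psi_{\mathbf{B}_N}(P)=\psi_{\mathbf{B}}(P)+\tfrac1N\omega_{\mathbf{B}}(P)+o(1/N),$$ $$\varphi^{v_N}_{\mathbf{A}_N}(P)=\varphi_{\mathbf{A}}(P)+o(1),\qquad \varphi^{v_N}_{\mathbf{B}_N}(P)=\varphi_{\mathbf{B}}(P)+o(1).$$ For each $N\geq 2$ let $U_N$ be a uniform random unitary $N\times N$ matrix leaving $v_N$ invariant. Let $\omega$ be the third component (the cyclic conditionally free product of $\omega_{\mathbf{A}}$ and $\omega_{\mathbf{B}}$) of $(\psi_{\mathbf{A}},\varphi_{\mathbf{A}},\omega_{\mathbf{A}})\circledast(\psi_{\mathbf{B}},\varphi_{\mathbf{B}},\omega_{\mathbf{B}})$.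 Then for any $P\in\mathbb{C}\langle X_k,Y_k:k\in K\rangle$, $$\mathbb{E}\Big[\tfrac1N\mathrm{Tr}\big(P(\mathbf{A}_N,U_N\mathbf{B}_NU_N^\star)\big)\Big]=(\psi_{\mathbf{A}}*\psi_{\mathbf{B}})(P)+\tfrac1N\,\omega(P)+O(N^{-2}).$$ Equivalently, for any $s\ge1$ and any $P_1,\dots,P_s\in\mathbb{C}\langle X_k:k\in K\rangle$, $Q_1,\dots,Q_s\in\mathbb{C}\langle Y_k:k\in K\rangle$ with $\psi_{\mathbf{A}}(P_i)=0=\psi_{\mathbf{B}}(Q_i)$ for all $i$, $$\mathbb{E}\Big[\mathrm{Tr}\big(P_1(\mathbf{A}_N)Q_1(U_N\mathbf{B}_NU_N^\star)\cdots P_s(\mathbf{A}_N)Q_s(U_N\mathbf{B}_NU_N^\star)\big)\Big]=\varphi_{\mathbf{A}}(P_1)\varphi_{\mathbf{B}}(Q_1)\cdots\varphi_{\mathbf{A}}(P_s)\varphi_{\mathbf{B}}(Q_s)+O(N^{-1}).$$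
   Context: A uniform random unitary matrix leaving $v$ invariant is distributed according to Haar measure on $\{U\in U(N):Uv=v\}$. For a family $\mathbf{A}$ of $N\times N$ matrices and $v\in\mathbb{C}^N$: $\psi_{\mathbf{A}}(P)=\frac1N\mathrm{Tr}(P(\mathbf{A}))$ and $\varphi^v_{\mathbf{A}}(P)=\mathrm{Tr}(vv^\star P(\mathbf{A}))$. In $P(\mathbf{A},\mathbf{C})$, $X_k$ is evaluated on $\mathbf{A}$ and $Y_k$ on $\mathbf{C}$; $U\mathbf{B}U^\star=\{UB^kU^\star:k\in K\}$. A linear functional $\omega$ is tracial if $\omega(ab)=\omega(ba)$. ($\omega_{\mathbf{A}},\omega_{\mathbf{B}}$ above are automatically tracial and vanish at $1$.) $\mathcal{A}_1\star\mathcal{A}_2$ is the free product of unital algebras with identification of units. A sequence $(a_1,\dots,a_n)$ with $a_j\in\mathcal{A}_{i_j}$ is alternating if $i_1\ne i_2\ne\cdots\ne i_n$, cyclically alternating if moreover $i_n\ne i_1$ (so $n\ge2$), and centered w.r.t. $\psi$ if $\psi(a_j)=0$ for all $j$. Cyclic conditionally free product: given unital algebras $\mathcal{A}_1,\mathcal{A}_2$ and triples of linear functionals $(\psi_i,\varphi_i,\omega_i)$ on $\mathcal{A}_i$ with $\psi_i,\varphi_i$ unital, $\omega_i$ tracial and $\omega_1(1)=\omega_2(1)$, $(\psi_1,\varphi_1,\omega_1)\circledast(\psi_2,\varphi_2,\omega_2)=(\psi,\varphi,\omega)$ is the unique triple of linear functionals on $\mathcal{A}_1\star\mathcal{A}_2$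 extending the given ones, with $\omega$ tracial, such that: for every alternating sequence centered w.r.t. $\psi$, $\psi(a_1\cdots a_n)=0$ and $\varphi(a_1\cdots a_n)=\varphi(a_1)\cdots\varphi(a_n)$; and for every cyclically alternating sequence centered w.r.t. $\psi$, $\omega(a_1\cdots a_n)=\varphi(a_1)\cdots\varphi(a_n)$. The first component $\psi$ is the free product $\psi_1*\psi_2$.
   Formalization: With o(1/N), o(1) hypotheses the O(N^-2), O(N^-1) errors fail (A_N=N^{-3/2}I, B_N=0, P=X). Proved instead: errors o(1/N), o(1) as stated; and the errors O(N^-2), O(N^-1) when the assumed expansions hold with errors O(N^-2) for psi and O(N^-1) for phi. *)

(* Defs.v *)
From HB Require Import structures.
From mathcomp Require Import all_boot all_order all_algebra complex.
From mathcomp Require Import all_classical all_reals all_analysis.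
(* The notations of monalg are incompatible with those of the analysis
   library, so only its definitions and instances are imported. *)
From mathcomp Require Import -(notations) finmap monalg.

Set Implicit Arguments.
Unset Strict Implicit.
Unset Printing Implicit Defensive.

Import Order.TTheory GRing.Theory Num.Theory.
Import numFieldNormedType.Exports.

Local Open Scope classical_set_scope.
Local Open Scope ring_scope.
Local Open Scope complex_scope.
Local Open Scope sesquilinear_scope.

(* The noncommutative polynomials C<X_k : k in K>: the algebra over C = R[i] of
   the free monoid on K. Taking K + K as index set gives C<X_k, Y_k : k in K>,
   with X_k = ncvar R (inl k) and Y_k = ncvar R (inr k). *)
Definition ncpoly (R : realType) (K : choiceType) := malg (fmonom K) R[i].

HB.instance Definition _ (R : realType) (K : choiceType) :=
  GRing.Lalgebra.on (ncpoly R K).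

Definition ncvar (R : realType) (K : choiceType) (k : K) : ncpoly R K :=
  mkmalgU (fmu k) 1.

(* The canonical embeddings of C<X_k : k in K> and C<Y_k : k in K> into their
   free product C<X_k, Y_k : k in K> are ncmap inl and ncmap inr. *)
Definition ncmap (R : realType) (K L : choiceType) (f : K -> L)
    (p : ncpoly R K) : ncpoly R L :=
  \sum_(m <- msupp p) mcoeff m p *: \prod_(k <- (m : seq K)) ncvar R (f k).

Definition mxeval (R : realType) (K : choiceType) (N : nat)
    (A : K -> 'M[R[i]]_N) (p : ncpoly R K) : 'M[R[i]]_N :=
  \sum_(m <- msupp p) mcoeff m p *: \big[mulmx/1%:M]_(k <- (m : seq K)) A k.

Definition conjfam (R : realType) (K : choiceType) (N : nat)
    (U : 'M[R[i]]_N) (B : K -> 'M[R[i]]_N) : K -> 'M[R[i]]_N :=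
  fun k => U *m B k *m U^t*.

Definition joinfam (R : realType) (K : choiceType) (N : nat)
    (A C : K -> 'M[R[i]]_N) : (K + K)%type -> 'M[R[i]]_N :=
  fun k => match k with inl k => A k | inr k => C k end.

Definition psi_mx (R : realType) (K : choiceType) (N : nat)
    (A : K -> 'M[R[i]]_N) (p : ncpoly R K) : R[i] :=
  N%:R^-1 * \tr (mxeval A p).

Definition phi_mx (R : realType) (K : choiceType) (N : nat)
    (v : 'cV[R[i]]_N) (A : K -> 'M[R[i]]_N) (p : ncpoly R K) : R[i] :=
  \tr (v *m v^t* *m mxeval A p).

Definition l2norm (R : realType) (N : nat) (x : 'cV[R[i]]_N) : R :=
  Num.sqrt (\sum_(i < N) Normc.normc (x i 0) ^+ 2).

Definition opnorm (R : realType) (N : nat) (A : 'M[R[i]]_N) : R :=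
  sup [set l2norm (A *m x) | x in [set x | l2norm x <= 1]].

Definition tracial (F : comNzRingType) (A : lalgType F) (f : {scalar A}) :=
  forall a b : A, f (a * b) = f (b * a).

Section CyclicConditionallyFreeProduct.
(* The free algebras above carry the library's left-algebra structure only,
   hence lalgType; A stands for the free product of A1 and A2, and j1, j2 for
   the embeddings of its factors. *)
Variables (F : comNzRingType) (A1 A2 A : lalgType F).
Variables (j1 : A1 -> A) (j2 : A2 -> A).

Definition inj_factor (a : A1 + A2) : A :=
  match a with inl a => j1 a | inr a => j2 a end.

Definition other_factor (a b : A1 + A2) : bool := is_inl a != is_inl b.

(* A sequence (a_1, ..., a_n) with n >= 1. *)
Definition alternating (s : seq (A1 + A2)) : bool :=
  (0 < size s)%N && sorted other_factor s.

(* [cycle] also compares the last term with the first one, so that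
   a one-term sequence is not cyclically alternating. *)
Definition cyclically_alternating (s : seq (A1 + A2)) : bool :=
  (0 < size s)%N && cycle other_factor s.

Definition centered (psi : {scalar A}) (s : seq (A1 + A2)) : bool :=
  all (fun a => psi (inj_factor a) == 0) s.

(* (psi, phi, omega) = (psi1, phi1, omega1) * (psi2, phi2, omega2), where * is
   the cyclic conditionally free product. *)
Record is_cyclic_cfree_product
    (psi1 phi1 omega1 : {scalar A1}) (psi2 phi2 omega2 : {scalar A2})
    (psi phi omega : {scalar A}) : Prop := IsCyclicCfreeProduct {
  ccfree_extends1 : forall a,
    [/\ psi (j1 a) = psi1 a, phi (j1 a) = phi1 a & omega (j1 a) = omega1 a];
  ccfree_extends2 : forall a,
    [/\ psi (j2 a) = psi2 a, phi (j2 a) = phi2 a & omega (j2 a) = omega2 a];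
  ccfree_tracial : tracial omega;
  ccfree_psi : forall s, alternating s -> centered psi s ->
    psi (\prod_(a <- s) inj_factor a) = 0;
  ccfree_phi : forall s, alternating s -> centered psi s ->
    phi (\prod_(a <- s) inj_factor a) = \prod_(a <- s) phi (inj_factor a);
  ccfree_omega : forall s, cyclically_alternating s -> centered psi s ->
    omega (\prod_(a <- s) inj_factor a) = \prod_(a <- s) phi (inj_factor a)
}.

End CyclicConditionallyFreeProduct.

(* The Borel sets of the space of N x N complex matrices, generated by the
   real and imaginary parts of the entries. *)
Definition mx_borel (R : realType) (N : nat) : set (set 'M[R[i]]_N) :=
  <<s [set E : (set 'M[R[i]]_N) |
         exists (i j : 'I_N) (S : set R), measurable S /\
           (E = (fun M : 'M[R[i]]_N => complex.Re (M i j)) @^-1` S \/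
            E = (fun M : 'M[R[i]]_N => complex.Im (M i j)) @^-1` S)] >>.

Definition unitary_stabilizer (R : realType) (N : nat) (v : 'cV[R[i]]_N) :
    set 'M[R[i]]_N :=
  [set U | U \is unitarymx /\ U *m v = v].

(* U is a random element of the compact group {U in U(N) : U v = v} whose law is
   the Haar measure, i.e. the probability measure on that group invariant under
   left translations. *)
Record uniform_unitary_fixing (R : realType) d (T : measurableType d)
    (P : probability T R) (N : nat) (v : 'cV[R[i]]_N)
    (U : T -> 'M[R[i]]_N) : Prop := UniformUnitaryFixing {
  uuf_measurable : forall E, mx_borel E -> measurable (U @^-1` E);
  uuf_stabilizer : forall t, unitary_stabilizer v (U t);
  uuf_haar : forall W, unitary_stabilizer v W -> forall E, mx_borel E ->
    P ((fun t => W *m U t) @^-1` E) = P (U @^-1` E)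
}.

Definition expectationC (R : realType) d (T : measurableType d)
    (P : probability T R) (X : T -> R[i]) : R[i] :=
  fine ('E_P[fun t => complex.Re (X t)])%E +i*
  fine ('E_P[fun t => complex.Im (X t)])%E.

(* f(N) = o(N^-k), resp. O(N^-k), as N tends to infinity; the regular module
   R[i]^o carries the norm of the complex numbers. *)
Definition is_o_invpow (R : realType) (k : nat) (f : nat -> R[i]) : Prop :=
  (f : nat -> R[i]^o) =o_\oo (fun N : nat => N%:R ^- k : R[i]^o).

Definition is_O_invpow (R : realType) (k : nat) (f : nat -> R[i]) : Prop :=
  (f : nat -> R[i]^o) =O_\oo (fun N : nat => N%:R ^- k : R[i]^o).

(* Main.v *)
Require Import Defs.
From HB Require Import structures.
From mathcomp Require Import all_boot all_order all_algebra complex.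
From mathcomp Require Import all_classical all_reals all_analysis.
From mathcomp Require Import -(notations) finmap monalg.
From mathcomp Require Import zify ring lra.
Import Order.TTheory GRing.Theory Num.Theory.
Import numFieldNormedType.Exports.

Set Implicit Arguments.
Unset Strict Implicit.
Unset Printing Implicit Defensive.

Local Open Scope classical_set_scope.
Local Open Scope ring_scope.
Local Open Scope complex_scope.
Local Open Scope sesquilinear_scope.

(** The proof rests on the Schwinger-Dyson (loop) equations of the Haar measure
    on the stabilizer of [v], and avoids the Weingarten calculus.

    Let [P = 1 - v v^*] be the projection on the orthogonal complement of [v].
    The law of [U] is invariant under left multiplication by the rotations
    [1 + (z - 1) x x^*], where [x] is a unit vector orthogonal to [v] and
    [|z| = 1]. Differentiating at [z = 1] and polarizing in [x] shows that, for
    every matrix [X], the expectation of the derivative in the direction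
    [P X P] of a product of two traces of words in deterministic letters [a] and
    conjugated letters [U b U^*] is zero ([schwinger_dyson0]); in that direction
    the derivative of [C = U b U^*] is the commutator of [P X P] and [C].
    Inserting matrix units for [X] and summing over them, a commutator cuts a
    word in two pieces, each with its own trace, because the sum of
    [P E_ab P M P E_ba P] is [tr (P M) P] ([contraction]).

    Call a letter good if its operator norm and its trace are both bounded
    independently of [N]; the polynomials that are centered in the limit
    evaluate to good letters. The first use of the equations is that traces of
    alternating words in good letters have second moments bounded uniformly in
    the dimension ([trace_L2]). This is proved by induction on the length:
    writing the equation of the word against the conjugate of its own trace, the
    second moment comes with the factor [N - 1], the other cuts give the trace
    of a shorter alternating word times a factor at most of order [N], and what
    remains is at most of order [N]. With these bounds the equations give more: [tr (P w)] has expectation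
    of order [1 / N] for an alternating word [w] of even length, and so does
    [v^* l P w v] for a letter [l] followed by an alternating word. Since
    [U v = v], peeling the letters off one by one shows that the expectation of
    [v^* w v] is, up to order [1 / N], the product of the values of its letters
    in the state of [v]. As [tr w] is [tr (P w) + v^* w v], this gives
    [trace_alternating], with an error that is uniform in all the data.

    The rest is algebra. The alternating centered words and single factors span
    the free product ([S_all]). For a single factor the expansion is an
    assumption; on cyclically alternating words it is [trace_alternating]; and a
    word whose two ends are of the same kind is reduced to shorter words by
    moving its last factor to the front, which changes neither the traces nor
    [omega], while [psi] vanishes before and after. The errors [o(1)] and
    [O(1/N)] are treated together, as two instances of [error_class]. *)

(** * Complex moduli and operator bounds *)

Section Modulus.
Variable R : realType.
Local Notation C := R[i].
Implicit Types x y : C.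

Definition nc (x : C) : R := Normc.normc x.

Lemma normE x : `|x| = (nc x)%:C. Proof. by []. Qed.

Lemma nc_ge0 x : 0 <= nc x.
Proof. by rewrite -lecR -normE normr_ge0. Qed.

Lemma nc0 : nc 0 = 0. Proof. exact: Normc.normc0. Qed.
Lemma nc1 : nc 1 = 1. Proof. exact: Normc.normc1. Qed.

Lemma ncM x y : nc (x * y) = nc x * nc y. Proof. exact: Normc.normcM. Qed.

Lemma ncD x y : nc (x + y) <= nc x + nc y.
Proof. by rewrite -lecR rmorphD /= -!normE ler_normD. Qed.

Lemma ncN x : nc (- x) = nc x.
Proof. by apply: (@complexI R); rewrite -!normE normrN. Qed.

Lemma ncB x y : nc (x - y) <= nc x + nc y.
Proof. by rewrite -(ncN y) ncD. Qed.

Lemma ncJ x : nc (Num.conj x) = nc x.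
Proof. by apply: (@complexI R); rewrite -!normE norm_conjC. Qed.

Lemma ncV x : nc x^-1 = (nc x)^-1. Proof. exact: Normc.normcV. Qed.

Lemma nc_real (r : R) : 0 <= r -> nc r%:C = r.
Proof. by move=> r0; apply: (@complexI R); rewrite -normE normc_def /= expr0n addr0 sqrtr_sqr ger0_norm. Qed.

Lemma nc_nat n : nc n%:R = n%:R.
Proof.
have -> : (n%:R : C) = (n%:R : R)%:C by rewrite rmorph_nat.
by rewrite nc_real.
Qed.

Lemma nc_eq0 x : nc x = 0 -> x = 0. Proof. exact: Normc.eq0_normc. Qed.

Lemma nc_sum I (r : seq I) (P : pred I) (f : I -> C) :
  nc (\sum_(i <- r | P i) f i) <= \sum_(i <- r | P i) nc (f i).
Proof.
elim/big_ind2: _ => [|a b c e h1 h2|//]; first by rewrite nc0.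
exact: le_trans (ncD _ _) (lerD h1 h2).
Qed.

Lemma nc_Re x : `|complex.Re x| <= nc x.
Proof. by rewrite -lecR -normE; exact: normc_ge_Re. Qed.

Lemma nc_Im x : `|complex.Im x| <= nc x.
Proof.
case: x => a b /=; rewrite -sqrtr_sqr ler_wsqrtr // lerDr; exact: sqr_ge0.
Qed.

Lemma nc_sqrE x : nc x ^+ 2 = complex.Re x ^+ 2 + complex.Im x ^+ 2.
Proof. by case: x => a b; rewrite /nc /= sqr_sqrtr ?addr_ge0 ?sqr_ge0. Qed.

Lemma mul_conjE x : x * Num.conj x = (nc x ^+ 2)%:C.
Proof. by rewrite -normCK normE rmorphXn. Qed.

End Modulus.

Section Adjoint.
Variable R : realType.
Local Notation C := R[i].

Lemma trCZ m n (c : C) (a : 'M[C]_(m, n)) : (c *: a)^t* = Num.conj c *: a^t*.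
Proof. by apply/matrixP => i j; rewrite !mxE rmorphM. Qed.

Lemma trCD m n (a b : 'M[C]_(m, n)) : (a + b)^t* = a^t* + b^t*.
Proof. by apply/matrixP => i j; rewrite !mxE rmorphD. Qed.

Lemma trCB m n (a b : 'M[C]_(m, n)) : (a - b)^t* = a^t* - b^t*.
Proof. by apply/matrixP => i j; rewrite !mxE rmorphB. Qed.

Lemma trCM m n p (a : 'M[C]_(m, n)) (b : 'M[C]_(n, p)) : (a *m b)^t* = b^t* *m a^t*.
Proof. by rewrite trmx_mul map_mxM. Qed.

Lemma trC1 n : (1%:M : 'M[C]_n)^t* = 1%:M.
Proof. by rewrite trmx1 map_mx1. Qed.

Lemma outerJ n (y z : 'cV[C]_n) : (y *m z^t*)^t* = z *m y^t*.
Proof. by rewrite trCM trmxCK. Qed.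

Lemma trC_tr n (a : 'M[C]_n) : \tr (a^t*) = Num.conj (\tr a).
Proof. by rewrite /mxtrace rmorph_sum; apply: eq_bigr => i _; rewrite !mxE. Qed.

Lemma trC_unitary n (u : 'M[C]_n) : u \is unitarymx -> u^t* *m u = 1%:M.
Proof. by move=> uu; exact/mulmx1C/unitarymxP. Qed.

End Adjoint.

Section OperatorBounds.
Variable R : realType.
Local Notation C := R[i].
Variable N : nat.
Implicit Types (x y : 'cV[C]_N) (a b : 'M[C]_N) (M : R).

Definition dotc x y : C := (x^t* *m y) 0 0.

Lemma dotcE x y : dotc x y = \sum_i Num.conj (x i 0) * y i 0.
Proof. by rewrite /dotc mxE; apply: eq_bigr => i _; rewrite !mxE. Qed.

Lemma dotcDr x y z : dotc x (y + z) = dotc x y + dotc x z.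
Proof. by rewrite /dotc mulmxDr mxE. Qed.

Lemma dotcC x y : dotc y x = Num.conj (dotc x y).
Proof.
rewrite !dotcE rmorph_sum; apply: eq_bigr => i _.
by rewrite rmorphM /= conjCK mulrC.
Qed.

Lemma dotcZr x y (c : C) : dotc x (c *: y) = c * dotc x y.
Proof. by rewrite /dotc -scalemxAr mxE. Qed.

Lemma dotc_mulmx a x y : dotc (a *m x) y = dotc x (a^t* *m y).
Proof. by rewrite /dotc trmx_mul map_mxM mulmxA. Qed.

Lemma l2norm_ge0 x : 0 <= l2norm x. Proof. exact: sqrtr_ge0. Qed.

Lemma l2norm_sqr x : l2norm x ^+ 2 = \sum_i nc (x i 0) ^+ 2.
Proof. by rewrite sqr_sqrtr // sumr_ge0 // => i _; exact: sqr_ge0. Qed.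

Lemma dotcc x : dotc x x = (l2norm x ^+ 2)%:C.
Proof.
rewrite dotcE l2norm_sqr rmorph_sum; apply: eq_bigr => i _.
by rewrite mulrC mul_conjE.
Qed.

Lemma l2norm_eq0 x : l2norm x = 0 -> x = 0.
Proof.
move=> x0; have /eqP := l2norm_sqr x; rewrite x0 expr0n /= eq_sym.
rewrite psumr_eq0 => [/allP h|i _]; last exact: sqr_ge0.
apply/matrixP => i j; rewrite (ord1 j) mxE; apply: nc_eq0; apply/eqP.
by have := h i (mem_index_enum i); rewrite /= expf_eq0.
Qed.

(** The Cauchy-Schwarz inequality, by normalizing the two vectors and
    bounding each product of moduli by the half sum of the squares. *)
Lemma CauchySchwarz x y : nc (dotc x y) <= l2norm x * l2norm y.
Proof.
have [x0|x0] := eqVneq (l2norm x) 0.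
  by rewrite (l2norm_eq0 x0) /dotc trmx0 map_mx0 mul0mx mxE nc0 mulr_ge0 ?l2norm_ge0.
have [y0|y0] := eqVneq (l2norm y) 0.
  by rewrite (l2norm_eq0 y0) /dotc mulmx0 mxE nc0 mulr_ge0 ?l2norm_ge0.
have xp : 0 < l2norm x by rewrite lt_def x0 l2norm_ge0.
have yp : 0 < l2norm y by rewrite lt_def y0 l2norm_ge0.
set a := l2norm x in x0 xp *; set b := l2norm y in y0 yp *.
have h i : nc (Num.conj (x i 0) * y i 0)
    <= (b / a / 2) * nc (x i 0) ^+ 2 + (a / b / 2) * nc (y i 0) ^+ 2.
  rewrite ncM ncJ; set s := nc _; set t := nc _.
  have -> : b / a / 2 * s ^+ 2 + a / b / 2 * t ^+ 2
      = s * t + (b * s - a * t) ^+ 2 / (2 * a * b) by field; rewrite x0 y0.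
  by rewrite lerDl divr_ge0 ?sqr_ge0 // !mulr_ge0 // ltW.
rewrite dotcE; apply: le_trans (nc_sum _ _ _) _.
apply: le_trans (ler_sum _ (fun i _ => h i)) _.
rewrite big_split /= -!mulr_sumr -!l2norm_sqr -/a -/b.
by rewrite le_eqVlt; apply/orP; left; apply/eqP; field; rewrite x0 y0.
Qed.

(** Bounding the sesquilinear form, instead of the vectors [a *m x], makes the
    bound visibly stable under sums and adjoints. *)
Definition opbd M a := forall x y, nc (dotc x (a *m y)) <= M * (l2norm x * l2norm y).

Lemma opbd_ge M M' a : M <= M' -> opbd M a -> opbd M' a.
Proof.
move=> MM h x y; apply: le_trans (h x y) _.
by rewrite ler_wpM2r // mulr_ge0 ?l2norm_ge0.
Qed.

Lemma opbdD M M' a b : opbd M a -> opbd M' b -> opbd (M + M') (a + b).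
Proof.
move=> ha hb x y; rewrite mulmxDl dotcDr mulrDl.
exact: le_trans (ncD _ _) (lerD (ha _ _) (hb _ _)).
Qed.

Lemma opbdZ M a (c : C) : opbd M a -> opbd (nc c * M) (c *: a).
Proof.
by move=> ha x y; rewrite -scalemxAl dotcZr ncM -mulrA ler_wpM2l ?nc_ge0.
Qed.

Lemma opbdN M a : opbd M a -> opbd M (- a).
Proof. by move=> /(opbdZ (-1)); rewrite scaleN1r ncN nc1 mul1r. Qed.

Lemma opbdB M M' a b : opbd M a -> opbd M' b -> opbd (M + M') (a - b).
Proof. by move=> ha hb; exact: opbdD ha (opbdN hb). Qed.

Lemma opbd0 : opbd 0 (0 : 'M[C]_N).
Proof. by move=> x y; rewrite mul0mx /dotc mulmx0 mxE nc0 mul0r. Qed.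

Lemma opbd1 : opbd 1 (1%:M : 'M[C]_N).
Proof. by move=> x y; rewrite mul1mx mul1r CauchySchwarz. Qed.

Lemma opbdJ M a : opbd M a -> opbd M (a^t*).
Proof.
move=> h x y; rewrite -dotc_mulmx dotcC ncJ.
by apply: le_trans (h _ _) _; rewrite [l2norm y * _]mulrC.
Qed.

Lemma opbd_l2norm M a x : 0 <= M -> opbd M a -> l2norm (a *m x) <= M * l2norm x.
Proof.
move=> M0 h; have := h (a *m x) x; rewrite dotcc nc_real ?sqr_ge0 //.
rewrite mulrCA expr2; have [->|ax] := eqVneq (l2norm (a *m x)) 0.
  by rewrite !mul0r mulr_ge0 ?l2norm_ge0.
by rewrite ler_pM2l // lt_def ax l2norm_ge0.
Qed.

Lemma l2norm_opbd M a :
  (forall x, l2norm (a *m x) <= M * l2norm x) -> opbd M a.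
Proof.
move=> h x y; apply: le_trans (CauchySchwarz _ _) _.
by rewrite mulrCA ler_wpM2l ?l2norm_ge0.
Qed.

Lemma opbdM M M' a b : 0 <= M' -> opbd M a -> opbd M' b ->
  0 <= M -> opbd (M * M') (a *m b).
Proof.
move=> M0' ha hb M0 x y; rewrite -mulmxA; apply: le_trans (ha _ _) _.
rewrite -mulrA ler_wpM2l // [X in _ <= X]mulrCA ler_wpM2l ?l2norm_ge0 //.
exact: opbd_l2norm.
Qed.

Lemma l2norm_delta (i : 'I_N) : l2norm (delta_mx i 0 : 'cV[C]_N) = 1.
Proof.
rewrite /l2norm (bigD1 i) //= big1 => [|j ji].
  by rewrite mxE !eqxx [Normc.normc _]nc1 expr1n addr0 sqrtr1.
by rewrite mxE (negbTE ji) [Normc.normc _]nc0 expr0n.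
Qed.

Lemma dotc_delta a (i j : 'I_N) : dotc (delta_mx i 0) (a *m delta_mx j 0) = a i j.
Proof.
rewrite dotcE (bigD1 i) //= big1 ?addr0 => [|k ki].
  rewrite mxE !eqxx conjC1 mul1r mxE (bigD1 j) //= big1 ?addr0 => [|k kj].
    by rewrite mxE !eqxx mulr1.
  by rewrite mxE (negbTE kj) mulr0.
by rewrite mxE (negbTE ki) conjC0 mul0r.
Qed.

Lemma opbd_entry M a i j : opbd M a -> nc (a i j) <= M.
Proof. by move=> h; rewrite -dotc_delta; apply: le_trans (h _ _) _; rewrite !l2norm_delta !mulr1. Qed.

Lemma opbd_tr M a : opbd M a -> nc (\tr a) <= N%:R * M.
Proof.
move=> h; apply: le_trans (nc_sum _ _ _) _.
apply: le_trans (ler_sum _ (fun i _ => opbd_entry i i h)) _.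
by rewrite sumr_const card_ord mulr_natl.
Qed.

Lemma opbd_outer x y : opbd (l2norm x * l2norm y) (x *m y^t*).
Proof.
move=> u w; have -> : dotc u (x *m y^t* *m w) = dotc u x * dotc y w.
  rewrite /dotc -!mulmxA [y^t* *m w]mx11_scalar mul_mx_scalar -scalemxAr.
  by rewrite [LHS]mxE mulrC -mx11_scalar.
have -> : l2norm x * l2norm y * (l2norm u * l2norm w)
    = (l2norm u * l2norm x) * (l2norm y * l2norm w) by ring.
by rewrite ncM ler_pM ?nc_ge0 // CauchySchwarz.
Qed.

Lemma unitary_l2norm (u : 'M[C]_N) x : u \is unitarymx -> l2norm (u *m x) = l2norm x.
Proof.
move=> uu; apply/eqP; rewrite -(eqrXn2 (_ : 0 < 2)%N) ?l2norm_ge0 //.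
apply/eqP/(@complexI R); rewrite -!dotcc dotc_mulmx mulmxA.
by rewrite mulmx1C ?mul1mx //; exact/unitarymxP.
Qed.

Lemma opbd_unitary (u : 'M[C]_N) : u \is unitarymx -> opbd 1 u.
Proof. by move=> uu; apply: l2norm_opbd => x; rewrite unitary_l2norm // mul1r. Qed.

(** In finite dimension the supremum defining the operator norm is taken over
    a bounded set, which bounds [l2norm (A *m x)] for every [x]. *)
Lemma opnorm_opbd M a : opnorm a <= M -> opbd M a.
Proof.
move=> h; apply: l2norm_opbd => x.
have [K aK] : exists K, forall x, l2norm x <= 1 -> l2norm (a *m x) <= K.
  pose S := \sum_i \sum_j nc (a i j).
  exists (Num.sqrt (\sum_(i < N) S ^+ 2)) => y y1; rewrite ler_wsqrtr //.
  apply: ler_sum => i _; rewrite lerXn2r ?nnegrE ?nc_ge0 //.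
    by apply: sumr_ge0 => k _; apply: sumr_ge0 => j _; exact: nc_ge0.
  rewrite mxE; apply: le_trans (nc_sum _ _ _) _.
  apply: (@le_trans _ _ (\sum_j nc (a i j))).
    apply: ler_sum => j _; rewrite ncM ler_piMr ?nc_ge0 //.
    rewrite -(@ler_pXn2r _ 2%N) ?nnegrE ?nc_ge0 //.
    apply: (@le_trans _ _ (l2norm y ^+ 2)); last by rewrite lerXn2r ?nnegrE ?l2norm_ge0.
    by rewrite l2norm_sqr [leRHS](bigD1 j) //= lerDl sumr_ge0 // => k _; exact: sqr_ge0.
  rewrite /S [leRHS](bigD1 i) //= lerDl; apply: sumr_ge0 => k _.
  by apply: sumr_ge0 => j _; exact: nc_ge0.
have sN y : l2norm y <= 1 -> l2norm (a *m y) <= M.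
  move=> y1; apply: le_trans h; apply: ub_le_sup; last by exists y.
  by exists K => _ [z z1 <-]; exact: aK.
have [x0|x0] := eqVneq (l2norm x) 0.
  rewrite x0 mulr0 (l2norm_eq0 x0) mulmx0 /l2norm big1 ?sqrtr0 // => i _.
  by rewrite mxE [Normc.normc _]nc0 expr0n.
have xp : 0 < l2norm x by rewrite lt_def x0 l2norm_ge0.
have l2Z (c : R) y : 0 <= c -> l2norm (c%:C *: y) = c * l2norm y.
  move=> c0; apply/eqP; rewrite -(eqrXn2 (_ : 0 < 2)%N) ?mulr_ge0 ?l2norm_ge0 //.
  rewrite exprMn !l2norm_sqr mulr_sumr; apply/eqP/eq_bigr => i _.
  by rewrite mxE ncM nc_real // exprMn.
have := sN ((l2norm x)^-1%:C *: x); rewrite -scalemxAr !l2Z ?invr_ge0 ?l2norm_ge0 //.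
by rewrite mulVf // => /(_ (lexx _)); rewrite ler_pdivrMl // mulrC.
Qed.

End OperatorBounds.

(** * Expectations over the unitary stabilizer of a vector *)

(** Packing these data lets bounds that are uniform in all of them, in
    particular in the dimension, be stated by quantifying over one object. *)
Record haar_model (R : realType) := HaarModel {
  dim : nat;
  vec : 'cV[R[i]]_dim;
  disp : measure_display;
  space : measurableType disp;
  law : probability space R;
  rand : space -> 'M[R[i]]_dim;
  dim_ge2 : (2 <= dim)%N;
  vec_unit : l2norm vec = 1;
  rand_haar : uniform_unitary_fixing law vec rand }.

(** An alias, because generated sigma-algebras live on pointed types. *)
Definition mx_space (R : realType) (N : nat) := 'M[R[i]]_N.
HB.instance Definition _ (R : realType) (N : nat) := Choice.on (mx_space R N).
HB.instance Definition _ (R : realType) (N : nat) :=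
  isPointed.Build (mx_space R N) (0 : 'M[R[i]]_N).

Section Expectation.
Variables (R : realType) (m : haar_model R).
Local Notation C := R[i].
Local Notation N := (dim m).
Local Notation v := (vec m).
Local Notation stab := (unitary_stabilizer v).

Definition mx_gens : set (set (mx_space R N)) :=
  [set E : (set 'M[C]_N) |
         exists (i j : 'I_N) (S : set R), measurable S /\
           (E = (fun M : 'M[C]_N => complex.Re (M i j)) @^-1` S \/
            E = (fun M : 'M[C]_N => complex.Im (M i j)) @^-1` S)].

Let MB : measurableType _ := g_sigma_algebraType mx_gens.

Lemma measurable_rand : measurable_fun [set: space m] (@rand R m : _ -> MB).
Proof.
move=> _ E mE; rewrite setTI; exact: (uuf_measurable (rand_haar m)) mE.
Qed.

Definition bmR (g : 'M[C]_N -> R) : Prop :=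
  measurable_fun [set: MB] g /\ exists c, forall u, stab u -> `|g u| <= c.

Definition bmC (f : 'M[C]_N -> C) : Prop :=
  bmR (fun u => complex.Re (f u)) /\ bmR (fun u => complex.Im (f u)).

Definition Er (g : 'M[C]_N -> R) : R := fine ('E_(law m)[fun t => g (rand t)])%E.

Definition E (f : 'M[C]_N -> C) : C := expectationC (law m) (fun t => f (rand t)).

Lemma bmR_Lfun g : bmR g -> (fun t => g (rand t)) \in Lfun (law m) 1.
Proof.
case=> mg [c hc]; apply/Lfun1_integrable/measurable_bounded_integrable => //.
- by apply: (le_lt_trans (probability_le1 (law m) measurableT)); rewrite ltry.
- exact: (measurableT_comp mg measurable_rand).
exists c; split; first exact: num_real.
move=> x cx t _; apply: le_trans (ltW cx); apply: hc.
exact: (uuf_stabilizer (rand_haar m)).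
Qed.

Lemma bmR_cst r : bmR (fun _ => r).
Proof. by split; [exact: measurable_cst | exists `|r|]. Qed.

Lemma bmRD g h : bmR g -> bmR h -> bmR (fun u => g u + h u).
Proof.
move=> [mg [c hc]] [mh [c' hc']]; split; first exact: measurable_realfun.measurable_funD.
by exists (c + c') => u su; apply: le_trans (ler_normD _ _) (lerD (hc _ su) (hc' _ su)).
Qed.

Lemma bmRM g h : bmR g -> bmR h -> bmR (fun u => g u * h u).
Proof.
move=> [mg [c hc]] [mh [c' hc']]; split; first exact: measurable_realfun.measurable_funM.
exists (c * c') => u su; rewrite normrM ler_pM //; [exact: hc | exact: hc'].
Qed.

Lemma bmRN g : bmR g -> bmR (fun u => - g u).
Proof.
by move=> hg; have := bmRM (bmR_cst (-1)) hg; under eq_fun do rewrite mulN1r.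
Qed.

Lemma bmRB g h : bmR g -> bmR h -> bmR (fun u => g u - h u).
Proof. by move=> hg hh; exact: bmRD hg (bmRN hh). Qed.

Lemma ErD g h : bmR g -> bmR h -> Er (fun u => g u + h u) = Er g + Er h.
Proof.
move=> hg hh; rewrite /Er -fineD; try exact/expectation_fin_num/bmR_Lfun.
by rewrite -expectationD //; exact: bmR_Lfun.
Qed.

Lemma ErZ r g : bmR g -> Er (fun u => r * g u) = r * Er g.
Proof.
move=> hg; rewrite /Er -[r in RHS]/(fine r%:E) -fineM //; last first.
  exact/expectation_fin_num/bmR_Lfun.
rewrite -expectationZl; last exact: bmR_Lfun.
by congr (fine ('E_(law m)[_])); apply/funext => t /=; rewrite mulrC.
Qed.

Lemma Er_cst r : Er (fun _ => r) = r.
Proof. by rewrite /Er (expectation_cst (law m) r). Qed.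

Lemma Er_ge0 g : (forall u, stab u -> 0 <= g u) -> 0 <= Er g.
Proof.
move=> h; apply/fine_ge0/expectation_ge0 => t; apply: h.
exact: (uuf_stabilizer (rand_haar m)).
Qed.

Lemma Er_le g h : bmR g -> bmR h -> (forall u, stab u -> g u <= h u) -> Er g <= Er h.
Proof.
move=> hg hh gh; rewrite -subr_ge0 -[Er g]mul1r -mulNr -ErZ // -ErD //; last first.
  exact: bmRM (bmR_cst _) _.
by apply: Er_ge0 => u su; rewrite mulN1r subr_ge0 gh.
Qed.

Lemma EE f : E f = Er (fun u => complex.Re (f u)) +i* Er (fun u => complex.Im (f u)).
Proof. by []. Qed.

Lemma bmC_cst z : bmC (fun _ => z). Proof. by split; exact: bmR_cst. Qed.

Lemma ReD (x y : C) : complex.Re (x + y) = complex.Re x + complex.Re y.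
Proof. by case: x; case: y. Qed.
Lemma ImD (x y : C) : complex.Im (x + y) = complex.Im x + complex.Im y.
Proof. by case: x; case: y. Qed.
Lemma ReM (x y : C) :
  complex.Re (x * y) = complex.Re x * complex.Re y - complex.Im x * complex.Im y.
Proof. by case: x; case: y. Qed.
Lemma ImM (x y : C) :
  complex.Im (x * y) = complex.Re x * complex.Im y + complex.Im x * complex.Re y.
Proof. by case: x; case: y. Qed.

Lemma ReJ (x : C) : complex.Re (Num.conj x) = complex.Re x.
Proof. by case: x. Qed.
Lemma ImJ (x : C) : complex.Im (Num.conj x) = - complex.Im x.
Proof. by case: x. Qed.

Lemma bmCD f g : bmC f -> bmC g -> bmC (fun u => f u + g u).
Proof.
move=> [f1 f2] [g1 g2]; split.
  by under eq_fun do rewrite ReD; exact: bmRD.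
by under eq_fun do rewrite ImD; exact: bmRD.
Qed.

Lemma bmCM f g : bmC f -> bmC g -> bmC (fun u => f u * g u).
Proof.
move=> [f1 f2] [g1 g2]; split.
  by under eq_fun do rewrite ReM; apply: bmRB; exact: bmRM.
by under eq_fun do rewrite ImM; apply: bmRD; exact: bmRM.
Qed.

Lemma bmCN f : bmC f -> bmC (fun u => - f u).
Proof.
by move=> hf; have := bmCM (bmC_cst (-1)) hf; under eq_fun do rewrite mulN1r.
Qed.

Lemma bmCB f g : bmC f -> bmC g -> bmC (fun u => f u - g u).
Proof. by move=> hf hg; exact: bmCD hf (bmCN hg). Qed.

Lemma bmCJ f : bmC f -> bmC (fun u => Num.conj (f u)).
Proof.
move=> [f1 f2]; split.
  by under eq_fun do rewrite ReJ.
by under eq_fun do rewrite ImJ; exact: bmRN.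
Qed.

Lemma bmC_sum I (r : seq I) (P : pred I) (f : I -> 'M[C]_N -> C) :
  (forall i, bmC (f i)) -> bmC (fun u => \sum_(i <- r | P i) f i u).
Proof.
move=> h; elim: r => [|i r IH].
  by under eq_fun do rewrite big_nil; exact: bmC_cst.
under eq_fun do rewrite big_cons; case: (P i) => //; exact: bmCD.
Qed.

Lemma bmR_sqr f : bmC f -> bmR (fun u => nc (f u) ^+ 2).
Proof.
move=> [f1 f2]; under eq_fun do rewrite nc_sqrE !expr2.
by apply: bmRD; exact: bmRM.
Qed.

Lemma ED f g : bmC f -> bmC g -> E (fun u => f u + g u) = E f + E g.
Proof.
move=> [f1 f2] [g1 g2]; rewrite !EE.
under eq_fun do rewrite ReD; under [in X in _ +i* X]eq_fun do rewrite ImD.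
by rewrite !ErD //.
Qed.

Lemma EZ z f : bmC f -> E (fun u => z * f u) = z * E f.
Proof.
move=> [f1 f2]; case: z => a b; rewrite !EE.
under eq_fun do rewrite ReM /=; under [in X in _ +i* X]eq_fun do rewrite ImM /=.
have bmZ r g : bmR g -> bmR (fun u => r * g u) by exact: bmRM (bmR_cst _).
rewrite ErD ?ErZ //; try exact: bmZ; try exact/bmRN/bmZ.
rewrite (_ : (fun u => - (b * _)) = (fun u => (- b) * complex.Im (f u))); last first.
  by apply/funext => u; rewrite mulNr.
by rewrite ErD ?ErZ ?mulNr //; exact: bmZ.
Qed.

Lemma E_cst z : E (fun _ => z) = z.
Proof. by case: z => a b; rewrite EE !Er_cst. Qed.

Lemma EN f : bmC f -> E (fun u => - f u) = - E f.
Proof. by move=> hf; rewrite -mulN1r -EZ //; under [in RHS]eq_fun do rewrite mulN1r. Qed.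

Lemma EB f g : bmC f -> bmC g -> E (fun u => f u - g u) = E f - E g.
Proof. by move=> hf hg; rewrite ED ?EN //; exact: bmCN. Qed.

Lemma E_sum I (r : seq I) (P : pred I) (f : I -> 'M[C]_N -> C) :
  (forall i, bmC (f i)) ->
  E (fun u => \sum_(i <- r | P i) f i u) = \sum_(i <- r | P i) E (f i).
Proof.
move=> h; elim: r => [|i r IH].
  by under eq_fun do rewrite big_nil; rewrite big_nil E_cst.
rewrite big_cons -IH; under eq_fun do rewrite big_cons; case: (P i) => //.
by rewrite ED //; exact: bmC_sum.
Qed.

Lemma eq_E f g : (forall u, stab u -> f u = g u) -> E f = E g.
Proof.
move=> h; rewrite /E; congr (expectationC (law m) _); apply/funext => t; apply: h.
exact: (uuf_stabilizer (rand_haar m)).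
Qed.


(** Rotating [E f] to the positive real axis reduces the bound to the
    monotonicity of real expectations. *)
Lemma nc_E_le f g : bmC f -> bmR g -> (forall u, stab u -> nc (f u) <= g u) ->
  nc (E f) <= Er g.
Proof.
move=> hf hg h; have [z0|z0] := eqVneq (E f) 0.
  by rewrite z0 nc0; apply: Er_ge0 => u su; exact: le_trans (nc_ge0 _) (h _ su).
set z := E f in z0 *; have nz : nc z != 0 by apply: contra_neq z0 => /nc_eq0.
pose l := (nc z)%:C^-1 * Num.conj z.
have nl : nc l = 1.
  by rewrite /l ncM ncV ncJ nc_real ?nc_ge0 // mulVf.
have hl : E (fun u => l * f u) = (nc z)%:C.
  rewrite EZ // -/z /l -mulrA [_ * z]mulrC mul_conjE rmorphXn expr2 mulKf //.
  by rewrite -normE normr_eq0.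
have hlf : bmC (fun u => l * f u) by exact: bmCM (bmC_cst _) hf.
have -> : nc z = Er (fun u => complex.Re (l * f u)).
  by have := congr1 (@complex.Re R) hl; rewrite EE /=.
apply: Er_le => //; first by case: hlf.
move=> u su; apply: le_trans (h u su).
by rewrite -[nc _]mul1r -nl -ncM; apply: le_trans (nc_Re _); exact: ler_norm.
Qed.

Lemma bmC_entry i j : bmC (fun u => u i j).
Proof.
have b u : stab u -> nc (u i j) <= 1.
  by move=> [uu _]; exact: opbd_entry (opbd_unitary uu).
split; (split; last by exists 1 => u su; apply: le_trans (b u su); rewrite ?nc_Re ?nc_Im).
- move=> _ S mS; rewrite setTI; apply: sub_sigma_algebra; exists i, j, S.
  by split => //; left.
- move=> _ S mS; rewrite setTI; apply: sub_sigma_algebra; exists i, j, S.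
  by split => //; right.
Qed.

(** Two real random variables with the same distribution have the same
    expectation; left invariance is what makes the distributions agree. *)
Lemma Er_invariant W g : stab W -> bmR g -> bmR (fun u => g (W *m u)) ->
  Er (fun u => g (W *m u)) = Er g.
Proof.
move=> sW hg hgW.
have mg : measurable_fun [set: space m] (fun t => g (rand t)).
  exact: (measurableT_comp hg.1 measurable_rand).
have mgW : measurable_fun [set: space m] (fun t => g (W *m rand t)).
  exact: (measurableT_comp hgW.1 measurable_rand).
rewrite /Er unlock; congr fine.
have pf h : measurable_fun [set: space m] h -> h \in Lfun (law m) 1 ->
    (\int[law m]_w (h w)%:E = \int[pushforward (law m) h]_(y in [set: R]) y%:E)%E.
  move=> mh /Lfun1_integrable ih.
  by rewrite (integral_pushforward mh) //; exact: measurable_EFin.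
rewrite (pf _ mg (bmR_Lfun hg)) (pf _ mgW (bmR_Lfun hgW)).
apply: eq_measure_integral => S mS _ /=; rewrite /pushforward.
apply: (uuf_haar (rand_haar m) sW (E := g @^-1` S)).
by have := hg.1 measurableT S mS; rewrite setTI.
Qed.

Lemma E_invariant W f : stab W -> bmC f -> bmC (fun u => f (W *m u)) ->
  E (fun u => f (W *m u)) = E f.
Proof.
move=> sW [f1 f2] [g1 g2]; rewrite !EE.
by rewrite (Er_invariant sW f1 g1) (Er_invariant sW f2 g2).
Qed.

End Expectation.

(** * Words in deterministic and conjugated letters, and their derivatives *)

Section Words.
Variables (R : realType) (N : nat).
Local Notation C := R[i].
Local Notation mx := 'M[C]_N.
Local Notation letter := (mx + mx)%type.
Implicit Types (u X Y : mx) (l : letter) (s t : seq letter).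

(** Keeping the deterministic letters [inl a] and the conjugated letters
    [inr b] in one sequence, rather than evaluated polynomials in them, lets the
    derivative in [u] be computed by recursion over the sequence. *)
Definition lev u l : mx :=
  match l with inl a => a | inr b => u *m b *m u^t* end.

Definition wev u s : mx := \big[mulmx/1%:M]_(l <- s) lev u l.

Definition dlev u X l : mx :=
  match l with inl _ => 0 | inr _ => X *m lev u l - lev u l *m X end.

Fixpoint der u X s : mx :=
  if s is l :: r then dlev u X l *m wev u r + lev u l *m der u X r else 0.

Lemma wev_nil u : wev u [::] = 1%:M. Proof. by rewrite /wev big_nil. Qed.

Lemma wev_cons u l s : wev u (l :: s) = lev u l *m wev u s.
Proof. by rewrite /wev big_cons. Qed.

Lemma wev_cat u s t : wev u (s ++ t) = wev u s *m wev u t.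
Proof.
elim: s => [|l s IH]; first by rewrite wev_nil mul1mx.
by rewrite cat_cons !wev_cons IH mulmxA.
Qed.

Lemma wev_rcons u s l : wev u (rcons s l) = wev u s *m lev u l.
Proof. by rewrite -cats1 wev_cat wev_cons wev_nil mulmx1. Qed.

Lemma wev1 u l : wev u [:: l] = lev u l.
Proof. by rewrite wev_cons wev_nil mulmx1. Qed.

Lemma dlevD u X Y l : dlev u (X + Y) l = dlev u X l + dlev u Y l.
Proof. by case: l => a /=; rewrite ?addr0 // mulmxDl mulmxDr opprD addrACA. Qed.

Lemma dlevZ u c X l : dlev u (c *: X) l = c *: dlev u X l.
Proof. by case: l => a /=; rewrite ?scaler0 // -scalemxAl -scalemxAr scalerBr. Qed.

Lemma derD u X Y s : der u (X + Y) s = der u X s + der u Y s.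
Proof.
elim: s => [|l s IH] /=; first by rewrite addr0.
by rewrite dlevD IH mulmxDl mulmxDr addrACA.
Qed.

Lemma derZ u c X s : der u (c *: X) s = c *: der u X s.
Proof.
elim: s => [|l s IH] /=; first by rewrite scaler0.
by rewrite dlevZ IH -scalemxAl -scalemxAr scalerDr.
Qed.

Lemma der0 u s : der u 0 s = 0.
Proof. by rewrite -[X in der u X s](scale0r (0 : mx)) derZ scale0r. Qed.

Lemma der_sum u I (r : seq I) (F : I -> mx) s :
  der u (\sum_(i <- r) F i) s = \sum_(i <- r) der u (F i) s.
Proof.
elim: r => [|i r IH]; first by rewrite !big_nil der0.
by rewrite !big_cons derD IH.
Qed.


End Words.

Section Taylor.
Variables (R : realType) (m : haar_model R).
Local Notation C := R[i].
Local Notation N := (dim m).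
Local Notation v := (vec m).
Local Notation mx := 'M[C]_N.
Local Notation stab := (unitary_stabilizer v).
Local Notation E := (@E R m).

Lemma stabM W u : stab W -> stab u -> stab (W *m u).
Proof.
by move=> [W1 W2] [u1 u2]; split; [exact: mul_unitarymx | rewrite -mulmxA u2 W2].
Qed.

Definition bmM (F : mx -> mx) := forall i j, bmC (fun u => F u i j).

Lemma bmM_cst a : bmM (fun _ => a). Proof. by move=> i j; exact: bmC_cst. Qed.

Lemma bmM_id : bmM (fun u => u). Proof. by move=> i j; exact: bmC_entry. Qed.

Lemma bmMD F G : bmM F -> bmM G -> bmM (fun u => F u + G u).
Proof. by move=> hF hG i j; under eq_fun do rewrite mxE; exact: bmCD. Qed.

Lemma bmMN F : bmM F -> bmM (fun u => - F u).
Proof. by move=> hF i j; under eq_fun do rewrite mxE; exact: bmCN. Qed.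

Lemma bmMB F G : bmM F -> bmM G -> bmM (fun u => F u - G u).
Proof. by move=> hF hG; exact: bmMD hF (bmMN hG). Qed.

Lemma bmMM F G : bmM F -> bmM G -> bmM (fun u => F u *m G u).
Proof.
move=> hF hG i j; under eq_fun do rewrite mxE.
by apply: bmC_sum => k; exact: bmCM.
Qed.

Lemma bmMJ F : bmM F -> bmM (fun u => (F u)^t*).
Proof. by move=> hF i j; under eq_fun do rewrite !mxE; exact: bmCJ. Qed.

Lemma bmM_tr F : bmM F -> bmC (fun u => \tr (F u)).
Proof. by move=> hF; apply: bmC_sum => i. Qed.

Lemma bmM_lev l : bmM (fun u => lev u l).
Proof.
case: l => a /=; first exact: bmM_cst.
by apply: bmMM; [apply: bmMM; [exact: bmM_id|exact: bmM_cst]|apply: bmMJ; exact: bmM_id].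
Qed.

Lemma bmM_wev s : bmM (fun u => wev u s).
Proof.
elim: s => [|l s IH]; first by under eq_fun do rewrite wev_nil; exact: bmM_cst.
by under eq_fun do rewrite wev_cons; exact: bmMM (bmM_lev l) IH.
Qed.

Lemma bmM_der F s : bmM F -> bmM (fun u => der u (F u) s).
Proof.
move=> hF; elim: s => [|l s IH] /=; first exact: bmM_cst.
apply: bmMD; apply: bmMM => //; [|exact: bmM_wev|exact: bmM_lev].
case: l => a; first exact: bmM_cst.
by apply: bmMB; apply: bmMM => //; exact: (bmM_lev (inr a)).
Qed.

Lemma bmC_bound f : bmC f -> exists2 c, 0 <= c & forall u, stab u -> nc (f u) <= c.
Proof.
move=> [[_ [c hc]] [_ [c' hc']]]; exists (`|c| + `|c'|) => [|u su].
  by rewrite addr_ge0.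
rewrite -(@ler_pXn2r _ 2%N) ?nnegrE ?nc_ge0 ?addr_ge0 // nc_sqrE.
have h1 : `|complex.Re (f u)| <= `|c| by exact: le_trans (hc _ su) (ler_norm _).
have h2 : `|complex.Im (f u)| <= `|c'| by exact: le_trans (hc' _ su) (ler_norm _).
rewrite -[complex.Re _ ^+ 2]real_normK ?num_real // -[complex.Im _ ^+ 2]real_normK ?num_real //.
rewrite sqrrD -addrA lerD ?lerXn2r ?nnegrE //.
by rewrite -[leLHS]add0r lerD ?mulrn_wge0 ?mulr_ge0 // lerXn2r ?nnegrE.
Qed.

Variable x : 'cV[C]_N.
Hypotheses (x1 : l2norm x = 1) (xv : dotc x v = 0).

(** The Cayley transform gives an algebraic parametrization of the rotations
    [1 + (z - 1) x x^*] with [|z| = 1], so that the first order expansion at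
    [tau = 0] needs no trigonometry. *)
Definition phase (tau : R) : C := (1 + tau%:C * 'i) / (1 - tau%:C * 'i).

Definition rot (tau : R) : mx := 1%:M + (phase tau - 1) *: (x *m x^t*).

(** The factor is the derivative of [phase] at [0]. *)
Definition gen : mx := (2 * 'i) *: (x *m x^t*).

Lemma phase_den (tau : R) : (1 - tau%:C * 'i : C) != 0.
Proof.
apply/eqP => /(congr1 (@complex.Re R)) /= h.
by move: h; rewrite !(mul0r, mulr0, mulr1, subr0, addr0, oppr0) => /eqP; rewrite oner_eq0.
Qed.

Lemma outer_sqr : (x *m x^t*) *m (x *m x^t*) = x *m x^t*.
Proof.
rewrite mulmxA -[x *m _ *m x]mulmxA [x^t* *m x]mx11_scalar -/(dotc x x) dotcc x1 expr1n.
by rewrite mul_mx_scalar scale1r.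
Qed.

Lemma conj_phase tau : phase tau * Num.conj (phase tau) = 1.
Proof.
rewrite /phase rmorphM fmorphV rmorphD rmorphB !rmorph1 rmorphM /= conjCi.
have -> : Num.conj (tau%:C : C) = tau%:C by rewrite /Num.conj /= oppr0.
have := phase_den tau; have := phase_den (- tau).
rewrite rmorphN mulNr opprK mulrN opprK => h1 h2.
by rewrite mulrACA -invfM [(1 - _) * _]mulrC divff // mulf_neq0.
Qed.

Lemma rot_stab tau : stab (rot tau).
Proof.
split; last first.
  rewrite /rot mulmxDl mul1mx -scalemxAl -mulmxA [x^t* *m v]mx11_scalar -/(dotc x v) xv.
  by rewrite mul_mx_scalar scale0r scaler0 addr0.
apply/unitarymxP; rewrite trCD trC1 trCZ outerJ rmorphB rmorph1 /rot.
rewrite !mulmxDl !mulmxDr !mul1mx !mulmx1; set Q := x *m _.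
rewrite -scalemxAl -scalemxAr scalerA outer_sqr -/Q -!addrA -!scalerDl.
rewrite [X in X *: Q](_ : _ = 0) ?scale0r ?addr0 //.
by have := conj_phase tau; set z := phase tau; set w := Num.conj _ => h; ring: h.
Qed.

Lemma nc_phase tau : 0 < tau -> nc (phase tau - 1 - tau%:C * (2 * 'i)) <= 2 * tau ^+ 2.
Proof.
move=> t0; have := phase_den tau => d0.
have -> : phase tau - 1 - tau%:C * (2 * 'i) = - (2 * tau ^+ 2)%:C / (1 - tau%:C * 'i).
  have i2 : ('i : C) ^+ 2 = -1 by rewrite sqrCi.
  rewrite /phase rmorphM rmorphXn rmorph_nat; field: i2; exact: d0.
have t2 : 0 <= 2 * tau ^+ 2 by rewrite mulr_ge0 // sqr_ge0.
rewrite ncM ncN ncV nc_real // ler_pdivrMr; last first.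
  by rewrite lt_def nc_ge0 andbT; apply: contra d0 => /eqP/nc_eq0 ->.
rewrite ler_peMr //; apply: le_trans (nc_Re _).
by rewrite /= !(mul0r, mulr0, mulr1, subr0, addr0, oppr0) normr1.
Qed.

(** The derivative at the identity along the rotations, multiplied from the
    left; the remainder is uniform over the group, so that it survives taking
    expectations. *)
Definition rderiv (f f' : mx -> C) :=
  [/\ bmC f, bmC f', forall tau, bmC (fun u => f (rot tau *m u)) &
    exists2 c, 0 <= c & forall tau u, 0 < tau < 1 -> stab u ->
      nc (f (rot tau *m u) - f u - tau%:C * f' u) <= c * tau ^+ 2].

(** The left invariance of the law makes the first order term vanish. *)
Lemma rderiv_E f f' : rderiv f f' -> E f' = 0.
Proof.
move=> [hf hf' hfr [c c0 hc]]; apply: nc_eq0; apply/eqP.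
rewrite eq_le nc_ge0 andbT; apply/ler_addgt0Pr => e e0; rewrite add0r.
pose tau := Num.min (e / (c + 1)) (1 / 2).
have cp : 0 < c + 1 by rewrite ltr_wpDl.
have t0 : 0 < tau by rewrite lt_min divr_gt0 //=; lra.
have t1 : tau < 1 by rewrite gt_min; apply/orP; right; lra.
have /le_trans -> // : nc (E f') <= c * tau.
  rewrite -(ler_pM2l t0) -{1}(nc_real (ltW t0)) -ncM.
  have -> : tau%:C * E f' = - E (fun u => f (rot tau *m u) - f u - tau%:C * f' u).
    have h : bmC (fun u => tau%:C * f' u) by exact: bmCM (bmC_cst _ _) hf'.
    rewrite EB ?EB ?EZ //; last exact: bmCB.
    by rewrite (E_invariant (rot_stab tau)) // subrr sub0r opprK.
  rewrite ncN; apply: le_trans (_ : Er (fun _ : mx => c * tau ^+ 2) <= _).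
    apply: nc_E_le; [|exact: bmR_cst|by move=> u su; apply: hc; rewrite ?t0].
    by apply: bmCB; [exact: bmCB|exact: bmCM (bmC_cst _ _) hf'].
  by rewrite Er_cst le_eqVlt; apply/orP; left; apply/eqP; ring.
apply: (@le_trans _ _ (c * (e / (c + 1)))); first by rewrite ler_wpM2l // ge_min lexx.
by rewrite mulrA ler_pdivrMr // mulrC ler_pM2l // lerDl.
Qed.

Lemma rderiv_cst z : rderiv (fun _ => z) (fun _ => 0).
Proof.
split; try (move=> *; exact: bmC_cst).
by exists 0 => // tau u _ _; rewrite subrr mulr0 subr0 nc0 mul0r.
Qed.

Lemma rderivD f f' g g' : rderiv f f' -> rderiv g g' -> rderiv (fun u => f u + g u) (fun u => f' u + g' u).
Proof.
move=> [f1 f2 f3 [c c0 hc]] [g1 g2 g3 [d d0 hd]]; split; try (move=> *; exact: bmCD).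
exists (c + d) => [|tau u ht su]; first exact: addr_ge0.
rewrite (_ : _ - _ - _ = (f (rot tau *m u) - f u - tau%:C * f' u)
  + (g (rot tau *m u) - g u - tau%:C * g' u)); last by ring.
by rewrite mulrDl; apply: le_trans (ncD _ _) (lerD (hc _ _ ht su) (hd _ _ ht su)).
Qed.

Lemma rderivM f f' g g' : rderiv f f' -> rderiv g g' ->
  rderiv (fun u => f u * g u) (fun u => f' u * g u + f u * g' u).
Proof.
move=> [f1 f2 f3 [c c0 hc]] [g1 g2 g3 [d d0 hd]].
split; first exact: bmCM; first by apply: bmCD; exact: bmCM.
  by move=> tau; exact: bmCM.
have [kf kf0 hf] := bmC_bound f1; have [kf' kf0' hf'] := bmC_bound f2.
have [kg kg0 hg] := bmC_bound g1; have [kg' kg0' hg'] := bmC_bound g2.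
exists (c * kg + (kf + kf') * d + kf' * kg') => [|tau u ht su].
  by rewrite !addr_ge0 // mulr_ge0 ?addr_ge0.
have /andP[t0 t1] := ht.
have ntau : nc (tau%:C : C) = tau by rewrite nc_real // ltW.
rewrite (_ : _ - _ - _ =
    (f (rot tau *m u) - f u - tau%:C * f' u) * g (rot tau *m u)
    + (f u + tau%:C * f' u) * (g (rot tau *m u) - g u - tau%:C * g' u)
    + tau%:C * tau%:C * (f' u * g' u)); last by ring.
rewrite [leRHS]mulrDl [X in _ <= X + _]mulrDl; apply: le_trans (ncD _ _) (lerD _ _).
  apply: le_trans (ncD _ _) (lerD _ _).
    rewrite ncM mulrAC ler_pM ?nc_ge0 //; [exact: hc | apply: hg].
    exact: stabM (rot_stab tau) su.
  rewrite ncM -[leRHS]mulrA ler_pM ?nc_ge0 //; last exact: hd.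
  apply: le_trans (ncD _ _) (lerD (hf _ su) _).
  rewrite ncM ntau -[leRHS]mul1r.
  by apply: ler_pM; [exact: ltW|exact: nc_ge0|exact: ltW|exact: hf'].
rewrite !ncM ntau -expr2 mulrC ler_wpM2r ?sqr_ge0 //.
by apply: ler_pM; rewrite ?nc_ge0 //; [exact: hf'|exact: hg'].
Qed.

Lemma rderivJ f f' : rderiv f f' -> rderiv (fun u => Num.conj (f u)) (fun u => Num.conj (f' u)).
Proof.
move=> [f1 f2 f3 [c c0 hc]]; split; try (move=> *; exact: bmCJ).
exists c => // tau u ht su; rewrite (_ : _ - _ - _ =
  Num.conj (f (rot tau *m u) - f u - tau%:C * f' u)) ?ncJ ?hc //.
have ct : Num.conj (tau%:C : C) = tau%:C by rewrite /Num.conj /= oppr0.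
by rewrite -[X in _ - X * _]ct -rmorphM -!rmorphB.
Qed.

Lemma rderiv_sum I (r : seq I) (f f' : I -> mx -> C) : (forall i, rderiv (f i) (f' i)) ->
  rderiv (fun u => \sum_(i <- r) f i u) (fun u => \sum_(i <- r) f' i u).
Proof.
move=> h; elim: r => [|i r IH].
  by under eq_fun do rewrite big_nil; under [X in rderiv _ X]eq_fun do rewrite big_nil; exact: rderiv_cst.
under eq_fun do rewrite big_cons; under [X in rderiv _ X]eq_fun do rewrite big_cons.
exact: rderivD.
Qed.

Definition rderivMx (F F' : mx -> mx) := forall i j, rderiv (fun u => F u i j) (fun u => F' u i j).

Lemma rderivMx_cst a : rderivMx (fun _ => a) (fun _ => 0).
Proof. by move=> i j; under [X in rderiv _ X]eq_fun do rewrite mxE; exact: rderiv_cst. Qed.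

Lemma rderivMxM F F' G G' : rderivMx F F' -> rderivMx G G' ->
  rderivMx (fun u => F u *m G u) (fun u => F' u *m G u + F u *m G' u).
Proof.
move=> hF hG i j; under eq_fun do rewrite mxE.
under [X in rderiv _ X]eq_fun do rewrite !mxE -big_split.
by apply: rderiv_sum => k; exact: rderivM.
Qed.

Lemma rderivMxJ F F' : rderivMx F F' -> rderivMx (fun u => (F u)^t*) (fun u => (F' u)^t*).
Proof.
move=> hF i j; under eq_fun do rewrite !mxE; under [X in rderiv _ X]eq_fun do rewrite !mxE.
exact: rderivJ.
Qed.

Lemma rderivMx_tr F F' : rderivMx F F' -> rderiv (fun u => \tr (F u)) (fun u => \tr (F' u)).
Proof. by move=> hF; apply: rderiv_sum => k; exact: hF. Qed.

Lemma rderivMx_id : rderivMx (fun u => u) (fun u => gen *m u).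
Proof.
move=> i j; have bg := bmMM (bmM_cst gen) bmM_id.
have bQ := bmMM (bmM_cst (x *m x^t*)) bmM_id.
split; [exact: bmC_entry|exact: bg| |].
  by move=> tau; exact: (bmMM (bmM_cst (rot tau)) bmM_id).
have [c c0 hc] := bmC_bound (bQ i j); exists (2 * c) => [|tau u /andP[t0 _] su].
  by rewrite mulr_ge0.
rewrite (_ : _ - _ - _ = (phase tau - 1 - tau%:C * (2 * 'i)) * (x *m x^t* *m u) i j).
  by rewrite ncM [2 * c]mulrC -mulrA mulrC ler_pM ?nc_ge0 // ?nc_phase ?hc.
rewrite /rot /gen mulmxDl mul1mx -!scalemxAl.
move: (x *m x^t* *m u) => Y; rewrite !mxE; ring.
Qed.

Lemma genJ : gen^t* = - gen.
Proof.
rewrite /gen trCZ outerJ -scaleNr rmorphM /= conjCi.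
by congr (_ *: _); rewrite rmorph_nat mulrN.
Qed.

Lemma rderivMx_lev l : rderivMx (fun u => lev u l) (fun u => dlev u gen l).
Proof.
case: l => a /=; first exact: rderivMx_cst.
have := rderivMxM (rderivMxM rderivMx_id (rderivMx_cst a)) (rderivMxJ rderivMx_id).
congr rderivMx; apply/funext => u.
by rewrite mulmx0 addr0 trCM genJ !mulmxN !mulmxA.
Qed.

Lemma rderivMx_wev s : rderivMx (fun u => wev u s) (fun u => der u gen s).
Proof.
elim: s => [|l s IH].
  by under eq_fun do rewrite wev_nil; exact: rderivMx_cst.
by under eq_fun do rewrite wev_cons; exact: rderivMxM (rderivMx_lev l) IH.
Qed.

Lemma rderiv_E_words s t :
  E (fun u => \tr (der u gen s) * \tr (wev u t) + \tr (wev u s) * \tr (der u gen t)) = 0.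
Proof. by apply: rderiv_E; apply: rderivM; apply: rderivMx_tr; exact: rderivMx_wev. Qed.

End Taylor.

(** * Schwinger-Dyson equations *)

Section SchwingerDyson.
Variables (R : realType) (m : haar_model R).
Local Notation C := R[i].
Local Notation N := (dim m).
Local Notation v := (vec m).
Local Notation mx := 'M[C]_N.
Local Notation stab := (unitary_stabilizer v).
Local Notation E := (@E R m).
Local Notation letter := (mx + mx)%type.

Definition prj : mx := 1%:M - v *m v^t*.

Lemma vec_dot : v^t* *m v = 1%:M.
Proof.
by rewrite [LHS]mx11_scalar -/(dotc v v) dotcc vec_unit expr1n.
Qed.

Lemma prjJ : prj^t* = prj.
Proof. by rewrite /prj trCB trC1 outerJ. Qed.

Lemma prj_vec : prj *m v = 0.
Proof. by rewrite /prj mulmxBl mul1mx -mulmxA vec_dot mulmx1 subrr. Qed.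

Lemma vec_prj : v^t* *m prj = 0.
Proof. by rewrite /prj mulmxBr mulmx1 mulmxA vec_dot mul1mx subrr. Qed.

Lemma prjK : prj *m prj = prj.
Proof. by rewrite {2}/prj mulmxBr mulmx1 mulmxA prj_vec mul0mx subr0. Qed.

Lemma tr_prj : \tr prj = N%:R - 1.
Proof.
rewrite /prj linearB /= mxtrace1 mxtrace_mulC vec_dot.
by rewrite /mxtrace big_ord1 mxE.
Qed.

Lemma opbd_prj : opbd 2 prj.
Proof.
have := opbdB (@opbd1 R N) (opbd_outer v v); rewrite vec_unit mulr1.
by rewrite -[2]/(1 + 1)%:R natrD.
Qed.

Section Polarization.
Variable L : mx -> C.
Hypotheses (LD : forall X Y, L (X + Y) = L X + L Y)
  (LZ : forall c X, L (c *: X) = c * L X).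
Hypothesis L0 : forall x, l2norm x = 1 -> dotc x v = 0 -> L (x *m x^t*) = 0.

Lemma polarize_diag x : dotc x v = 0 -> L (x *m x^t*) = 0.
Proof.
move=> xv; have [x0|x0] := eqVneq (l2norm x) 0.
  by rewrite (l2norm_eq0 x0) mul0mx -[X in L X](scale0r (0 : mx)) LZ mul0r.
pose r := (l2norm x)^-1; pose y := r%:C *: x.
have r0 : 0 <= r by rewrite invr_ge0 l2norm_ge0.
have cr : Num.conj (r%:C : C) = r%:C by rewrite /Num.conj /= oppr0.
have yy : y *m y^t* = (r ^+ 2)%:C *: (x *m x^t*).
  rewrite /y linearZ map_mxZ /= cr -scalemxAl -scalemxAr scalerA.
  by rewrite -rmorphM -expr2.
have y1 : l2norm y = 1.
  apply/eqP; rewrite -(eqrXn2 (_ : 0 < 2)%N) ?l2norm_ge0 // expr1n l2norm_sqr;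
  under eq_bigr do rewrite mxE ncM nc_real // exprMn.
  by rewrite -mulr_sumr -l2norm_sqr -exprMn mulVf // expr1n.
have yv : dotc y v = 0.
  rewrite /dotc /y linearZ map_mxZ /= -scalemxAl mxE.
  by rewrite -[X in _ * X]/(dotc x v) xv mulr0.
have := L0 y1 yv; rewrite yy LZ => /eqP; rewrite mulf_eq0 => /orP[|/eqP //].
by rewrite -[_ == 0]/((r ^+ 2)%:C == 0%:C) (inj_eq (@complexI R)) expf_eq0 /= invr_eq0 (negbTE x0).
Qed.

Lemma polarize x y : dotc x v = 0 -> dotc y v = 0 -> L (x *m y^t*) = 0.
Proof.
move=> xv yv.
have step (c : C) : Num.conj c * L (x *m y^t*) + c * L (y *m x^t*) = 0.
  have dv : dotc (x + c *: y) v = 0.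
    by rewrite (dotcC v) dotcDr dotcZr (dotcC x v) (dotcC y v) xv yv conjC0 mulr0 addr0 conjC0.
  have := polarize_diag dv.
  rewrite linearD linearZ /= map_mxD map_mxZ mulmxDl !mulmxDr.
  rewrite -!scalemxAl -!scalemxAr !LD !LZ !polarize_diag // !mulr0.
  by rewrite add0r addr0.
have := step 'i; have := step 1; rewrite conjC1 conjCi !mul1r => h1.
rewrite (_ : L (y *m x^t*) = - L (x *m y^t*)); last by apply/eqP; rewrite -addr_eq0 addrC h1.
move=> /eqP; rewrite mulNr mulrN -opprD oppr_eq0 -mulr2n mulrn_eq0 /= mulf_eq0.
by rewrite (negbTE (neq0Ci _)) /= => /eqP.
Qed.

Lemma polarize_prj X : L (prj *m X *m prj) = 0.
Proof.
have L0' : L 0 = 0 by rewrite -[X in L X](scale0r (0 : mx)) LZ mul0r.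
rewrite (matrix_sum_delta X) mulmx_sumr mulmx_suml.
elim/big_rec: _ => [//|i Y _ IH]; rewrite LD IH addr0 mulmx_sumr mulmx_suml.
elim/big_rec: _ => [//|j Z _ IH']; rewrite LD IH' addr0.
rewrite -scalemxAr -scalemxAl LZ.
have dv k : dotc (prj *m delta_mx k 0) v = 0 by rewrite dotc_mulmx prjJ prj_vec /dotc mulmx0 mxE.
have -> : prj *m delta_mx i j *m prj
    = (prj *m delta_mx i 0) *m (prj *m delta_mx j (0 : 'I_1))^t*.
  rewrite trmx_mul map_mxM prjJ mulmxA; congr (_ *m _).
  rewrite -mulmxA; congr (_ *m _); apply/matrixP => a b.
  rewrite !mxE big_ord1 !mxE eqxx andbT /= andbT.
  by rewrite conjC_nat -natrM mulnb.

by rewrite polarize ?mulr0.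
Qed.

End Polarization.

Lemma schwinger_dyson0 (X : mx) (s t : seq letter) :
  E (fun u => \tr (der u (prj *m X *m prj) s) * \tr (wev u t)
            + \tr (wev u s) * \tr (der u (prj *m X *m prj) t)) = 0.
Proof.
have bw (r : seq letter) : bmC (fun u => \tr (wev u r)) by apply: bmM_tr; exact: bmM_wev.
have bd Y (r : seq letter) : bmC (fun u => \tr (der u Y r)).
  by apply: bmM_tr; apply: bmM_der; exact: bmM_cst.
have b Y : bmC (fun u => \tr (der u Y s) * \tr (wev u t) + \tr (wev u s) * \tr (der u Y t)).
  by apply: bmCD; exact: bmCM.
apply: (polarize_prj (L := fun X => E (fun u => \tr (der u X s) * \tr (wev u t)
            + \tr (wev u s) * \tr (der u X t)))).
- move=> Y Z; rewrite -ED //; apply: eq_E => u _.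
  by rewrite !derD !linearD /=; ring.
- move=> c Y; rewrite -EZ //; apply: eq_E => u _.
  by rewrite !derZ !linearZ /=; ring.
move=> x x1 xv; have := rderiv_E_words x1 xv s t; rewrite /gen.
under eq_E => u _ do rewrite !derZ !linearZ /=.
rewrite (_ : E _ = 2 * 'i * E (fun u => \tr (der u (x *m x^t*) s) * \tr (wev u t)
            + \tr (wev u s) * \tr (der u (x *m x^t*) t))); last first.
  by rewrite -EZ //; apply: eq_E => u _; ring.
by move=> /eqP; rewrite !mulf_eq0 pnatr_eq0 (negbTE (neq0Ci _)) /= => /eqP.
Qed.

Definition punit (a b : 'I_N) : mx := prj *m delta_mx a b *m prj.

Lemma delta_sandwich (M : mx) (a b c d : 'I_N) :
  (delta_mx a b : mx) *m M *m (delta_mx c d : mx) = M b c *: delta_mx a d.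
Proof.
rewrite -(@mul_delta_mx _ _ _ _ (0 : 'I_1) a b) -(@mul_delta_mx _ _ _ _ (0 : 'I_1) c d).
rewrite -2!mulmxA [_ *m (M *m _)]mulmxA [_ *m (_ *m delta_mx 0 d)]mulmxA.
rewrite [_ *m _ *m delta_mx c 0]mx11_scalar mul_scalar_mx -scalemxAr mul_delta_mx.
by rewrite -rowE -colE !mxE.
Qed.

(** Each summand is a diagonal entry of the compressed factor, indexed by [b],
    times a compressed diagonal unit indexed by [a], so the two sums separate. *)
Lemma contraction (M : mx) :
  \sum_a \sum_b punit a b *m M *m punit b a = \tr (prj *m M) *: prj.
Proof.
have h a b : punit a b *m M *m punit b a
    = (prj *m M *m prj) b b *: (prj *m delta_mx a a *m prj).
  rewrite scalemxAl scalemxAr -delta_sandwich /punit !mulmxA.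
  by [].
under eq_bigr do under eq_bigr do rewrite h.
under eq_bigr do rewrite -scaler_suml -/(mxtrace _) mxtrace_mulC mulmxA prjK.
rewrite -scaler_sumr -mulmx_suml -mulmx_sumr (_ : \sum_i _ = 1%:M) ?mulmx1 ?prjK //.
by rewrite mx1_sum_delta.
Qed.

Lemma tr_delta (M : mx) (a b : 'I_N) : \tr (delta_mx a b *m M) = M b a.
Proof.
rewrite /mxtrace (bigD1 a) //= big1 ?addr0 => [|i ia]; rewrite mxE.
  by rewrite (bigD1 b) //= big1 ?addr0 => [|j jb]; rewrite mxE !eqxx ?mul1r // (negbTE jb) mul0r.
by rewrite big1 // => j _; rewrite mxE (negbTE ia) mul0r.
Qed.

Lemma contraction_tr (M : mx) :
  \sum_a \sum_b \tr (punit a b *m M) *: punit b a = prj *m M *m prj.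
Proof.
have h a b : \tr (punit a b *m M) *: punit b a
    = prj *m ((prj *m M *m prj) b a *: delta_mx b a) *m prj.
  rewrite -scalemxAr -scalemxAl; congr (_ *: _).
  by rewrite /punit -!mulmxA mxtrace_mulC -!mulmxA tr_delta mulmxA.
under eq_bigr do under eq_bigr do rewrite h.
rewrite exchange_big /=; under eq_bigr do rewrite -mulmx_suml -mulmx_sumr.
rewrite -mulmx_suml -mulmx_sumr -matrix_sum_delta.
by rewrite !mulmxA prjK -mulmxA prjK.
Qed.

(** The sum over the occurrences of conjugated letters in [s], each of which
    is cut out on its left and on its right by the commutator in [der]; the
    accumulator [L] is the product of the letters already passed. *)
Fixpoint cuts (u G L : mx) (s : seq letter) : C :=
  if s is l :: r then
    (if l is inr _ then
       \tr (prj *m L) * \tr (G *m prj *m wev u s)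
       - \tr (prj *m (L *m lev u l)) * \tr (G *m prj *m wev u r)
     else 0) + cuts u G (L *m lev u l) r
  else 0.

Lemma tr_sum2 (G Y : mx) (F : 'I_N -> 'I_N -> mx) :
  \sum_a \sum_b \tr (G *m F a b *m Y) = \tr (G *m (\sum_a \sum_b F a b) *m Y).
Proof.
rewrite mulmx_sumr mulmx_suml linear_sum; apply: eq_bigr => a _ /=.
by rewrite mulmx_sumr mulmx_suml linear_sum.
Qed.

Lemma cutsE u G L s :
  \sum_a \sum_b \tr (G *m punit a b *m L *m der u (punit b a) s) = cuts u G L s.
Proof.
elim: s L => [|l s IH] L.
  by rewrite big1 // => a _; rewrite big1 // => b _; rewrite /= mulmx0 linear0.
rewrite [cuts _ _ _ _]/= -IH.
have e a b : \tr (G *m punit a b *m L *m der u (punit b a) (l :: s))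
    = \tr (G *m (punit a b *m L *m dlev u (punit b a) l) *m wev u s)
    + \tr (G *m punit a b *m (L *m lev u l) *m der u (punit b a) s).
  by rewrite -linearD /= mulmxDr !mulmxA.
under eq_bigr do under eq_bigr do rewrite e.
under eq_bigr do rewrite big_split /=.
rewrite big_split /=; congr (_ + _); rewrite {IH e} tr_sum2.
case: l => b; rewrite ?wev_cons /=.
  rewrite (_ : \sum_i _ = 0) ?mulmx0 ?mul0mx ?linear0 //.
  by rewrite big1 // => i _; rewrite big1 // => j _; rewrite mulmx0.
move: (u *m b *m _) => c; have -> : \sum_i \sum_j punit i j *m L *m (punit j i *m c - c *m punit j i)
    = \tr (prj *m L) *: (prj *m c) - \tr (prj *m (L *m c)) *: prj.
  rewrite scalemxAl -!contraction mulmx_suml -sumrB; apply: eq_bigr => i _.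
  rewrite mulmx_suml -sumrB; apply: eq_bigr => j _.
  by rewrite mulmxBr !mulmxA.
rewrite mulmxBr mulmxBl raddfB /= -2!scalemxAr -2!scalemxAl.
rewrite (mxtraceZ (\tr (prj *m L))) (mxtraceZ (\tr (prj *m (L *m c)))).
by rewrite !mulmxA.
Qed.

Lemma bmC_cuts (G L : mx -> mx) s : bmM G -> bmM L ->
  bmC (fun u => cuts u (G u) (L u) s).
Proof.
move=> hG; elim: s L => [|l s IH] L hL /=; first exact: bmC_cst.
have hP := bmM_cst prj; have hl := bmM_lev l.
apply: bmCD; last by apply: IH; exact: bmMM.
case: l hl => b hl; first exact: bmC_cst.
apply: bmCB; apply: bmCM; apply: bmM_tr.
- exact: bmMM hP hL.
- exact: bmMM (bmMM hG hP) (bmM_wev _).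
- exact: bmMM hP (bmMM hL hl).
- exact: bmMM (bmMM hG hP) (bmM_wev _).
Qed.

(** [schwinger_dyson0] summed over the matrix units inserted between [G] and
    [s]: the derivative of [s] produces the cuts, and when the derivative
    falls on [t] the two traces merge into one. *)
Lemma schwinger_dyson (G : mx) s t :
  E (fun u => cuts u G 1%:M s * \tr (wev u t)
            + \tr (der u (prj *m (wev u s *m G) *m prj) t)) = 0.
Proof.
pose F a b := fun u => \tr (der u (punit b a) (inl (G *m punit a b) :: s)) * \tr (wev u t)
  + \tr (wev u (inl (G *m punit a b) :: s)) * \tr (der u (punit b a) t).
have bF a b : bmC (F a b).
  by apply: bmCD; apply: bmCM; apply: bmM_tr; do ?[exact: bmM_wev | apply: bmM_der; exact: bmM_cst].
transitivity (E (fun u => \sum_a \sum_b F a b u)).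
  apply: eq_E => u _; rewrite /F -cutsE mulr_suml.
  under [in RHS]eq_bigr do rewrite big_split /=.
  rewrite big_split /=; congr (_ + _).
    apply: eq_bigr => a _; rewrite mulr_suml; apply: eq_bigr => b _.
    by rewrite mul0mx add0r mulmx1.
  rewrite -contraction_tr der_sum linear_sum /=; apply: eq_bigr => a _.
  rewrite der_sum linear_sum /=; apply: eq_bigr => b _.
  rewrite derZ linearZ /= wev_cons /=; congr (_ * _).
  by rewrite mulmxA [LHS]mxtrace_mulC mulmxA.
rewrite E_sum => [|a]; last exact: bmC_sum.
rewrite big1 // => a _; rewrite E_sum // big1 // => b _.
exact: schwinger_dyson0.
Qed.

(** Here the matrix units are inserted after a letter [l]. Since [G] vanishes
    on the complement of the vector, only one half of the commutator
    differentiating [l] survives, the one that meets the inserted unit. *)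
Lemma schwinger_dyson_letter (G : mx) l s : G *m prj = 0 ->
  E (fun u => (if l is inr _ then
                 - (\tr prj * \tr (G *m lev u l *m prj *m wev u s)) else 0)
            + cuts u (G *m lev u l) 1%:M s) = 0.
Proof.
move=> G0; pose w a b : seq letter := [:: inl G, l, inl (punit a b) & s].
pose F a b := fun u => \tr (der u (punit b a) (w a b)) * \tr (wev u [::])
  + \tr (wev u (w a b)) * \tr (der u (punit b a) [::]).
have bF a b : bmC (F a b).
  by apply: bmCD; apply: bmCM; apply: bmM_tr; do ?[exact: bmM_wev | apply: bmM_der; exact: bmM_cst].
have N0 : (N%:R : C) != 0 by rewrite pnatr_eq0 -lt0n (leq_trans _ (dim_ge2 m)).
have bc : bmC (fun u => cuts u (G *m lev u l) 1%:M s).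
  by apply: bmC_cuts; [exact: bmMM (bmM_cst G) (bmM_lev l) | exact: bmM_cst].
have bl : bmC (fun u => if l is inr _ then
    - (\tr prj * \tr (G *m lev u l *m prj *m wev u s)) else 0).
  case: (l) (bmM_lev l) => b hl; first exact: bmC_cst.
  apply/bmCN/bmCM; first exact: bmC_cst.
  by apply: bmM_tr; apply: bmMM; [apply: bmMM; [apply: bmMM|]|]; do ?[exact: bmM_cst | exact: bmM_wev].
apply: (mulfI N0); rewrite mulr0 -EZ; last exact: bmCD.
transitivity (E (fun u => \sum_a \sum_b F a b u)); last first.
  rewrite E_sum => [|a]; last exact: bmC_sum.
  rewrite big1 // => a _; rewrite E_sum // big1 // => b _.
  exact: schwinger_dyson0.
apply: eq_E => u _; rewrite /F /= wev_nil mxtrace1.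
transitivity (\sum_a \sum_b N%:R * \tr (der u (punit b a) (w a b))); last first.
  apply: eq_bigr => a _; apply: eq_bigr => b _.
  by rewrite linear0 mulr0 addr0 mulrC.
rewrite -cutsE; under [RHS]eq_bigr do rewrite -mulr_sumr.
rewrite -mulr_sumr; congr (_ * _).
have e a b : \tr (der u (punit b a) (w a b))
    = \tr (G *m (dlev u (punit b a) l *m punit a b) *m wev u s)
    + \tr (G *m lev u l *m punit a b *m 1%:M *m der u (punit b a) s).
  rewrite /= mul0mx add0r mulmx1 !wev_cons /=  mul0mx add0r -linearD /=.
  by rewrite mulmxDr !mulmxA.
under [RHS]eq_bigr do under eq_bigr do rewrite e.
under [RHS]eq_bigr do rewrite big_split /=.
rewrite big_split /=; congr (_ + _); rewrite tr_sum2.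
case: (l) => b.
  rewrite (_ : \sum_i _ = 0) ?mulmx0 ?mul0mx ?linear0 //.
  by rewrite big1 // => i _; rewrite big1 // => j _; rewrite /= mul0mx.
rewrite -mulmxA mulmx_sumr.
have -> : \sum_i G *m (\sum_j dlev u (punit j i) (inr b) *m punit i j)
    = - (\tr prj *: (G *m lev u (inr b) *m prj)).
  rewrite scalemxAr -{1}[prj in \tr prj]mulmx1 -contraction exchange_big mulmx_sumr -sumrN.
  apply: eq_bigr => i _; rewrite !mulmx_sumr -sumrN; apply: eq_bigr => j _.
  have Gp : G *m punit j i = 0 by rewrite /punit !mulmxA G0 !mul0mx.
  rewrite /dlev; move: (lev u (inr b)) => w0.
  rewrite mulmxBl mulmxBr -(mulmxA (punit j i) w0) (mulmxA G (punit j i)) Gp mul0mx sub0r.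
  by rewrite mulmx1 !mulmxA.
by rewrite mulNmx raddfN /= -scalemxAl mxtraceZ mulmxA.
Qed.

End SchwingerDyson.

(** * Fluctuations of traces of alternating words *)

Section Letters.
Variables (R : realType) (N : nat).
Local Notation C := R[i].
Local Notation mx := 'M[C]_N.
Local Notation letter := (mx + mx)%type.
Implicit Types (u X : mx) (l : letter) (s t : seq letter) (M : R).

Definition lmx l : mx := match l with inl a => a | inr b => b end.

(** The trace bound is what centering amounts to in the limit: it is of order
    one although [N] times the operator bound would be allowed. *)
Definition good M l : Prop := opbd M (lmx l) /\ nc (\tr (lmx l)) <= M.

Definition goodw M s : Prop := {in s, forall l, good M l}.

Definition alt (A B : Type) (x y : A + B) : bool := is_inl x != is_inl y.

Lemma goodw_cons M l s : goodw M (l :: s) <-> good M l /\ goodw M s.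
Proof.
split=> [h|[h1 h2] l']; last by rewrite inE => /orP[/eqP ->|/h2].
by split=> [|l' l's]; apply: h; rewrite inE ?eqxx // l's orbT.
Qed.

Lemma goodw_cat M s t : goodw M (s ++ t) <-> goodw M s /\ goodw M t.
Proof.
split=> [h|[h1 h2] l]; last by rewrite mem_cat => /orP[/h1|/h2].
by split=> l ls; apply: h; rewrite mem_cat ls ?orbT.
Qed.

Lemma goodw_rcons M s l : goodw M (rcons s l) <-> goodw M s /\ good M l.
Proof.
rewrite -cats1 goodw_cat goodw_cons; split=> [[? []//]|[? ?]]; split=> //.
Qed.

Lemma goodw_ge M M' s : M <= M' -> goodw M s -> goodw M' s.
Proof.
move=> MM h l /h [h1 h2]; split; [exact: opbd_ge MM h1 | exact: le_trans MM].
Qed.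

Lemma alt_last (A B : Type) (l : A + B) (s : seq (A + B)) : sorted (@alt A B) (l :: s) ->
  is_inl (last l s) = is_inl l (+) odd (size s).
Proof.
elim: s l => [|l' s IH] l /=; first by rewrite addbF.
move=> /andP[ll' h]; rewrite IH //; move: ll'; rewrite /alt.
by case: (is_inl l); case: (is_inl l'); case: (odd _).
Qed.

Lemma opbd_lev u M l : 0 <= M -> u \is unitarymx -> opbd M (lmx l) -> opbd M (lev u l).
Proof.
case: l => b //= M0 uu hb; rewrite -[M]mulr1 -[M * 1]mul1r mulrA.
apply: opbdM => //; [|exact/opbdJ/opbd_unitary|by rewrite mul1r].
by apply: opbdM => //; exact: opbd_unitary.
Qed.

Lemma opbd_wev u M s : 1 <= M -> u \is unitarymx -> goodw M s ->
  opbd (M ^+ size s) (wev u s).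
Proof.
move=> M1 uu; elim: s => [|l s IH]; first by rewrite wev_nil expr0 => _; exact: opbd1.
have M0 : 0 <= M by apply: le_trans M1.
move=> /goodw_cons [[hl _] hs]; rewrite wev_cons exprS.
by apply: opbdM => //; [rewrite exprn_ge0|exact: opbd_lev|exact: IH].
Qed.

Lemma opbd_wev_le u M n s : 1 <= M -> u \is unitarymx -> goodw M s -> (size s <= n)%N ->
  opbd (M ^+ n) (wev u s).
Proof. by move=> M1 uu hs sn; apply: opbd_ge (opbd_wev M1 uu hs); rewrite ler_weXn2l. Qed.

Lemma opbd_der u M c X s : 1 <= M -> 0 <= c -> u \is unitarymx -> goodw M s -> opbd c X ->
  opbd ((size s)%:R * (2 * c * M ^+ size s)) (der u X s).
Proof.
move=> M1 c0 uu; elim: s => [|l s IH]; first by rewrite mul0r => _ _; exact: opbd0.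
have M0 : 0 <= M by apply: le_trans M1.
move=> /goodw_cons [[hl _] hs] hX /=.
have hL : opbd M (lev u l) by exact: opbd_lev.
have hd : opbd (2 * c * M) (dlev u X l).
  case: l hl hL => b hl hL; first by apply: opbd_ge (@opbd0 _ _); rewrite !mulr_ge0.
  by apply: opbd_ge (opbdB (opbdM _ hX hL _) (opbdM _ hL hX _)) => //; lra.
have Ms : 0 <= M ^+ size s by exact: exprn_ge0.
have hw := opbd_wev M1 uu hs.
apply: opbd_ge (opbdD (opbdM Ms hd hw _) (opbdM _ hL (IH hs hX) M0)).
- by rewrite exprS -natr1 le_eqVlt; apply/orP; left; apply/eqP; ring.
- by rewrite !mulr_ge0.
- by rewrite !mulr_ge0.
Qed.

Definition ladj l : letter := match l with inl a => inl (a^t*) | inr b => inr (b^t*) end.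

Definition wadj s : seq letter := rev [seq ladj l | l <- s].

Lemma lev_adj u l : lev u (ladj l) = (lev u l)^t*.
Proof. by case: l => b //=; rewrite !trCM trmxCK mulmxA. Qed.

Lemma wev_adj u s : wev u (wadj s) = (wev u s)^t*.
Proof.
elim: s => [|l s IH]; first by rewrite wev_nil trC1.
by rewrite /wadj /= rev_cons wev_rcons IH wev_cons trCM lev_adj.
Qed.

Lemma goodw_adj M s : goodw M s -> goodw M (wadj s).
Proof.
move=> h l; rewrite mem_rev => /mapP [l' /h [h1 h2] ->].
by case: l' h1 h2 => b /= h1 h2; split; rewrite /= ?trC_tr ?ncJ //; exact: opbdJ.
Qed.

Lemma size_wadj s : size (wadj s) = size s.
Proof. by rewrite size_rev size_map. Qed.

Definition lmul l l' : letter :=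
  match l, l' with
  | inr b, inr b' => inr (b *m b')
  | _, _ => inl (lmx l *m lmx l')
  end.

Definition lcenter l : letter :=
  let c := N%:R^-1 * \tr (lmx l) in
  match l with inl a => inl (a - c%:M) | inr b => inr (b - c%:M) end.

Lemma lev_mul u l l' : u \is unitarymx -> is_inl l = is_inl l' ->
  lev u (lmul l l') = lev u l *m lev u l'.
Proof.
case: l => a; case: l' => a' // uu _ /=.
by rewrite !mulmxA -(mulmxA _ (u^t*) u) trC_unitary // mulmx1.
Qed.

Lemma lev_center u l : u \is unitarymx ->
  lev u l = lev u (lcenter l) + (N%:R^-1 * \tr (lmx l))%:M.
Proof.
case: l => a uu /=; first by rewrite subrK.
rewrite mulmxBr mulmxBl mul_mx_scalar -scalemxAl (unitarymxP uu) scalemx1.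
by rewrite subrK.
Qed.

Lemma good_center M l : (0 < N)%N -> 0 <= M -> opbd M (lmx l) -> good (2 * M) (lcenter l).
Proof.
move=> N0 M0 hl; have nN : (N%:R : C) != 0 by rewrite pnatr_eq0 -lt0n.
have hc : nc (N%:R^-1 * \tr (lmx l)) <= M.
  rewrite ncM ncV nc_nat mulrC ler_pdivrMr ?ltr0n // mulrC.
  exact: opbd_tr.
have -> : good (2 * M) (lcenter l) = good (2 * M) (inl (lmx l - (N%:R^-1 * \tr (lmx l))%:M)).
  by case: l {hl hc}.
split => /=; last first.
  by rewrite linearB /= mxtrace_scalar -[_ *+ N]mulr_natl mulVKf // subrr nc0 mulr_ge0.
rewrite -[X in _ - X]scalemx1; apply: opbd_ge (opbdB hl (opbdZ _ (@opbd1 _ _))).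
by rewrite mulr1; lra.
Qed.

Lemma is_inl_mul l l' : is_inl l = is_inl l' -> is_inl (lmul l l') = is_inl l.
Proof. by case: l => a; case: l'. Qed.

Lemma is_inl_center l : is_inl (lcenter l) = is_inl l.
Proof. by case: l. Qed.

End Letters.

Section Fluctuations.
Variable R : realType.
Local Notation C := R[i].

Lemma young (a e d : R) : 0 < d -> e * a <= d * a ^+ 2 + (4 * d)^-1 * e ^+ 2.
Proof.
move=> d0; rewrite -subr_ge0.
rewrite (_ : _ - _ = (2 * d * a - e) ^+ 2 / (4 * d)); last by field; rewrite gt_eqF.
by rewrite divr_ge0 ?sqr_ge0 // mulr_ge0 // ltW.
Qed.

Lemma split_sizes (a b s n : nat) : (a + b.+1 = s)%N -> (s <= n)%N ->
  [/\ (a.+1 <= n.+1)%N, (a.+2 <= n.+1)%N, (b.+1 <= n)%N & (b <= n)%N].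
Proof. by move=> e h; split; lia. Qed.

Lemma even_weight (c q x k : R) : c != 0 -> q != 0 ->
  4 * q * (2 * c * ((32 * c * q)^-1 * x + (4 * (32 * c * q)^-1)^-1 * k))
    = x / 4 + 64 * q ^+ 2 * c ^+ 2 * k.
Proof. by move=> c0 q0; field; rewrite q0 c0. Qed.

Lemma even_absorb (d n1 c x q h : R) : d <= 2 * n1 -> 0 <= q * (8 * c) ->
  0 <= 2 * q * h -> 0 <= d * h ->
  n1 * x <= n1 * (c + x / 4) + d * h + (q - 1) * (2 * (d * h)) + d * (q * (8 * c)) ->
  n1 * x <= n1 * (c + x / 4 + 4 * q * h + 16 * q * c).
Proof.
move=> dn c0 h0 dh H; apply: le_trans H _.
have h1 := ler_wpM2r h0 dn; have h2 := ler_wpM2r c0 dn.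
rewrite -subr_ge0; rewrite -subr_ge0 in h1; rewrite -subr_ge0 in h2.
apply: le_trans (addr_ge0 (addr_ge0 h1 h2) dh) _.
by rewrite le_eqVlt; apply/orP; left; apply/eqP; field.
Qed.

Lemma even_final (c x q k : R) :
  x <= c + x / 4 + (x / 4 + 64 * q ^+ 2 * c * k) + 16 * q * c ->
  x <= 2 * c * (1 + 64 * q ^+ 2 * k + 16 * q).
Proof.
have -> : 2 * c * (1 + 64 * q ^+ 2 * k + 16 * q)
  = 2 * (c + 64 * q ^+ 2 * c * k + 16 * q * c) by ring.
by move=> h; lra.
Qed.

Section OneModel.
Variable m : haar_model R.
Local Notation N := (dim m).
Local Notation v := (vec m).
Local Notation mx := 'M[C]_N.
Local Notation stab := (unitary_stabilizer v).
Local Notation E := (@E R m).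
Local Notation Er := (@Er R m).
Local Notation letter := (mx + mx)%type.
Local Notation P := (prj m).

Lemma dim_gt0 : (0 < N)%N. Proof. exact: leq_trans (dim_ge2 m). Qed.

Lemma nc_vec c (X : mx) : opbd c X -> nc (dotc v (X *m v)) <= c.
Proof. by move=> h; have := h v v; rewrite vec_unit !mulr1. Qed.

Lemma tr_prjM (X : mx) : \tr (P *m X) = \tr X - dotc v (X *m v).
Proof.
rewrite /prj mulmxBl mul1mx linearB /= -mulmxA mxtrace_mulC -mulmxA.
by congr (_ - _); rewrite /dotc /mxtrace big_ord1.
Qed.

Lemma tr_vec (X : mx) : \tr (v *m v^t* *m X) = dotc v (X *m v).
Proof. by rewrite -mulmxA mxtrace_mulC -mulmxA /dotc /mxtrace big_ord1. Qed.

Lemma stab_unitary u : stab u -> u \is unitarymx. Proof. by case. Qed.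

Lemma bmC_prj s : bmC (fun u : mx => \tr (P *m wev u s)).
Proof. by apply: bmM_tr; apply: bmMM (bmM_wev s); exact: bmM_cst. Qed.

Lemma bmC_trw s : bmC (fun u : mx => \tr (wev u s)).
Proof. by apply: bmM_tr; exact: bmM_wev. Qed.

Lemma bmR_Z (r : R) (g : mx -> R) : bmR g -> bmR (fun u => r * g u).
Proof. by move=> hg; exact: bmRM (bmR_cst m r) hg. Qed.

(** Every letter contributes at most two terms to [cuts]; they are bounded
    separately, after weighting by a further factor [T]. *)
Lemma E_cuts_le (G : mx -> mx) (T : mx -> C) (kappa : R) s1 s2 :
  0 <= kappa -> bmM G -> bmC T ->
  (forall r1 b r2, s2 = r1 ++ inr b :: r2 ->
     nc (E (fun u => \tr (P *m wev u (s1 ++ r1))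
                   * \tr (G u *m P *m wev u (inr b :: r2)) * T u)) <= kappa
  /\ nc (E (fun u => \tr (P *m wev u (s1 ++ rcons r1 (inr b)))
                   * \tr (G u *m P *m wev u r2) * T u)) <= kappa) ->
  nc (E (fun u => cuts u (G u) (wev u s1) s2 * T u)) <= (size s2)%:R * (2 * kappa).
Proof.
move=> k0 hG hT; elim: s2 s1 => [|l s2 IH] s1 h.
  have -> : (fun u => cuts u (G u) (wev u s1) [::] * T u) = (fun _ => 0).
    by apply/funext => u; rewrite mul0r.
  by rewrite E_cst nc0 mul0r.
have hP : bmM (fun _ : mx => P) by exact: bmM_cst.
have bw s : bmC (fun u => \tr (G u *m P *m wev u s)).
  by apply: bmM_tr; apply: bmMM (bmM_wev s); exact: bmMM.
have bc s s' : bmC (fun u => cuts u (G u) (wev u s) s' * T u).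
  by apply: bmCM => //; apply: bmC_cuts => //; exact: bmM_wev.
have IHl : nc (E (fun u => cuts u (G u) (wev u (rcons s1 l)) s2 * T u))
    <= (size s2)%:R * (2 * kappa).
  apply: IH => r1 b r2 e; have := h (l :: r1) b r2; rewrite e => /(_ erefl).
  by rewrite -!cats1 -!catA.
case: l h IHl => [a|b] h IHl.
  have -> : E (fun u => cuts u (G u) (wev u s1) (inl a :: s2) * T u)
      = E (fun u => cuts u (G u) (wev u (rcons s1 (inl a))) s2 * T u).
    by apply: eq_E => u _; rewrite /= add0r wev_rcons.
  apply: le_trans IHl _; rewrite ler_wpM2r ?ler_nat //.
  by rewrite mulr_ge0.
have [h1] := h [::] b s2 erefl; rewrite [rcons _ _]/= => h2.
have -> : E (fun u => cuts u (G u) (wev u s1) (inr b :: s2) * T u)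
  = (E (fun u => \tr (P *m wev u (s1 ++ [::])) * \tr (G u *m P *m wev u (inr b :: s2)) * T u)
   - E (fun u => \tr (P *m wev u (s1 ++ [:: inr b])) * \tr (G u *m P *m wev u s2) * T u))
  + E (fun u => cuts u (G u) (wev u (rcons s1 (inr b))) s2 * T u).
  have bb s s' : bmC (fun u => \tr (P *m wev u s) * \tr (G u *m P *m wev u s') * T u).
    by do !apply: bmCM => //; exact: bmC_prj.
  rewrite -EB // -ED //; last exact: bmCB.
  apply: eq_E => u _ /=; rewrite cats0 cats1 wev_rcons /=; ring.
apply: le_trans (ncD _ _) _; apply: le_trans (lerD (ncB _ _) IHl) _.
rewrite [size (_ :: _)]/= -[(size s2).+1%:R]natr1 [leRHS]mulrDl mul1r [leRHS]addrC lerD2r.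
by rewrite mulr2n mulrDl mul1r; exact: lerD h1 h2.
Qed.

Lemma E_real g : E (fun u => (g u)%:C) = (Er g)%:C.
Proof. by rewrite EE /= Er_cst. Qed.

Lemma dimB1 : (N%:R - 1 : R) >= 1 /\ (N%:R : R) <= 2 * (N%:R - 1).
Proof. have h : (2 : R) <= N%:R by rewrite ler_nat dim_ge2.
by split; lra. Qed.

Lemma tr_prj_sqr (c : R) (X : mx) : opbd c X ->
  nc (\tr (P *m X)) ^+ 2 <= 2 * nc (\tr X) ^+ 2 + 2 * c ^+ 2.
Proof.
move=> hX; rewrite tr_prjM.
have h1 := ncB (\tr X) (dotc v (X *m v)); have h2 := nc_vec hX.
have := nc_ge0 (\tr X); have := nc_ge0 (dotc v (X *m v)).
have := nc_ge0 (\tr X - dotc v (X *m v)).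
set y := nc (_ - _) in h1 *; set z := nc (dotc _ _) in h1 h2 *.
set x := nc (\tr X) in h1 * => y0 z0 x0.
have : y ^+ 2 <= (x + z) ^+ 2 by rewrite lerXn2r ?nnegrE ?addr_ge0.
have : z ^+ 2 <= c ^+ 2 by rewrite lerXn2r ?nnegrE // (le_trans z0).
by move=> a1 a2; have a3 := sqr_ge0 (x - z); lra.
Qed.

Lemma tr_prj_le (c : R) (X : mx) : 0 <= c -> opbd c X -> nc (\tr (P *m X)) <= N%:R * (2 * c).
Proof. by move=> c0 hX; apply: opbd_tr; apply: opbdM => //; exact: opbd_prj. Qed.

(** The even case of the induction bounding the fluctuations: in the
    Schwinger-Dyson equation of the word against the conjugate of its own
    trace, the first cut gives [N - 1] times the second moment, up to the value
    of the word in the state of the vector; every other cut is the trace of a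
    shorter alternating word times a factor at most of order [N]; and the trace
    merged from the two words is of order [N], by the operator bounds. *)
Lemma trace_L2_even n (M K : R) b s : 1 <= M -> 0 <= K ->
  (forall r, sorted (@alt mx mx) r -> (0 < size r <= n)%N -> goodw M r ->
     Er (fun u => nc (\tr (wev u r)) ^+ 2) <= K) ->
  sorted (@alt mx mx) (inr b :: s) -> (size s <= n)%N -> is_inl (last (inr b) s) ->
  goodw M (inr b :: s) ->
  Er (fun u => nc (\tr (wev u (inr b :: s))) ^+ 2) <=
    (let c := M ^+ n.+1 in
     2 * c ^+ 2 * (1 + 64 * n.+1%:R ^+ 2 * (2 * K + 2 * c ^+ 2) + 16 * n.+1%:R)).
Proof.
move=> M1 K0 hK hs sn sl gs /=; set c := M ^+ n.+1; set w := inr b :: s in hs gs *.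
have M0 : 0 <= M by lra.
have c1 : 1 <= c by exact: exprn_ege1.
have c0 : 0 <= c by lra.
(* [d] is the weight in Young's inequality for which the second moment [x]
   reappears on the right with the factor [1 / 4], see [even_weight] *)
set x := Er _; pose q : R := n.+1%:R; pose d := (32 * c * q)^-1.
have q1 : 1 <= q by rewrite ler1n.
have qn0 : q != 0 by rewrite pnatr_eq0.
have cn0 : c != 0 by apply/eqP; lra.
have d0 : 0 < d by rewrite invr_gt0 !mulr_gt0 //; lra.
have [N1 N2] := dimB1.
pose T := fun u : mx => \tr (wev u w); pose Tb := fun u : mx => \tr (wev u (wadj w)).
have TbE u : Tb u = Num.conj (T u) by rewrite /Tb wev_adj trC_tr.
have bT : bmC T by exact: bmC_trw.
have bTb : bmC Tb by exact: bmC_trw.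
have bT2 : bmR (fun u => nc (T u) ^+ 2) by exact: bmR_sqr.
have x0 : 0 <= x by apply: Er_ge0 => u _; exact: sqr_ge0.
pose K2 := 2 * K + 2 * c ^+ 2; pose h := 2 * c * (d * x + (4 * d)^-1 * K2).
have h0 : 0 <= h.
  have c2 := sqr_ge0 c; apply: mulr_ge0; first by apply: mulr_ge0.
  apply: addr_ge0; first by apply: mulr_ge0 => //; exact: ltW.
  apply: mulr_ge0; first by rewrite invr_ge0 mulr_ge0 // ltW.
  by rewrite /K2 addr_ge0 // mulr_ge0.
(* a cut into a piece of order [N] and a shorter alternating word [r'] *)
have cut_le r r' : goodw M r -> (size r <= n.+1)%N -> goodw M r' ->
    sorted (@alt mx mx) r' -> (0 < size r' <= n)%N ->
    nc (E (fun u => \tr (P *m wev u r) * \tr (1%:M *m P *m wev u r') * Tb u)) <= N%:R * h.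
  move=> gr sr gr' ar' sr'.
  pose g u := N%:R * (2 * c) * (d * nc (T u) ^+ 2 + (4 * d)^-1 * (2 * nc (\tr (wev u r')) ^+ 2 + 2 * c ^+ 2)).
  have b2 : bmR (fun u : mx => nc (\tr (wev u r')) ^+ 2) by exact/bmR_sqr/bmC_trw.
  have b3 : bmR (fun u : mx => 2 * nc (\tr (wev u r')) ^+ 2 + 2 * c ^+ 2).
    by apply: bmRD; [exact: bmR_Z | exact: bmR_cst].
  have bg : bmR g by apply: bmR_Z; apply: bmRD; exact: bmR_Z.
  apply: (@le_trans _ _ (Er g)).
    apply: nc_E_le => // [|u su]; first by do !apply: bmCM => //; rewrite ?mul1mx; exact: bmC_prj.
    have uu := stab_unitary su; rewrite /g mul1mx TbE !ncM ncJ -[leLHS]mulrA.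
    have w1 := tr_prj_le c0 (opbd_wev_le M1 uu gr sr).
    have w2 := tr_prj_sqr (opbd_wev_le M1 uu gr' (leqW (proj2 (andP sr')))).
    rewrite -/c in w1 w2; apply: ler_pM; rewrite ?mulr_ge0 ?nc_ge0 //.
    apply: (@le_trans _ _ (d * nc (T u) ^+ 2 + (4 * d)^-1 * nc (\tr (P *m wev u r')) ^+ 2)).
      exact: young.
    by rewrite lerD2l ler_wpM2l // invr_ge0; lra.
  rewrite /g ErZ; last by apply: bmRD; exact: bmR_Z.
  rewrite ErD; [|exact: bmR_Z|exact: bmR_Z]; rewrite ErZ // ErZ //.
  rewrite ErD; [|exact: bmR_Z|exact: bmR_cst]; rewrite ErZ // Er_cst.
  rewrite /h [leRHS]mulrA ler_wpM2l ?mulr_ge0 //.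
  have i0 : 0 <= (4 * d)^-1 by rewrite invr_ge0 mulr_ge0 // ltW.
  rewrite lerD2l ler_wpM2l // /K2.
  by rewrite lerD2r ler_wpM2l // hK.
have D_le : nc (E (fun u => \tr (der u (P *m (wev u w *m 1%:M) *m P) (wadj w))))
    <= N%:R * (q * (8 * c ^+ 2)).
  have bD : bmC (fun u : mx => \tr (der u (P *m (wev u w *m 1%:M) *m P) (wadj w))).
    apply: bmM_tr; apply: bmM_der; apply: bmMM; last exact: bmM_cst.
    by apply: bmMM; [exact: bmM_cst | apply: bmMM; [exact: bmM_wev | exact: bmM_cst]].
  rewrite -[leRHS](Er_cst m); apply: nc_E_le => // [|u su]; first exact: bmR_cst.
  have uu := stab_unitary su.
  have hw : opbd c (wev u w) by apply: (opbd_wev_le M1 uu gs).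
  have c2 : 0 <= 2 * c by rewrite mulr_ge0.
  have hX : opbd (2 * c * 2) (P *m (wev u w *m 1%:M) *m P).
    by rewrite mulmx1; apply: opbdM => //; [apply: opbdM => //|]; exact: opbd_prj.
  have := opbd_tr (opbd_der M1 _ uu (goodw_adj gs) hX); rewrite size_wadj /= => /(_ _).
  move=> /(_ _) /le_trans; apply; first by rewrite mulr_ge0.
  rewrite ler_wpM2l //; apply: ler_pM => //; first by rewrite !mulr_ge0 // exprn_ge0.
    by rewrite ler_nat.
  apply: (@le_trans _ _ (2 * (2 * c * 2) * c)); last by rewrite le_eqVlt; apply/orP; left; apply/eqP; ring.
  by apply: ler_wpM2l; [rewrite !mulr_ge0 | rewrite ler_weXn2l].
pose V := fun u : mx => dotc v (wev u w *m v).
have VE u : V u = \tr (wev u w) - \tr (P *m wev u w).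
  by rewrite tr_prjM opprB addrC subrK.
have bV : bmC V.
  have -> : V = fun u => \tr (wev u w) - \tr (P *m wev u w) by apply/funext => u; exact: VE.
  by apply: bmCB; [exact: bmC_trw | exact: bmC_prj].
have V_le : nc (E (fun u => V u * Tb u)) <= c ^+ 2 + x / 4.
  apply: (@le_trans _ _ (Er (fun u => c ^+ 2 + 4^-1 * nc (T u) ^+ 2))).
    apply: nc_E_le => [||u su]; first exact: bmCM.
      by apply: bmRD; [exact: bmR_cst | exact: bmR_Z].
    have := nc_vec (opbd_wev_le M1 (stab_unitary su) gs (leqnn _)); rewrite ncM TbE ncJ.
    move=> h1; have h2 : nc (V u) <= c by apply: le_trans h1 _; rewrite ler_weXn2l.
    move: (nc_ge0 (T u)) (nc_ge0 (V u)) h2; set t := nc (T u); set y := nc (V u) => t0 y0 h2.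
    have : y * t <= c * t by rewrite ler_wpM2r.
    have := sqr_ge0 (c - 2^-1 * t).
    have -> : (c - 2^-1 * t) ^+ 2 = c ^+ 2 + 4^-1 * t ^+ 2 - c * t by field.
    by move=> a1 a2; lra.
  rewrite ErD; [|exact: bmR_cst|exact: bmR_Z].
  by rewrite Er_cst ErZ // [4^-1 * _]mulrC.
pose Y := fun u : mx => \tr (P *m wev u [:: inr b]) * \tr (1%:M *m P *m wev u s) * Tb u.
have bY : bmC Y by do !apply: bmCM => //; rewrite ?mul1mx; exact: bmC_prj.
have ss : (0 < size s)%N by case: (s) sl.
have srt : sorted (@alt mx mx) s by move: hs => /=; exact: path_sorted.
have gb : goodw M [:: inr b] by move: gs => /goodw_cons [gb _]; apply/goodw_cons.
have gss : goodw M s by case/goodw_cons: gs.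
have Y_le : nc (E Y) <= N%:R * h by apply: cut_le; rewrite // ss.
pose Z := fun u : mx => cuts u 1%:M (wev u [:: inr b]) s * Tb u.
have bZ : bmC Z.
  by apply: bmCM => //; apply: bmC_cuts; [exact: bmM_cst | exact: bmM_wev].
have Nh0 : 0 <= N%:R * h by rewrite mulr_ge0.
have Z_le : nc (E Z) <= n%:R * (2 * (N%:R * h)).
  apply: (@le_trans _ _ ((size s)%:R * (2 * (N%:R * h)))); last first.
    by apply: ler_wpM2r; [rewrite mulr_ge0 | rewrite ler_nat].
  apply: (@E_cuts_le (fun _ => 1%:M) Tb _ [:: inr b] s Nh0 (bmM_cst _) bTb).
  move=> r1 b' r2 e; have hr2 : (0 < size r2)%N.
    by move: sl; rewrite e last_cat /=; case: (r2).
  have gr1 : goodw M r1 /\ goodw M (inr b' :: r2) by apply/goodw_cat; rewrite -e.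
  have [gb' gr2] : good M (inr b') /\ goodw M r2 by apply/goodw_cons; case: gr1.
  have sz : (size r1 + (size r2).+1 = size s)%N by rewrite e size_cat.
  have sr : sorted (@alt mx mx) (inr b' :: r2).
    by move: srt; rewrite e => /cat_sorted2 [].

  have [gbb _] := (goodw_cons _ _ _).1 gb.
  have g1 : goodw M (inr b :: r1) by apply/goodw_cons; split=> //; case: gr1.
  have g2 : goodw M (inr b :: rcons r1 (inr b')).
    by apply/goodw_cons; split=> //; apply/goodw_rcons; split=> //; case: gr1.
  have [z1 z2 z3 z4] := split_sizes sz sn.
  have {z2}z2 : (size (inr b :: rcons r1 (inr b')) <= n.+1)%N by rewrite /= size_rcons.
  have {hr2 z4}z4 : (0 < size r2 <= n)%N by rewrite hr2.
  split; [exact: (cut_le _ _ g1 z1 gr1.2 sr z3)|].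
  exact: (cut_le _ _ g2 z2 gr2 (path_sorted sr) z4).
have bD : bmC (fun u : mx => \tr (der u (P *m (wev u w *m 1%:M) *m P) (wadj w))).
  apply: bmM_tr; apply: bmM_der; apply: bmMM; last exact: bmM_cst.
  by apply: bmMM; [exact: bmM_cst | apply: bmMM; [exact: bmM_wev | exact: bmM_cst]].
have eT : E (fun u => T u * Tb u) = x%:C.
  rewrite -E_real; apply: eq_E => u _; rewrite TbE; exact: mul_conjE.
pose nu : C := N%:R - 1.
have main : nu * x%:C = nu * E (fun u => V u * Tb u) + E Y - E Z
    - E (fun u => \tr (der u (P *m (wev u w *m 1%:M) *m P) (wadj w))).
  rewrite -eT -!EZ //; [|exact: bmCM|exact: bmCM].
  have bn f : bmC f -> bmC (fun u => nu * f u) by apply: bmCM; exact: bmC_cst.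
  have bVT : bmC (fun u => nu * (V u * Tb u)) by apply: bn; exact: bmCM.
  have bTT : bmC (fun u => nu * (T u * Tb u)) by apply: bn; exact: bmCM.
  rewrite -ED // -EB //; [|exact: bmCD]; rewrite -EB //; [|by apply: bmCB => //; exact: bmCD].
  rewrite -[RHS](addr0 _) -[X in _ = _ + X](schwinger_dyson 1%:M w (wadj w)) -ED; last 2 first.
  - by apply: bmCB => //; apply: bmCB => //; exact: bmCD.
  - by apply: bmCD => //; apply: bmCM => //; apply: bmC_cuts; exact: bmM_cst.
  apply: eq_E => u _; rewrite /Y /Z /= !mulmx1 !mul1mx tr_prj -/nu wev1 /= VE.
  rewrite -/w -/(T u) -/(Tb u); ring.
have nnu : nc nu = N%:R - 1.
  have -> : nu = (N%:R - 1 : R)%:C by rewrite rmorphB rmorph_nat rmorph1.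
  by rewrite nc_real //; lra.
have : (N%:R - 1) * x <= (N%:R - 1) * (c ^+ 2 + x / 4) + N%:R * h
    + n%:R * (2 * (N%:R * h)) + N%:R * (q * (8 * c ^+ 2)).
  rewrite -{1}nnu -{1}(nc_real x0) -ncM main.
  apply: le_trans (ncB _ _) (lerD _ D_le); apply: le_trans (ncB _ _) (lerD _ Z_le).
  apply: le_trans (ncD _ _) (lerD _ Y_le); rewrite ncM nnu ler_wpM2l //; lra.
have -> : (n%:R : R) = q - 1 by rewrite /q -natr1 addrK.
have he : 4 * q * h = x / 4 + 64 * q ^+ 2 * c ^+ 2 * K2.
  exact: even_weight.
move=> hx; have n0 : 0 < (N%:R - 1 : R) by exact: lt_le_trans ltr01 N1.
have q0 : 0 <= q by exact: ler0n.
have cq0 : 0 <= q * (8 * c ^+ 2) by apply: mulr_ge0 => //; apply: mulr_ge0 => //; exact: sqr_ge0.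
have qh0 : 0 <= 2 * q * h by apply: mulr_ge0 => //; exact: mulr_ge0.
have : (N%:R - 1) * x <= (N%:R - 1) * (c ^+ 2 + x / 4 + 4 * q * h + 16 * q * c ^+ 2).
  exact: even_absorb hx.
rewrite ler_pM2l // he -/q -/K2 => hx2.
move: hx2; exact: even_final.
Qed.

End OneModel.

End Fluctuations.
Section SecondMoments.
Variable R : realType.
Local Notation C := R[i].


(** The ends are multiplied by moving the last letter to the front, and
    their product is recentred: both words on the right are shorter and still
    alternating. *)
Lemma trace_merge_ends (m : haar_model R) (u : 'M[C]_(dim m)) l l' s :
  u \is unitarymx -> is_inl l = is_inl l' ->
  \tr (wev u (l :: rcons s l'))
    = \tr (wev u (lcenter (lmul l' l) :: s))
    + (dim m)%:R^-1 * \tr (lmx (lmul l' l)) * \tr (wev u s).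
Proof.
move=> uu ll'; rewrite !wev_cons wev_rcons mulmxA mxtrace_mulC mulmxA -lev_mul //.
by rewrite lev_center // mulmxDl linearD /= mul_scalar_mx linearZ.
Qed.

(** By induction on the length of the word. In odd length the two ends are of
    the same kind and [trace_merge_ends] applies; in even length the word can be
    rotated so that it starts with a conjugated letter, and [trace_L2_even]
    applies. A letter obtained by merging two ends is good with a larger
    constant, which is why the constant is quantified inside the induction. *)
Lemma trace_L2 n (M : R) : 1 <= M -> exists2 K, 0 <= K &
  forall (m : haar_model R) (s : seq ('M[C]_(dim m) + 'M[C]_(dim m))),
  sorted (@alt _ _) s -> (0 < size s <= n)%N -> goodw M s ->
  Er (m := m) (fun u => nc (\tr (wev u s)) ^+ 2) <= K.
Proof.
elim: n M => [|n IH] M M1.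
  by exists 0 => // m s _; case: (size s).
have M0 : 0 <= M by lra.
have M2 : 1 <= M ^+ 2 by exact: exprn_ege1.
have [K K0 hK] := IH (2 * M ^+ 2) ltac:(lra).
have MM : M <= 2 * M ^+ 2 by rewrite expr2; nra.
pose c := M ^+ n.+1.
pose K1 := 2 * c ^+ 2 * (1 + 64 * n.+1%:R ^+ 2 * (2 * K + 2 * c ^+ 2) + 16 * n.+1%:R).
have K10 : 0 <= K1.
  rewrite /K1; apply: mulr_ge0; first by rewrite mulr_ge0 // sqr_ge0.
  have c2 := sqr_ge0 c; have k2 : 0 <= 2 * K + 2 * c ^+ 2 by rewrite addr_ge0 // mulr_ge0.
  apply: addr_ge0; last by rewrite mulr_ge0.
  by apply: addr_ge0 => //; apply: mulr_ge0 => //; apply: mulr_ge0 => //; exact: sqr_ge0.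
pose K3 := 2 * K + 2 * (M ^+ 2) ^+ 2 * K.
have K30 : 0 <= K3 by rewrite addr_ge0 // !mulr_ge0 // exprn_ge0.
have M20 : 0 <= M ^+ 2 by exact: sqr_ge0.
exists (K + M ^+ 2 + K1 + K3) => [|m s hs /andP[s0 sn] gs].
  by apply: addr_ge0 => //; apply: addr_ge0 => //; exact: addr_ge0.
have hKm r : sorted (@alt _ _) r -> (0 < size r <= n)%N -> goodw M r ->
    Er (m := m) (fun u => nc (\tr (wev u r)) ^+ 2) <= K.
  by move=> ar sr gr; apply: hK => //; exact: goodw_ge gr.
have [sn'|sn'] := leqP (size s) n.
  by apply: le_trans (hKm _ hs _ gs) _; rewrite ?s0 //; lra.
have {sn' sn s0} sn : size s = n.+1 by lia.
case: s sn hs gs => // l s [sn] hs gs.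
case/lastP: s sn hs gs => [|s l'] sn hs gs.
  apply: (@le_trans _ _ (M ^+ 2)); last by lra.
  rewrite -[leRHS](Er_cst m); apply: Er_le => [||u su]; first exact/bmR_sqr/bmC_trw.
    exact: bmR_cst.
  rewrite wev1 lerXn2r ?nnegrE ?nc_ge0 //.
  have -> : \tr (lev u l) = \tr (lmx l).
    case: (l) => b //=; rewrite mxtrace_mulC mulmxA trC_unitary ?mul1mx //.
    by case: su.
  by have [_] := gs l (mem_head _ _).
have := alt_last hs; rewrite last_rcons size_rcons /=.
have [gl gsl'] := (goodw_cons _ _ _).1 gs.
have [gs' gl'] := (goodw_rcons _ _ _).1 gsl'.
have as' : sorted (@alt _ _) s by move: hs => /= /path_sorted; rewrite -cats1 => /cat_sorted2 [].
rewrite size_rcons in sn.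
have [os|os] := boolP (odd (size s)) => /= par; last first.
  have {}par : is_inl l' = ~~ is_inl l by rewrite par; case: (is_inl l).
  apply: (@le_trans _ _ K1); last by lra.
  case: l gl par hs gs => [a|b] gl par hs gs.
    have -> : (fun u => nc (\tr (wev u (inl a :: rcons s l'))) ^+ 2)
        = (fun u => nc (\tr (wev u (rcons (rcons s l') (inl a)))) ^+ 2).
      by apply/funext => u; rewrite wev_cons [in RHS]wev_rcons [in RHS]mxtrace_mulC.
    have el : last l' (rcons s l') = l' by rewrite last_rcons.
    have es : size (rcons s l') = n by rewrite size_rcons.
    case: (rcons s l') es el hs gs => [|[a'|b'] r] er el hs gs.
    - by move: sn; rewrite -er.
    - by move: hs.
    apply: (trace_L2_even (n := n) M1 K0 hKm).
    - move: hs => /= hs; rewrite rcons_path hs /=.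
      by move: el => /= ->; rewrite /alt par.
    - by rewrite size_rcons -er.
    - by rewrite last_rcons.
    by rewrite -rcons_cons; apply/goodw_rcons; case/goodw_cons: gs.
  apply: (trace_L2_even (n := n) M1 K0 hKm) => //.
  - by rewrite size_rcons sn.
  - by rewrite last_rcons par.
have {}par : is_inl l = is_inl l' by rewrite par; case: (is_inl l).
have s0 : (0 < size s)%N by case: (s) os.
pose l0 := lcenter (lmul l' l); pose t0 : C := (dim m)%:R^-1 * \tr (lmx (lmul l' l)).
have ol : opbd (M ^+ 2) (lmx (lmul l' l)).
  have [h1 _] := gl; have [h2 _] := gl'.
  rewrite expr2; case: (l) h1 (l') h2 par => b h1 [b' h2|b' h2] //= _; exact: opbdM.
have g0 : good (2 * M ^+ 2) l0 by apply: good_center => //; exact: dim_gt0.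
have nt0 : nc t0 <= M ^+ 2.
  rewrite /t0 ncM ncV nc_nat mulrC ler_pdivrMr ?ltr0n ?dim_gt0 // mulrC.
  exact: opbd_tr.
have a0 : sorted (@alt _ _) (l0 :: s).
  have il : is_inl l0 = is_inl l by rewrite /l0 is_inl_center is_inl_mul.
  move: hs; case: (s) => //= x r /andP[h1 h2].
  by move: h1 h2; rewrite /alt il rcons_path => -> /andP[-> _].
have b1 : bmR (m := m) (fun u => nc (\tr (wev u (l0 :: s))) ^+ 2) by exact/bmR_sqr/bmC_trw.
have b2 : bmR (m := m) (fun u => nc (\tr (wev u s)) ^+ 2) by exact/bmR_sqr/bmC_trw.
apply: (@le_trans _ _ (Er (m := m) (fun u => 2 * nc (\tr (wev u (l0 :: s))) ^+ 2
    + 2 * (M ^+ 2) ^+ 2 * nc (\tr (wev u s)) ^+ 2))).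
  apply: Er_le => [||u su]; first exact/bmR_sqr/bmC_trw.
    by apply: bmRD; exact: bmR_Z.
  rewrite trace_merge_ends //; last by case: su.
  rewrite -/l0 -/t0; move: (\tr _) (\tr _) => y x.
  have := ncD x (t0 * y); rewrite ncM.
  have := nc_ge0 (x + t0 * y); have := nc_ge0 x; have := nc_ge0 y; have := nc_ge0 t0.
  move: (nc (x + _)) (nc x) (nc y) (nc t0) nt0 => z p q t nt t_0 q_0 p_0 z_0 zl.
  have h1 : t * q <= M ^+ 2 * q by rewrite ler_wpM2r.
  have h2 : z ^+ 2 <= (p + M ^+ 2 * q) ^+ 2.
    by rewrite lerXn2r ?nnegrE ?addr_ge0 ?mulr_ge0 //; lra.
  apply: le_trans h2 _; have := sqr_ge0 (p - M ^+ 2 * q).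
  by move: (M ^+ 2) => k h3; rewrite -subr_ge0; apply: le_trans h3 _; rewrite le_eqVlt; apply/orP; left; apply/eqP; ring.
rewrite ErD; [|exact: bmR_Z|exact: bmR_Z]; rewrite !ErZ //.
have h1 : Er (m := m) (fun u => nc (\tr (wev u (l0 :: s))) ^+ 2) <= K.
  have z0 : (0 < size (l0 :: s) <= n)%N by rewrite /= sn leqnn.
  by apply: (hK m (l0 :: s) a0 z0); apply/goodw_cons; split; [|exact: goodw_ge gs'].
have h2 : Er (m := m) (fun u => nc (\tr (wev u s)) ^+ 2) <= K.
  by apply: (hKm s as' _ gs'); rewrite s0 -sn leqnSn.
have h3 := ler_wpM2l (_ : 0 <= 2 * (M ^+ 2) ^+ 2) h2.
have := h3 ltac:(by rewrite mulr_ge0 // sqr_ge0); rewrite /K3; lra.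
Qed.

End SecondMoments.

(** * Expected traces of alternating words *)

Section Asymptotics.
Variable R : realType.
Local Notation C := R[i].

Lemma double_pred_le (a n : nat) : (a < n)%N -> (1 + 2 * a <= 2 * n)%N.
Proof. by move=> h; lia. Qed.

Lemma subword_sizes (a b n : nat) : (a + b.+1 < n)%N ->
  [/\ (a.+1 <= n)%N, (a.+2 <= n)%N, (b.+1 <= n)%N & (b <= n)%N].
Proof. by move=> h; split; lia. Qed.

Lemma le1sqr (y : R) : y <= 1 + y ^+ 2.
Proof. by have h := sqr_ge0 (y - 2^-1); rewrite sqrrB in h; lra. Qed.

Section OneModel.
Variable m : haar_model R.
Local Notation N := (dim m).
Local Notation v := (vec m).
Local Notation mx := 'M[C]_N.
Local Notation stab := (unitary_stabilizer v).
Local Notation E := (@E R m).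
Local Notation Er := (@Er R m).
Local Notation letter := (mx + mx)%type.
Local Notation P := (prj m).

Variables (n : nat) (M K : R).
Hypotheses (M1 : 1 <= M) (K0 : 0 <= K).
Hypothesis hK : forall r, sorted (@alt mx mx) r -> (0 < size r <= n)%N -> goodw M r ->
     Er (fun u => nc (\tr (wev u r)) ^+ 2) <= K.

Let c := M ^+ n.
Let K2 := 2 * K + 2 * c ^+ 2.

Let c0 : 0 <= c.
Proof. by apply: exprn_ge0; exact: le_trans M1. Qed.

Lemma K2_ge0 : 0 <= K2.
Proof. by apply: addr_ge0; apply: mulr_ge0 => //; exact: sqr_ge0. Qed.

Lemma prj_L2 r : sorted (@alt mx mx) r -> (0 < size r <= n)%N -> goodw M r ->
  Er (fun u => nc (\tr (P *m wev u r)) ^+ 2) <= K2.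
Proof.
move=> ar sr gr; have b2 : bmR (m := m) (fun u => nc (\tr (wev u r)) ^+ 2) by exact/bmR_sqr/bmC_trw.
apply: (@le_trans _ _ (Er (fun u => 2 * nc (\tr (wev u r)) ^+ 2 + 2 * c ^+ 2))).
  apply: Er_le => [||u su]; first exact/bmR_sqr/bmC_prj.
    by apply: bmRD; [exact: bmR_Z | exact: bmR_cst].
  apply: tr_prj_sqr; apply: opbd_wev_le => //; first by case: su.
  by case/andP: sr.
rewrite ErD; [|exact: bmR_Z|exact: bmR_cst]; rewrite Er_cst ErZ //.
by rewrite /K2 lerD2r ler_wpM2l // hK.
Qed.

Lemma subwords (x : letter) s r1 b r2 : s = r1 ++ inr b :: r2 ->
  sorted (@alt mx mx) (x :: s) -> (size (x :: s) <= n)%N -> goodw M (x :: s) ->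
  [/\ sorted (@alt mx mx) (x :: r1), (size (x :: r1) <= n)%N & goodw M (x :: r1)] /\
  [/\ sorted (@alt mx mx) (x :: rcons r1 (inr b)), (size (x :: rcons r1 (inr b)) <= n)%N
    & goodw M (x :: rcons r1 (inr b))] /\
  [/\ sorted (@alt mx mx) (inr b :: r2), (size (inr b :: r2) <= n)%N & goodw M (inr b :: r2)] /\
  [/\ sorted (@alt mx mx) r2, (size r2 <= n)%N & goodw M r2].
Proof.
move=> -> hs sz gs; have e : x :: r1 ++ inr b :: r2 = (x :: rcons r1 (inr b)) ++ r2.
  by rewrite /= cat_rcons.
have sz' : (size r1 + (size r2).+1 < n)%N by move: sz; rewrite /= size_cat.
have [gg1 gg2] : goodw M (x :: r1) /\ goodw M (inr b :: r2) by apply/goodw_cat.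
have [ss1 ss2] := cat_sorted2 (hs : sorted _ ((x :: r1) ++ inr b :: r2)).
have hs' := hs; rewrite e in hs'; have [ss3 ss4] := cat_sorted2 hs'.
have gs' := gs; rewrite e in gs'; have [gg3 gg4] := (goodw_cat _ _ _).1 gs'.
have [z1 z2 z3 z4] := subword_sizes sz'.
by do !split=> //=; rewrite size_rcons.
Qed.

(** In the Schwinger-Dyson equation without a second word, every term but the
    first one is a product of two traces with bounded second moments. *)
Lemma E_prj_small b s : sorted (@alt mx mx) (inr b :: s) -> (size (inr b :: s) <= n)%N ->
  is_inl (last (inr b) s) -> goodw M (inr b :: s) ->
  (N%:R - 1) * nc (E (fun u => \tr (P *m wev u (inr b :: s)))) <= (2 * n)%:R * K2.
Proof.
move=> hs sz sl gs; set w := inr b :: s in hs sz gs *.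
pose T : mx -> C := fun=> 1.
have bT : bmC T by exact: bmC_cst.
have cut_le r r' : sorted (@alt mx mx) r -> (0 < size r <= n)%N -> goodw M r ->
    sorted (@alt mx mx) r' -> (0 < size r' <= n)%N -> goodw M r' ->
    nc (E (fun u => \tr (P *m wev u r) * \tr (1%:M *m P *m wev u r') * T u)) <= K2.
  move=> ar sr gr ar' sr' gr'.
  pose g u := 2^-1 * nc (\tr (P *m wev u r)) ^+ 2 + 2^-1 * nc (\tr (P *m wev u r')) ^+ 2.
  have b1 : bmR (m := m) (fun u => nc (\tr (P *m wev u r)) ^+ 2) by exact/bmR_sqr/bmC_prj.
  have b2 : bmR (m := m) (fun u => nc (\tr (P *m wev u r')) ^+ 2) by exact/bmR_sqr/bmC_prj.
  apply: (@le_trans _ _ (Er g)).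
    apply: nc_E_le => [||u su].
    - by do !apply: bmCM => //; rewrite ?mul1mx; exact: bmC_prj.
    - by apply: bmRD; exact: bmR_Z.
    have h2 : 0 < 2^-1 :> R by rewrite invr_gt0.
    have := young (nc (\tr (P *m wev u r))) (nc (\tr (P *m wev u r'))) h2.
    have -> : (4 * 2^-1)^-1 = 2^-1 :> R by field.
    by move=> h; rewrite /T mulr1 mul1mx ncM /g [leLHS]mulrC.
  rewrite ErD; [|exact: bmR_Z|exact: bmR_Z]; rewrite !ErZ //.
  have h1 := prj_L2 ar sr gr; have h2 := prj_L2 ar' sr' gr'.
  have h3 := lerD h1 h2; rewrite -mulrDr.
  by rewrite -(@ler_pM2l _ 2) // mulVKf ?pnatr_eq0 // [leRHS]mulrDl !mul1r.
have ss : (0 < size s)%N by case: (s) sl.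
have srt : sorted (@alt mx mx) s by move: hs; exact: path_sorted.
have [gb gss] := (goodw_cons _ _ _).1 gs.
pose Y := fun u : mx => \tr (P *m wev u [:: inr b]) * \tr (1%:M *m P *m wev u s) * T u.
have bY : bmC Y by do !apply: bmCM => //; rewrite ?mul1mx; exact: bmC_prj.
have n0 : (0 < n)%N by exact: leq_trans sz.
have Y_le : nc (E Y) <= K2.
  apply: (cut_le [:: inr b] s) => //; last by rewrite ss (ltnW sz).
  by apply/goodw_cons.
pose Z := fun u : mx => cuts u 1%:M (wev u [:: inr b]) s * T u.
have bZ : bmC Z by apply: bmCM => //; apply: bmC_cuts; [exact: bmM_cst | exact: bmM_wev].
have Z_le : nc (E Z) <= (size s)%:R * (2 * K2).
  apply: (@E_cuts_le _ _ (fun _ => 1%:M) T _ [:: inr b] s K2_ge0 (bmM_cst _) bT).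
  move=> r1 b' r2 e.
  have [[h1 h2 h3] [[k1 k2 k3] [[i1 i2 i3] [j1 j2 j3]]]] := subwords e hs sz gs.
  have hr2 : (0 < size r2)%N by move: sl; rewrite e last_cat /=; case: (r2).
  split; first exact: (cut_le _ _ h1 h2 h3 i1 i2 i3).
  by apply: (cut_le _ _ k1 k2 k3 j1 _ j3); rewrite hr2.
pose nu : C := N%:R - 1.
have nnu : nc nu = N%:R - 1.
  have -> : nu = (N%:R - 1 : R)%:C by rewrite rmorphB rmorph_nat rmorph1.
  by rewrite nc_real //; have [] := dimB1 m; lra.
have bP : bmC (fun u => \tr (P *m wev u w)) by exact: bmC_prj.
have main : nu * E (fun u => \tr (P *m wev u w)) = E Y - E Z.
  have N0 : (N%:R : C) != 0 by rewrite pnatr_eq0 -lt0n dim_gt0.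
  apply: (mulIf N0); apply/eqP; rewrite -subr_eq0 -EZ // -EB // [X in X - _]mulrC [X in _ - X]mulrC.
  have bnP : bmC (fun u => nu * \tr (P *m wev u w)) by apply: bmCM => //; exact: bmC_cst.
  have bYZ : bmC (fun u => Y u - Z u) by exact: bmCB.
  rewrite -mulrBr -EB // -EZ; last exact: bmCB.
  rewrite -(schwinger_dyson 1%:M w [::]); apply/eqP; apply: eq_E => u _.
  rewrite /Y /Z /T /= linear0 !mulmx1 !mul1mx tr_prj -/nu wev1 /= wev_nil mxtrace1 -/w.
  by ring.
rewrite -nnu -ncM main; apply: le_trans (ncB _ _) _.
apply: le_trans (lerD Y_le Z_le) _.
rewrite mulrA -{1}[K2]mul1r -mulrDl ler_wpM2r ?K2_ge0 // mulrC -natrM -(natrD _ 1) ler_nat.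
exact: double_pred_le.
Qed.

Let kv := 2 * c ^+ 2 * (1 + K2).

Let kv0 : 0 <= kv.
Proof.
apply: mulr_ge0; first by apply: mulr_ge0 => //; exact: sqr_ge0.
by apply: addr_ge0 => //; exact: K2_ge0.
Qed.

Lemma vec_outer_prj : v *m v^t* *m P = 0.
Proof. by rewrite -mulmxA vec_prj mulmx0. Qed.

Lemma opbd_lev_c u l : (0 < n)%N -> stab u -> good M l -> opbd c (lev u l).
Proof.
move=> n0 su [hl _]; have M0 : 0 <= M by exact: le_trans M1.
apply: opbd_ge (opbd_lev M0 (stab_unitary su) hl).
by rewrite /c -(prednK n0) exprS ler_peMr // exprn_ege1.
Qed.

(** In the state of the fixed vector, the part of a word that passes through
    the orthogonal complement after its first letter is of order [1 / N]: in
    the Schwinger-Dyson equation it is the only term with the factor [N - 1]. *)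
Lemma E_vec_small l s : sorted (@alt mx mx) (l :: s) -> (size (l :: s) <= n)%N ->
  goodw M (l :: s) ->
  (N%:R - 1) * nc (E (fun u => dotc v (lev u l *m P *m wev u s *m v))) <= (2 * n)%:R * kv.
Proof.
move=> hs sz gs; have n0 : (0 < n)%N by exact: leq_trans sz.
have N10 : 0 <= N%:R - 1 :> R by have [] := dimB1 m; lra.
case: s hs sz gs => [|x s] hs sz gs.
  have -> : (fun u => dotc v (lev u l *m P *m wev u [::] *m v)) = (fun=> 0).
    by apply/funext => u; rewrite wev_nil mulmx1 -mulmxA prj_vec mulmx0 /dotc mulmx0 mxE.
  by rewrite E_cst nc0 mulr0 mulr_ge0.
have [gl gxs] := (goodw_cons _ _ _).1 gs; have [gx gss] := (goodw_cons _ _ _).1 gxs.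
have hxs : sorted (@alt mx mx) (x :: s) by move: hs; exact: path_sorted.
have szx : (size (x :: s) <= n)%N by exact: ltnW sz.
pose G := fun u : mx => v *m v^t* *m lev u l.
have bG : bmM G by apply: bmMM (bmM_lev l); exact: bmM_cst.
pose T : mx -> C := fun=> 1.
have bT : bmC T by exact: bmC_cst.
have bgw r : bmC (fun u => \tr (G u *m P *m wev u r)).
  by apply: bmM_tr; apply: bmMM (bmM_wev r); apply: bmMM => //; exact: bmM_cst.
have cut_le r r' : sorted (@alt mx mx) r -> (0 < size r <= n)%N -> goodw M r ->
    goodw M r' -> (size r' <= n)%N ->
    nc (E (fun u => \tr (P *m wev u r) * \tr (G u *m P *m wev u r') * T u)) <= kv.
  move=> ar sr gr gr' sr'.
  have b1 : bmR (m := m) (fun u => nc (\tr (P *m wev u r)) ^+ 2) by exact/bmR_sqr/bmC_prj.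
  have b2 : bmR (m := m) (fun u => 1 + nc (\tr (P *m wev u r)) ^+ 2).
    by apply: bmRD => //; exact: bmR_cst.
  apply: (@le_trans _ _ (Er (fun u => 2 * c ^+ 2 * (1 + nc (\tr (P *m wev u r)) ^+ 2)))).
    apply: nc_E_le => [||u su]; [|exact: bmR_Z|].
      by do !apply: bmCM => //; exact: bmC_prj.
    have hz : nc (\tr (G u *m P *m wev u r')) <= 2 * c ^+ 2.
      rewrite /G -!mulmxA mulmxA tr_vec; apply: nc_vec.
      have c20 : 0 <= 2 * c by rewrite mulr_ge0.
      rewrite (_ : 2 * c ^+ 2 = c * (2 * c)); last by ring.
      apply: opbdM => //; first exact: opbd_lev_c.
      apply: opbdM => //; first exact: opbd_prj.
      by apply: opbd_wev_le => //; exact: stab_unitary.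
    rewrite /T mulr1 ncM mulrC; apply: ler_pM; rewrite ?nc_ge0 //.
    exact: le1sqr.
  rewrite ErZ // ErD //; last exact: bmR_cst.
  rewrite Er_cst /kv; apply: ler_wpM2l; first by apply: mulr_ge0 => //; exact: sqr_ge0.
  by rewrite lerD2l; exact: prj_L2.
pose Z := fun u : mx => cuts u (G u) (wev u [:: x]) s * T u.
have bZ : bmC Z by apply: bmCM => //; apply: bmC_cuts => //; exact: bmM_wev.
have Z_le : nc (E Z) <= (size s)%:R * (2 * kv).
  apply: (@E_cuts_le _ _ G T _ [:: x] s kv0 bG bT).
  move=> r1 b' r2 e.
  have [[h1 h2 h3] [[k1 k2 k3] [[i1 i2 i3] [j1 j2 j3]]]] := subwords e hxs szx gxs.
  split; first exact: (cut_le _ _ h1 h2 h3 i3 i2).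
  exact: (cut_le _ _ k1 k2 k3 j3 j2).
pose Y := fun u : mx => \tr (P *m wev u [:: x]) * \tr (G u *m P *m wev u s) * T u.
have bY : bmC Y by do !apply: bmCM => //; exact: bmC_prj.
have Y_le : nc (E Y) <= kv.
  by apply: cut_le => //; [apply/goodw_cons | exact: ltnW].
pose nu : C := N%:R - 1.
have nnu : nc nu = N%:R - 1.
  have -> : nu = (N%:R - 1 : R)%:C by rewrite rmorphB rmorph_nat rmorph1.
  by rewrite nc_real.
pose V := fun u => \tr (G u *m P *m wev u (x :: s)).
have VE : E (fun u => dotc v (lev u l *m P *m wev u (x :: s) *m v)) = E V.
  by apply: eq_E => u _; rewrite -tr_vec /V /G !mulmxA.
have bV : bmC V by exact: bgw.
have bnV : bmC (fun u => nu * V u) by apply: bmCM => //; exact: bmC_cst.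
(* the commutator of the first conjugated letter among [l] and [x] gives the
   factor [N - 1]; the other of these two letters is deterministic *)
have main : nc (nu * E V) <= nc (E Z) + nc (E Y).
  have sd := schwinger_dyson_letter l (x :: s) vec_outer_prj.
  case: l x @G @T @Z @Y @V hs sd {VE gl gx gxs hxs Z_le Y_le cut_le sz szx gs}
    bG bT bgw bZ bY bV bnV => [a|b] [x|b'] G T Z Y V // _ sd bG bT bgw bZ bY bV bnV.
    have -> : nu * E V = E Y - E Z; last by rewrite [leRHS]addrC; exact: ncB.
    rewrite -EZ // -EB //; apply/eqP; rewrite -subr_eq0 -EB //; last exact: bmCB.
    rewrite -sd; apply/eqP; apply: eq_E => u _.
    rewrite /V /Z /Y /T add0r [in RHS]/= !mulr1 !mulmx1 tr_prj -/nu mul1mx !wev1 /G; ring.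
  have -> : nu * E V = E Z; last by rewrite lerDl nc_ge0.
  rewrite -EZ //; apply/eqP; rewrite eq_sym -subr_eq0 -EB //.
  rewrite -sd; apply/eqP; apply: eq_E => u _.
  rewrite /V /Z /T tr_prj -/nu [cuts _ _ 1%:M _]/= add0r mul1mx wev1 /G mulr1; ring.
rewrite VE -nnu -ncM; apply: le_trans main _; apply: le_trans (lerD Z_le Y_le) _.
rewrite mulrA -{2}[kv]mul1r -mulrDl; apply: ler_wpM2r => //.
rewrite addrC mulrC -natrM -(natrD _ 1) ler_nat.
by apply: double_pred_le; apply: leq_trans sz; rewrite /= ltnW.
Qed.

End OneModel.
End Asymptotics.

Section TraceAlternating.
Variable R : realType.
Local Notation C := R[i].

Section OneModel.
Variable m : haar_model R.
Local Notation N := (dim m).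
Local Notation v := (vec m).
Local Notation mx := 'M[C]_N.
Local Notation stab := (unitary_stabilizer v).
Local Notation E := (@E R m).
Local Notation letter := (mx + mx)%type.
Local Notation P := (prj m).

Lemma stab_adj_vec (u : mx) : stab u -> u^t* *m v = v.
Proof. by move=> [uu uv]; rewrite -{1}uv mulmxA trC_unitary // mul1mx. Qed.

(** The vector does not see the conjugation, since it is fixed by the unitary;
    splitting the identity after the first letter peels that letter off. *)
Lemma vec_cons (u : mx) (l : letter) s : stab u ->
  dotc v (wev u (l :: s) *m v)
    = dotc v (lmx l *m v) * dotc v (wev u s *m v) + dotc v (lev u l *m P *m wev u s *m v).
Proof.
move=> su; have e : dotc v (lev u l *m v) = dotc v (lmx l *m v).
  case: l => b //=; rewrite -!mulmxA stab_adj_vec // -[u in u *m _]trmxCK -dotc_mulmx.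
  by rewrite stab_adj_vec.
rewrite -e wev_cons {1}(_ : lev u l = lev u l *m (v *m v^t*) + lev u l *m P); last first.
  by rewrite -mulmxDr /prj addrC subrK mulmx1.
rewrite !mulmxDl dotcDr; congr (_ + _); rewrite /dotc -!mulmxA.
rewrite [v^t* *m (wev u s *m v)]mx11_scalar !mul_mx_scalar -!scalemxAr.
by rewrite [LHS]mxE mulrC -mx11_scalar.
Qed.

Variables (n : nat) (M K : R).
Hypotheses (M1 : 1 <= M) (K0 : 0 <= K).
Hypothesis hK : forall r, sorted (@alt mx mx) r -> (0 < size r <= n)%N -> goodw M r ->
     Er (m := m) (fun u => nc (\tr (wev u r)) ^+ 2) <= K.

Let c := M ^+ n.
Let K2 := 2 * K + 2 * c ^+ 2.
Let kv := 2 * c ^+ 2 * (1 + K2).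

Let c1 : 1 <= c. Proof. exact: exprn_ege1. Qed.

Let K20 : 0 <= K2. Proof. exact: K2_ge0. Qed.

Let kv0 : 0 <= kv.
Proof. by rewrite /kv; apply: mulr_ge0; [apply: mulr_ge0 => //; exact: sqr_ge0 | apply: addr_ge0]. Qed.

Lemma bmC_vec s : bmC (m := m) (fun u => dotc v (wev u s *m v)).
Proof.
have -> : (fun u => dotc v (wev u s *m v)) = (fun u => \tr (v *m v^t* *m wev u s)).
  by apply/funext => u; rewrite tr_vec.
by apply: bmM_tr; apply: bmMM (bmM_wev s); exact: bmM_cst.
Qed.

Lemma E_vec s : sorted (@alt mx mx) s -> (size s <= n)%N -> goodw M s ->
  nc (E (fun u => dotc v (wev u s *m v)) - \prod_(l <- s) dotc v (lmx l *m v))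
    <= (size s)%:R * M ^+ size s * ((2 * n)%:R * kv / (N%:R - 1)).
Proof.
have [N1 _] := dimB1 m; have N10 : 0 < N%:R - 1 :> R by exact: lt_le_trans N1.
have M0 : 0 <= M by exact: le_trans M1.
set B := _ / _; have B0 : 0 <= B by apply: divr_ge0; [apply: mulr_ge0; [exact: ler0n|exact: kv0] | exact: ltW].
elim: s => [|l s IH] hs sz gs.
  have -> : (fun u : mx => dotc v (wev u [::] *m v)) = (fun=> 1).
    by apply/funext => u; rewrite wev_nil mul1mx dotcc vec_unit expr1n.
  by rewrite E_cst big_nil subrr nc0 !mul0r.
have [[hl _] gss] := (goodw_cons _ _ _).1 gs.
have IHs := IH (path_sorted hs) (ltnW sz) gss.
have ev := E_vec_small M1 K0 hK hs sz gs.
pose W := fun u => dotc v (lev u l *m P *m wev u s *m v).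
have bW : bmC (m := m) W.
  have -> : W = (fun u => \tr (v *m v^t* *m (lev u l *m P *m wev u s))).
    by apply/funext => u; rewrite tr_vec.
  apply: bmM_tr; apply: bmMM; first exact: bmM_cst.
  apply: bmMM (bmM_wev s); apply: bmMM (bmM_lev l) _; exact: bmM_cst.
have W_le : nc (E W) <= B.
  by rewrite /B ler_pdivlMr // mulrC.
set p := dotc v (lmx l *m v).
have e : E (fun u => dotc v (wev u (l :: s) *m v)) = p * E (fun u => dotc v (wev u s *m v)) + E W.
  rewrite -EZ; last exact: bmC_vec.
  rewrite -ED //; last by apply: bmCM; [exact: bmC_cst | exact: bmC_vec].
  by apply: eq_E => u su; rewrite vec_cons.
rewrite e big_cons addrAC -mulrBr; apply: le_trans (ncD _ _) _.
have np : nc p <= M by exact: nc_vec.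
rewrite ncM [size (_ :: _)]/= -[(size s).+1%:R]natr1 [M ^+ _.+1]exprS.
have Mk : 1 <= M ^+ (size s).+1 by exact: exprn_ege1.
have -> : ((size s)%:R + 1) * (M * M ^+ size s) * B
    = M * ((size s)%:R * M ^+ size s * B) + M * M ^+ size s * B by ring.
apply: lerD; first exact: ler_pM (nc_ge0 _) (nc_ge0 _) np IHs.
by apply: le_trans W_le _; rewrite -exprS ler_peMl.
Qed.

(** The trace is the sum of the trace on the orthogonal complement, which is
    small by [E_prj_small], and of the value in the state of the vector. *)
Lemma E_trace_inr b s : sorted (@alt mx mx) (inr b :: s) -> (size (inr b :: s) <= n)%N ->
  is_inl (last (inr b) s) -> goodw M (inr b :: s) ->
  nc (E (fun u => \tr (wev u (inr b :: s))) - \prod_(l <- inr b :: s) dotc v (lmx l *m v))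
    <= ((2 * n)%:R * K2 + n%:R * c * ((2 * n)%:R * kv)) / (N%:R - 1).
Proof.
move=> hs sz sl gs; set w := inr b :: s in hs sz gs *.
have [N1 _] := dimB1 m; have N10 : 0 < N%:R - 1 :> R by exact: lt_le_trans N1.
have e : E (fun u => \tr (wev u w)) = E (fun u => \tr (P *m wev u w))
    + E (fun u => dotc v (wev u w *m v)).
  rewrite -ED; [|exact: bmC_prj|exact: bmC_vec].
  by apply: eq_E => u _; rewrite tr_prjM subrK.
rewrite e -addrA; apply: le_trans (ncD _ _) _; rewrite mulrDl; apply: lerD.
  by rewrite ler_pdivlMr // mulrC; exact: (E_prj_small M1 K0 hK).
apply: le_trans (E_vec hs sz gs) _; rewrite -[leRHS]mulrA; apply: ler_wpM2r.
  by apply: divr_ge0; [apply: mulr_ge0; [exact: ler0n|exact: kv0] | exact: ltW].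
by apply: ler_pM; rewrite ?ler_nat ?exprn_ge0 ?ler_weXn2l ?(le_trans _ M1).
Qed.

End OneModel.

(** Both the trace and the product are unchanged when the first letter is
    moved to the end, so that the word may be assumed to start with a
    conjugated letter. *)
Theorem trace_alternating n (M : R) : 1 <= M -> exists2 K, 0 <= K &
  forall (m : haar_model R) (s : seq ('M[C]_(dim m) + 'M[C]_(dim m))),
  sorted (@alt _ _) s -> (0 < size s <= n)%N -> ~~ odd (size s) -> goodw M s ->
  nc (E (m := m) (fun u => \tr (wev u s))
      - \prod_(l <- s) dotc (vec m) (lmx l *m vec m)) <= K / (dim m)%:R.
Proof.
move=> M1; have [K K0 hK] := trace_L2 n M1.
pose c := M ^+ n; pose K2 := 2 * K + 2 * c ^+ 2; pose kv := 2 * c ^+ 2 * (1 + K2).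
pose D := (2 * n)%:R * K2 + n%:R * c * ((2 * n)%:R * kv).
have c0 : 0 <= c by apply: exprn_ge0; exact: le_trans M1.
have K20 : 0 <= K2 by apply: addr_ge0; apply: mulr_ge0 => //; exact: sqr_ge0.
have kv0 : 0 <= kv.
  by apply: mulr_ge0; [apply: mulr_ge0 => //; exact: sqr_ge0 | apply: addr_ge0].
have D0 : 0 <= D.
  by apply: addr_ge0; apply: mulr_ge0; rewrite ?ler0n //; apply: mulr_ge0.
exists (2 * D) => [|m s hs sz ev gs]; first by rewrite mulr_ge0.
have [N1 N2] := dimB1 m; have N10 : 0 < (dim m)%:R - 1 :> R by exact: lt_le_trans N1.
apply: (@le_trans _ _ (D / ((dim m)%:R - 1))); last first.
  rewrite ler_pdivrMr // mulrAC ler_pdivlMr ?ltr0n ?dim_gt0 //.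
  by rewrite [2 * D]mulrC -mulrA ler_wpM2l.
have main b r : sorted (@alt _ _) (inr b :: r) -> (size (inr b :: r) <= n)%N ->
    is_inl (last (inr b) r) -> goodw M (inr b :: r) ->
    nc (E (m := m) (fun u => \tr (wev u (inr b :: r)))
      - \prod_(l <- inr b :: r) dotc (vec m) (lmx l *m vec m)) <= D / ((dim m)%:R - 1).
  exact: (E_trace_inr M1 K0 (hK m)).
case: s hs sz ev gs => [//|[a|b] s] hs /andP[_ sz] ev gs; have := alt_last hs.
  case: s hs sz ev gs => [//|[a'|b] s] hs sz ev gs; first by move: hs.
  rewrite /= in ev; rewrite /= negbK in ev; rewrite [odd _]/= ev => sl.
  have -> : (fun u => \tr (wev u [:: inl a, inr b & s]))
      = (fun u => \tr (wev u (inr b :: rcons s (inl a)))).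
    by apply/funext => u; rewrite -rcons_cons wev_rcons mxtrace_mulC wev_cons.
  have -> : \prod_(l <- [:: inl a, inr b & s]) dotc (vec m) (lmx l *m vec m)
      = \prod_(l <- inr b :: rcons s (inl a)) dotc (vec m) (lmx l *m vec m).
    by rewrite -rcons_cons big_rcons /= big_cons mulrC.
  have [ga gbs] := (goodw_cons _ _ _).1 gs.
  apply: main; last by rewrite -rcons_cons; apply/goodw_rcons.
  - rewrite -rcons_cons /= rcons_path; apply/andP; split; first by case/andP: hs.
    by rewrite /alt; move: sl => /= ->.
  - by rewrite /= size_rcons.
  - by rewrite last_rcons.
by move=> sl; apply: main => //; rewrite sl /=; move: ev => /=; rewrite negbK.
Qed.

End TraceAlternating.

(** * Evaluation of noncommutative polynomials *)

Section NCPoly.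
Variable R : realType.
Local Notation C := R[i].

Section Algebra.
Variable K : choiceType.
Implicit Types (p q : ncpoly R K) (m : fmonom K) (a : C).

Definition ncmonom m a : ncpoly R K := mkmalgU m a.

Lemma ncpoly_ind (Q : ncpoly R K -> Prop) :
  (forall m a, Q (ncmonom m a)) -> (forall p q, Q p -> Q q -> Q (p + q)) -> forall p, Q p.
Proof.
move=> hU hD p; rewrite [p]monalgE; apply: (big_ind Q) => //.
by have := hU (fmone K) 0; rewrite /ncmonom monalgU0.
Qed.

Lemma ncmonomM m m' a a' : ncmonom m a * ncmonom m' a' = ncmonom (fmmul m m') (a * a').
Proof. exact: fgmulUU. Qed.

Lemma ncmonomZ m a b : a *: ncmonom m b = ncmonom m (a * b).
Proof. by apply/malgP => k; rewrite mcoeffZ !mcoeffU mulrnAr. Qed.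

Lemma ncmonom1 : 1 = ncmonom (fmone K) 1. Proof. by []. Qed.

Lemma ncpoly_scalerAr a p q : p * (a *: q) = a *: (p * q).
Proof.
elim/ncpoly_ind: p => [m b|p p' IH IH']; last first.
  rewrite (mulrDl p p' (a *: q)) (mulrDl p p' q) scalerDr.
  exact: (congr2 +%R IH IH').
elim/ncpoly_ind: q => [m' b'|q q' IH IH']; last first.
  rewrite (scalerDr a q q') (mulrDr _ (a *: q)) (mulrDr _ q) scalerDr.
  exact: (congr2 +%R IH IH').
by rewrite (ncmonomZ m') !ncmonomM ncmonomZ mulrCA.
Qed.

Lemma prod_ncvar (s : seq K) : \prod_(k <- s) ncvar R k = ncmonom (FMonom s) 1.
Proof.
elim: s => [|k s IH]; first by rewrite big_nil ncmonom1 fmoneE.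
by rewrite big_cons IH /ncvar fmuE ncmonomM mulr1 fmmulE.
Qed.

(** Extending a function of the monomials linearly, as both [mxeval] and
    [ncmap] do. *)
Definition linext (V : lmodType C) (h : fmonom K -> V) p : V :=
  \sum_(m <- msupp p) mcoeff m p *: h m.

Lemma linextEw (V : lmodType C) (h : fmonom K -> V) (d : finset_of (Phant (fmonom K))) p :
  fsubset (msupp p) d -> linext h p = \sum_(m <- d) mcoeff m p *: h m.
Proof.
move=> le; rewrite [LHS](big_fset_incl _ le) => //= x xd /mcoeff_outdom ->.
by rewrite scale0r.
Qed.

Lemma linextD (V : lmodType C) (h : fmonom K -> V) p q :
  linext h (p + q) = linext h p + linext h q.
Proof.
pose d := fsetU (msupp p) (msupp q).
rewrite (@linextEw _ h d (p + q)); last exact: msuppD_le.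
rewrite (@linextEw _ h d p) ?fsubsetUl // (@linextEw _ h d q) ?fsubsetUr //.
by rewrite -big_split /=; apply: eq_bigr => m _; rewrite mcoeffD scalerDl.
Qed.

Lemma linextU (V : lmodType C) (h : fmonom K -> V) m a : linext h (ncmonom m a) = a *: h m.
Proof. by rewrite (linextEw _ msuppU_le) big_seq_fset1 mcoeffUU. Qed.

Lemma linextZ (V : lmodType C) (h : fmonom K -> V) a p :
  linext h (a *: p) = a *: linext h p.
Proof.
elim/ncpoly_ind: p => [m b|p q IHp IHq]; first by rewrite ncmonomZ !linextU scalerA.
rewrite scalerDr (linextD h (a *: p)) (linextD h p) scalerDr.
exact: (congr2 +%R IHp IHq).
Qed.

End Algebra.

Section Substitution.
Variables (K L : choiceType) (f : K -> L).
Implicit Types p q : ncpoly R K.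

Lemma ncmapD p q : ncmap f (p + q) = ncmap f p + ncmap f q. Proof. exact: linextD. Qed.

Lemma ncmapZ a p : ncmap f (a *: p) = a *: ncmap f p. Proof. exact: linextZ. Qed.

Lemma ncmapU m a : ncmap f (ncmonom m a) = ncmonom (FMonom (map f m)) a.
Proof.
rewrite [LHS]linextU -[a in RHS]mulr1 -ncmonomZ -prod_ncvar; congr (_ *: _).
by rewrite big_map.
Qed.

Lemma ncmapM p q : ncmap f (p * q) = ncmap f p * ncmap f q.
Proof.
elim/ncpoly_ind: p => [m a|p p' IH IH']; last first.
  rewrite mulrDl (ncmapD (p * q)) (ncmapD p) mulrDl.
  exact: (congr2 +%R IH IH').
elim/ncpoly_ind: q => [m' a'|q q' IH IH']; last first.
  rewrite mulrDr (ncmapD (_ * q)) (ncmapD q) mulrDr.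
  exact: (congr2 +%R IH IH').
by rewrite ncmonomM !ncmapU ncmonomM !fmmulE /= map_cat.
Qed.

Lemma ncmap1 : ncmap f (1 : ncpoly R K) = 1.
Proof. by rewrite [1 in LHS]ncmonom1 ncmapU [RHS]ncmonom1 !fmoneE. Qed.

End Substitution.

Section Evaluation.
Variables (K : choiceType) (N : nat).
Local Notation mx := 'M[C]_N.
Implicit Types (A : K -> mx) (p q : ncpoly R K).

Definition mxmonom A (s : seq K) : mx := \big[mulmx/1%:M]_(k <- s) A k.

Lemma mxmonom_cons A k s : mxmonom A (k :: s) = A k *m mxmonom A s.
Proof. by rewrite /mxmonom big_cons. Qed.

Lemma mxmonom_nil A : mxmonom A [::] = 1%:M. Proof. by rewrite /mxmonom big_nil. Qed.

Lemma mxmonom_cat A s t : mxmonom A (s ++ t) = mxmonom A s *m mxmonom A t.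
Proof.
elim: s => [|k s IH]; first by rewrite mxmonom_nil mul1mx.
by rewrite cat_cons !mxmonom_cons IH mulmxA.
Qed.

Lemma mxevalD A p q : mxeval A (p + q) = mxeval A p + mxeval A q.
Proof. exact: linextD. Qed.

Lemma mxevalZ A a p : mxeval A (a *: p) = a *: mxeval A p.
Proof. exact: linextZ. Qed.

Lemma mxevalU A m a : mxeval A (ncmonom m a) = a *: mxmonom A m.
Proof. exact: linextU. Qed.

Lemma mxevalM A p q : mxeval A (p * q) = mxeval A p *m mxeval A q.
Proof.
elim/ncpoly_ind: p => [m a|p p' IH IH']; last first.
  rewrite mulrDl (mxevalD A (p * q)) (mxevalD A p) mulmxDl.
  exact: (congr2 +%R IH IH').
elim/ncpoly_ind: q => [m' a'|q q' IH IH']; last first.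
  rewrite mulrDr (mxevalD A (_ * q)) (mxevalD A q) mulmxDr.
  exact: (congr2 +%R IH IH').
by rewrite ncmonomM !mxevalU fmmulE mxmonom_cat -scalemxAl -scalemxAr scalerA.
Qed.

Lemma mxeval1 A : mxeval A (1 : ncpoly R K) = 1%:M.
Proof. by rewrite ncmonom1 mxevalU fmoneE mxmonom_nil scale1r. Qed.

Lemma mxeval_conj (u : mx) A p : u \is unitarymx ->
  mxeval (conjfam u A) p = u *m mxeval A p *m u^t*.
Proof.
move=> uu; elim/ncpoly_ind: p => [m a|p q IH IH']; last first.
  by rewrite !mxevalD IH IH' mulmxDr mulmxDl.
rewrite !mxevalU -scalemxAr -scalemxAl; congr (_ *: _).
elim: (m : seq K) => [|k s IH].
  by rewrite !mxmonom_nil mulmx1 (unitarymxP uu).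
rewrite !mxmonom_cons IH /conjfam !mulmxA.
by rewrite -(mulmxA _ (u^t*) u) trC_unitary // mulmx1.
Qed.

End Evaluation.

Lemma opbd_mxeval (K : choiceType) (M : R) (p : ncpoly R K) : 0 <= M -> exists2 c, 0 <= c &
  forall N (A : K -> 'M[C]_N), (forall k, opbd M (A k)) -> opbd c (mxeval A p).
Proof.
move=> M0; elim/ncpoly_ind: p => [m a|p q [c c0 hc] [d d0 hd]]; last first.
  exists (c + d) => [|N A hA]; first exact: addr_ge0.
  by rewrite mxevalD; apply: opbdD; [exact: hc | exact: hd].
exists (nc a * M ^+ size (m : seq K)) => [|N A hA].
  by rewrite mulr_ge0 ?nc_ge0 ?exprn_ge0.
rewrite mxevalU; apply: opbdZ; elim: (m : seq K) => [|k s IH].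
  by rewrite mxmonom_nil expr0; exact: opbd1.
by rewrite mxmonom_cons exprS; apply: opbdM => //; exact: exprn_ge0.
Qed.

Lemma mxeval_ncmap (K L : choiceType) (N : nat) (f : K -> L) (D : L -> 'M[C]_N) p :
  mxeval D (ncmap f p) = mxeval (D \o f) p.
Proof.
elim/ncpoly_ind: p => [m a|p q IH IH']; last first.
  by rewrite ncmapD (mxevalD D) (mxevalD (D \o f)); exact: (congr2 +%R IH IH').
rewrite ncmapU !mxevalU; congr (_ *: _) => /=.
by rewrite /mxmonom big_map.
Qed.

End NCPoly.

(** * Alternating centered words span the free product *)

Section Spanning.
Variables (R : realType) (K : choiceType).
Local Notation C := R[i].
Local Notation pA := (ncpoly R K).
Local Notation pF := (ncpoly R (K + K)%type).
Local Notation factor := (pA + pA)%type.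
Local Notation j1 := (ncmap (R := R) (@inl K K)).
Local Notation j2 := (ncmap (R := R) (@inr K K)).
Local Notation inj := (inj_factor j1 j2).
Implicit Types (x y : factor) (s : seq factor).

Variable psi : {scalar pF}.
Hypothesis psi1 : psi 1 = 1.

Definition fmulr x y : factor :=
  match x, y with
  | inl a, inl b => inl (a * b)
  | inr a, inr b => inr (a * b)
  | _, _ => x
  end.

Lemma inj_fmul x y : is_inl x = is_inl y -> inj (fmulr x y) = inj x * inj y.
Proof. by case: x => a; case: y => b //= _; rewrite ncmapM. Qed.

Lemma is_inl_fmul x y : is_inl (fmulr x y) = is_inl x.
Proof. by case: x => a; case: y. Qed.

Definition fcenter x : factor :=
  match x with
  | inl a => inl (a - psi (inj x) *: 1)
  | inr a => inr (a - psi (inj x) *: 1)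
  end.

Lemma inj_center x : inj x = inj (fcenter x) + psi (inj x) *: 1.
Proof.
by case: x => a; set c := psi _; rewrite /= -/(ncmap _ _) -scaleNr ncmapD ncmapZ ncmap1 scaleNr subrK.
Qed.

Lemma psi_center x : psi (inj (fcenter x)) = 0.
Proof.
have := congr1 psi (inj_center x); rewrite linearD linearZ /= psi1 mulr1.
by move=> /eqP; rewrite -subr_eq subrr => /eqP <-.
Qed.

Lemma is_inl_fcenter x : is_inl (fcenter x) = is_inl x. Proof. by case: x. Qed.

Definition fprod s : pF := \prod_(x <- s) inj x.

Lemma fprod_cons x s : fprod (x :: s) = inj x * fprod s.
Proof. by rewrite /fprod big_cons. Qed.

Lemma fprod_cat s t : fprod (s ++ t) = fprod s * fprod t.
Proof. by rewrite /fprod big_cat. Qed.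

Lemma fprod_rcons s x : fprod (rcons s x) = fprod s * inj x.
Proof. by rewrite -cats1 fprod_cat fprod_cons /fprod big_nil mulr1. Qed.

Lemma not_alternating s : ~~ sorted (@alt pA pA) s ->
  exists s1 x y s2, s = s1 ++ x :: y :: s2 /\ is_inl x = is_inl y.
Proof.
case: s => [//|x s] /=; elim: s x => [//|y s IH] x /=; rewrite negb_and => /orP[h|/IH].
  by exists [::], x, y, s; split=> //; move: h; rewrite /alt negbK => /eqP.
by move=> [s1 [x' [y' [s2 [e h]]]]]; exists (x :: s1), x', y', s2; rewrite e.
Qed.

Lemma alt_cycle x s : sorted (@alt pA pA) (x :: s) -> odd (size s) ->
  cycle (@other_factor C pA pA) (x :: s).
Proof.
move=> hs os; have := alt_last hs; rewrite os => hl.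
rewrite /cycle rcons_path; apply/andP; split; first exact: hs.
by rewrite /other_factor hl; case: (is_inl x).
Qed.

Variable S : pF -> Prop.
Hypothesis SD : forall p q, S p -> S q -> S (p + q).
Hypothesis SZ : forall (c : C) p, S p -> S (c *: p).
Hypothesis S_factor : forall x, S (inj x).
Hypothesis S_cyc : forall s, cyclically_alternating s -> centered j1 j2 psi s -> S (fprod s).
Hypothesis S_ends : forall x y s, is_inl x = is_inl y -> (0 < size s)%N ->
  Defs.alternating (x :: rcons s y) -> centered j1 j2 psi (x :: rcons s y) ->
  S (fprod (fmulr y x :: s)) -> S (fprod (x :: rcons s y)).

Lemma S_centering n s1 s2 :
  (forall s, (0 < size s <= n)%N -> S (fprod s)) -> (0 < n)%N ->
  (size s1 + size s2 = n.+1)%N ->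
  S (fprod (s1 ++ map fcenter s2)) -> S (fprod (s1 ++ s2)).
Proof.
move=> IH n0; elim: s2 s1 => [//|x s2 IHs] s1 /= sz hS.
have -> : fprod (s1 ++ x :: s2)
    = fprod (rcons s1 (fcenter x) ++ s2) + psi (inj x) *: fprod (s1 ++ s2).
  rewrite cat_rcons !fprod_cat !fprod_cons [inj x]inj_center mulrDl mulrDr.
  by rewrite -scalerAl mul1r ncpoly_scalerAr -inj_center.
apply: SD; last first.
  by apply/SZ/IH; rewrite size_cat; move: sz; rewrite addnS => -[->]; rewrite n0 leqnn.
apply: IHs; first by rewrite size_rcons -sz addnS.
by rewrite cat_rcons.
Qed.

(** Words that are not alternating shorten by multiplying two neighbours;
    alternating words are centered modulo shorter words; what remains is
    cyclically alternating, or has two ends of the same kind. *)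
Lemma S_fprod n s : (0 < size s <= n)%N -> S (fprod s).
Proof.
elim: n s => [|n IH] s; first by case: (size s).
case/andP => s0; rewrite leq_eqVlt => /orP[/eqP sn|]; last first.
  by move=> sn; apply: IH; rewrite s0.
case: n => [|n] in IH sn *.
  by case: s sn {s0} => [|x [|y s]] // _; rewrite fprod_cons /fprod big_nil mulr1.
have [as_|/not_alternating [s1 [x [y [s2 [e xy]]]]]] := boolP (sorted (@alt pA pA) s); last first.
  have -> : fprod s = fprod (s1 ++ fmulr x y :: s2).
    rewrite e (fprod_cat s1 [:: x, y & s2]) (fprod_cat s1 (fmulr x y :: s2)).
    by rewrite (fprod_cons x) (fprod_cons y) (fprod_cons (fmulr x y)) (inj_fmul xy) (mulrA (inj x)).
  apply: IH; move: sn; rewrite e !size_cat /= !addnS => -[->].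
  by rewrite leqnn.
rewrite -[s]cat0s; apply: (S_centering (n := n.+1)) => //.
rewrite cat0s; set t := map fcenter s.
have tn : size t = n.+2 by rewrite size_map.
have at_ : sorted (@alt pA pA) t.
  rewrite /t sorted_map; apply: sub_sorted as_ => x y.
  by rewrite /alt /= !is_inl_fcenter.
have ct : centered j1 j2 psi t.
  by apply/allP => _ /mapP[x _ ->]; apply/eqP; exact: psi_center.
case: t tn at_ ct => [//|x t] [tn] at_ ct.
have [ot|et] := boolP (odd (size t)).
  by apply: S_cyc => //; rewrite /cyclically_alternating alt_cycle.
case/lastP: t tn at_ ct et => [//|t y] tn at_ ct et.
have xy : is_inl x = is_inl y.
  have := alt_last at_; rewrite last_rcons (negbTE et) addbF; exact: esym.
have t0 : (0 < size t)%N by move: et; rewrite size_rcons /=; case: (t).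
apply: S_ends => //; apply: IH => /=.
by move: tn; rewrite size_rcons => -[->].
Qed.

Lemma S_all p : S p.
Proof.
elim/ncpoly_ind: p => [m a|p q hp hq]; last exact: SD.
rewrite -[a]mulr1 -ncmonomZ; apply: SZ.
case: m => m; case: m => [|k m].
  have -> : ncmonom (FMonom [::]) 1 = inj (inl 1) by rewrite /= ncmap1 ncmonom1 fmoneE.
  exact: S_factor.
pose f (k : (K + K)%type) : factor :=
  match k with inl k => inl (ncvar R k) | inr k => inr (ncvar R k) end.
have fE k' : inj (f k') = ncvar R k'.
  by case: k' => k' /=; rewrite /ncvar !fmuE ncmapU.
have -> : ncmonom (FMonom (k :: m)) 1 = fprod (map f (k :: m)).
  rewrite -prod_ncvar /fprod big_map; apply: eq_bigr => k' _; exact/esym/fE.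
by apply: (S_fprod (n := size (k :: m))); rewrite size_map leqnn.
Qed.

End Spanning.

(** * Error terms *)

Section ErrorClass.
Variable R : realType.
Local Notation C := R[i].

(** The two kinds of error terms obey the same rules, which are all that the
    argument needs: [error_class] is stated for errors of traces that are not
    normalized, that is for [o(1)] and [O(1/N)]. *)
Record error_class (S0 : (nat -> C) -> Prop) : Prop := ErrorClass {
  error_dom : forall f g (c : R), S0 g ->
    (\forall N \near \oo, nc (f N) <= c * nc (g N)) -> S0 f;
  errorD : forall f g, S0 f -> S0 g -> S0 (fun N => f N + g N);
  error_inv : S0 (fun N => N%:R^-1);
  error_bounded : forall f, S0 f -> \forall N \near \oo, nc (f N) <= 1 }.

Lemma nc_invpow (k N : nat) : nc (N%:R ^- k) = (N%:R ^+ k)^-1 :> R.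
Proof. by rewrite ncV; elim: k => [|k IH]; rewrite ?expr0 ?nc1 // !exprS !invfM ncM invfM IH nc_nat. Qed.

Lemma is_o_invpowE k (f : nat -> C) : is_o_invpow k f <->
  (forall e : R, 0 < e -> \forall N \near \oo, nc (f N) <= e * (N%:R ^+ k)^-1).
Proof.
rewrite /is_o_invpow eqoP; split=> [h e e0|h e].
  have e0' : 0 < (e%:C : C) by rewrite ltcR.
  have := h _ e0'; apply: filterS => N.
  by rewrite !normE nc_invpow -rmorphM /= lecR.
case: e => a b; rewrite ltcE /= => /andP[/eqP b0 a0]; rewrite b0.
have := h _ a0; apply: filterS => N h1.
by rewrite !normE nc_invpow -[a +i* 0]/(a%:C) -rmorphM /= lecR.
Qed.

Lemma is_O_invpowE k (f : nat -> C) : is_O_invpow k f <->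
  (exists2 c : R, 0 < c & \forall N \near \oo, nc (f N) <= c * (N%:R ^+ k)^-1).
Proof.
rewrite /is_O_invpow eqO_exP; split=> [[e]|[c c0 h]].
  case: e => a b; rewrite ltcE /= => /andP[/eqP b0 a0]; rewrite b0 => h.
  exists a => //; move: h; apply: filterS => N.
  by rewrite !normE nc_invpow -[a +i* 0]/(a%:C) -rmorphM /= lecR.
exists c%:C; first by rewrite ltcR.
move: h; apply: filterS => N h1.
by rewrite !normE nc_invpow -rmorphM /= lecR.
Qed.

Lemma shift_le k (c : R) (f : nat -> C) (N : nat) : (0 < N)%N ->
  (nc (N%:R * f N) <= c * (N%:R ^+ k)^-1) = (nc (f N) <= c * (N%:R ^+ k.+1)^-1).
Proof.
move=> N0; have Np : 0 < N%:R :> R by rewrite ltr0n.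
by rewrite ncM nc_nat exprSr invfM mulrA [RHS]ler_pdivlMr // [nc _ * _]mulrC.
Qed.

Lemma is_o_shift k (f : nat -> C) :
  is_o_invpow k.+1 f <-> is_o_invpow k (fun N => N%:R * f N).
Proof.
rewrite !is_o_invpowE; split=> h e e0; have := h e e0; apply: filterS2 (nbhs_infty_ge 1) => N N1.
  by rewrite shift_le.
by rewrite shift_le.
Qed.

Lemma is_O_shift k (f : nat -> C) :
  is_O_invpow k.+1 f <-> is_O_invpow k (fun N => N%:R * f N).
Proof.
rewrite !is_O_invpowE; split=> -[c c0 h]; exists c => //; move: h;
  apply: filterS2 (nbhs_infty_ge 1) => N N1; by rewrite shift_le.
Qed.

Lemma near_inv_le (e : R) : 0 < e -> \forall N \near \oo, N%:R^-1 <= e :> R.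
Proof.
move=> e0; have [n hn] : exists n : nat, e^-1 <= n%:R.
  exists (Num.bound e^-1); apply: ltW; apply: le_lt_trans (archi_boundP _) => //.
  by rewrite invr_ge0 ltW.
exists n.+1 => // N /= nN; have N0 : 0 < N%:R :> R by rewrite ltr0n (leq_trans _ nN).
rewrite -[leRHS]invrK lef_pV2 ?posrE ?invr_gt0 //.
by apply: le_trans hn _; rewrite ler_nat ltnW.
Qed.

Lemma o_error : error_class (is_o_invpow 0).
Proof.
split.
- move=> f g c /is_o_invpowE hg fg; apply/is_o_invpowE => e e0.
  have c1 : 0 < `|c| + 1 by rewrite ltr_wpDl.
  have := hg _ (divr_gt0 e0 c1); apply: filterS2 fg => N h1.
  rewrite expr0 invr1 !mulr1 => h2; apply: le_trans h1 _.
  apply: (@le_trans _ _ ((`|c| + 1) * nc (g N))).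
    by rewrite ler_wpM2r ?nc_ge0 // (le_trans (ler_norm c)) // lerDl.
  by rewrite mulrC -ler_pdivlMr.
- move=> f g /is_o_invpowE hf /is_o_invpowE hg; apply/is_o_invpowE => e e0.
  have e2 : 0 < e / 2 by rewrite divr_gt0.
  have := hg _ e2; apply: filterS2 (hf _ e2) => N; rewrite expr0 invr1 !mulr1 => h1 h2.
  by apply: le_trans (ncD _ _) _; rewrite (splitr e) lerD.
- apply/is_o_invpowE => e e0; have := near_inv_le e0; apply: filterS => N.
  by rewrite expr0 invr1 mulr1 ncV nc_nat.
- move=> f /is_o_invpowE /(_ 1 ltr01); apply: filterS => N.
  by rewrite expr0 invr1 mulr1.
Qed.

Lemma O_error : error_class (is_O_invpow 1).
Proof.
split.
- move=> f g c /is_O_invpowE [d d0 hg] fg; apply/is_O_invpowE.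
  have c1 : 0 < `|c| + 1 by rewrite ltr_wpDl.
  exists ((`|c| + 1) * d); first exact: mulr_gt0.
  move: hg; apply: filterS2 fg => N h1 h2; apply: le_trans h1 _.
  apply: (@le_trans _ _ ((`|c| + 1) * nc (g N))).
    by rewrite ler_wpM2r ?nc_ge0 // (le_trans (ler_norm c)) // lerDl.
  by rewrite -mulrA ler_wpM2l // ltW.
- move=> f g /is_O_invpowE [c c0 hf] /is_O_invpowE [d d0 hg]; apply/is_O_invpowE.
  exists (c + d); first exact: addr_gt0.
  by move: hg; apply: filterS2 hf => N h1 h2; apply: le_trans (ncD _ _) _; rewrite mulrDl lerD.
- apply/is_O_invpowE; exists 1 => //; exists 0%N => // N _.
  by rewrite ncV nc_nat expr1 mul1r.
- move=> f /is_O_invpowE [c c0 hf].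
  have c1 : 0 < c^-1 by rewrite invr_gt0.
  move: hf; apply: filterS2 (near_inv_le c1) => N h1 h2; apply: le_trans h2 _.
  by rewrite expr1; apply: le_trans (ler_wpM2l (ltW c0) h1) _; rewrite mulfV // gt_eqF.
Qed.

Section Rules.
Variable S0 : (nat -> C) -> Prop.
Hypothesis hS : error_class S0.

Lemma error_near f g : S0 f -> (\forall N \near \oo, g N = f N) -> S0 g.
Proof.
move=> hf h; apply: (error_dom hS (c := 1)) hf _.
by move: h; apply: filterS => N ->; rewrite mul1r.
Qed.

Lemma errorZ (z : C) f : S0 f -> S0 (fun N => z * f N).
Proof.
move=> hf; apply: (error_dom hS (c := nc z)) hf _.
by apply: filterE => N; rewrite ncM.
Qed.

Lemma errorM f g : S0 f -> (exists c : R, \forall N \near \oo, nc (g N) <= c) ->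
  S0 (fun N => f N * g N).
Proof.
move=> hf [c hc]; apply: (error_dom hS (c := c)) hf _.
by move: hc; apply: filterS => N h; rewrite ncM mulrC ler_wpM2r ?nc_ge0.
Qed.

Lemma error_inv_le f (c : R) : (\forall N \near \oo, nc (f N) <= c / N%:R) -> S0 f.
Proof.
move=> h; apply: (error_dom hS (c := c)) (error_inv hS) _.
by move: h; apply: filterS => N; rewrite ncV nc_nat.
Qed.

Lemma error_bounded_at f (z : C) : S0 (fun N => f N - z) ->
  \forall N \near \oo, nc (f N) <= 1 + nc z.
Proof.
move=> /(error_bounded hS); apply: filterS => N h.
by rewrite -[f N](subrK z); apply: le_trans (ncD _ _) _; rewrite lerD2r.
Qed.

Lemma error_prod (I : Type) (r : seq I) (f : I -> nat -> C) (z : I -> C) :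
  (forall i, S0 (fun N => f i N - z i)) ->
  S0 (fun N => \prod_(i <- r) f i N - \prod_(i <- r) z i).
Proof.
move=> h; elim: r => [|i r IH].
  apply: (error_inv_le (c := 0)); apply: filterE => N.
  by rewrite !big_nil subrr nc0 mul0r.
apply: (error_near (f := fun N => (f i N - z i) * \prod_(i <- r) f i N
    + z i * (\prod_(i <- r) f i N - \prod_(i <- r) z i))).
  apply: (errorD hS); last exact: errorZ.
  by apply: errorM => //; eexists; exact: error_bounded_at IH.
by apply: filterE => N; rewrite !big_cons; ring.
Qed.

End Rules.
End ErrorClass.

(** * Asymptotic cyclic conditional freeness *)

Section Core.
Variables (R : realType) (K : choiceType).
Local Notation C := R[i].
Local Notation pA := (ncpoly R K).
Local Notation pF := (ncpoly R (K + K)%type).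
Local Notation factor := (pA + pA)%type.
Local Notation inj := (inj_factor (ncmap (R := R) (@inl K K)) (ncmap (R := R) (@inr K K))).

Variables (v : forall N : nat, 'cV[C]_N) (A B : forall N : nat, K -> 'M[C]_N).
Variables (psiA omegaA phiA psiB omegaB phiB : {scalar pA}).
Variables (d : nat -> measure_display) (T : forall N : nat, measurableType (d N)).
Variable Pr : forall N : nat, probability (T N) R.
Variable U : forall N : nat, T N -> 'M[C]_N.
Variables psi phi omega : {scalar pF}.
Hypothesis v_unit : forall N, (2 <= N)%N -> l2norm (v N) = 1.
Hypothesis AB_bounded : exists M : R, forall N, (2 <= N)%N -> forall k,
       opnorm (A N k) <= M /\ opnorm (B N k) <= M.
Hypothesis U_haar : forall N, (2 <= N)%N -> uniform_unitary_fixing (Pr N) (v N) (@U N).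
Hypothesis product_triple : is_cyclic_cfree_product (ncmap inl) (ncmap inr)
       psiA phiA omegaA psiB phiB omegaB psi phi omega.

Variable S0 : (nat -> C) -> Prop.
Hypothesis hS : error_class S0.
Hypothesis psiA_lim : forall p, S0 (fun N => N%:R * (psi_mx (A N) p - (psiA p + N%:R^-1 * omegaA p))).
Hypothesis psiB_lim : forall p, S0 (fun N => N%:R * (psi_mx (B N) p - (psiB p + N%:R^-1 * omegaB p))).
Hypothesis phiA_lim : forall p, S0 (fun N => phi_mx (v N) (A N) p - phiA p).
Hypothesis phiB_lim : forall p, S0 (fun N => phi_mx (v N) (B N) p - phiB p).

Definition model N (h : (2 <= N)%N) : haar_model R :=
  HaarModel h (v_unit h) (U_haar h).

Definition fword N (x : factor) : 'M[C]_N + 'M[C]_N :=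
  match x with inl a => inl (mxeval (A N) a) | inr b => inr (mxeval (B N) b) end.

Definition fpsi (x : factor) : C := match x with inl a => psiA a | inr b => psiB b end.

Definition fphi (x : factor) : C := match x with inl a => phiA a | inr b => phiB b end.

Lemma near2 : \forall N \near \oo, (2 <= N)%N.
Proof. exact: nbhs_infty_ge. Qed.

Lemma nat_unit N : (2 <= N)%N -> (N%:R : C) != 0.
Proof. by case: N => // N _; rewrite pnatr_eq0. Qed.

Lemma tr_bounded (D : forall N : nat, K -> 'M[C]_N) (psiD omegaD : {scalar pA}) (p : pA) :
  S0 (fun N => N%:R * (psi_mx (D N) p - (psiD p + N%:R^-1 * omegaD p))) -> psiD p = 0 ->
  exists c : R, \forall N \near \oo, nc (\tr (mxeval (D N) p)) <= c.
Proof.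
move=> h p0; exists (1 + nc (omegaD p)); apply: (error_bounded_at hS).
apply: (error_near hS h); apply: filterS near2 => N N2.
by rewrite p0 add0r mulrBr /psi_mx !(mulVKf (nat_unit N2)).
Qed.

Lemma opbd_family : exists2 M : R, 0 <= M & forall N, (2 <= N)%N -> forall k,
  opbd M (A N k) /\ opbd M (B N k).
Proof.
have [M hM] := AB_bounded; exists `|M| => // N N2 k.
have [h1 h2] := hM N N2 k.
by split; [exact: (opnorm_opbd (le_trans h1 (ler_norm M)))|exact: (opnorm_opbd (le_trans h2 (ler_norm M)))].
Qed.

Lemma good_fword x : fpsi x = 0 ->
  exists c : R, \forall N \near \oo, forall M, c <= M -> good M (fword N x).
Proof.
move=> x0; have [M M0 hM] := opbd_family.
have [c [hc0 [e hc]]] : exists c, (forall N, (2 <= N)%N -> opbd c (lmx (fword N x))) /\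
    exists e : R, \forall N \near \oo, nc (\tr (lmx (fword N x))) <= e.
  case: x x0 => [a|b] /= x0.
    have [c _ hc] := opbd_mxeval a M0.
    exists c; split; last exact: tr_bounded (psiA_lim a) x0.
    by move=> N N2; apply: hc => k; case: (hM N N2 k).
  have [c _ hc] := opbd_mxeval b M0.
  exists c; split; last exact: tr_bounded (psiB_lim b) x0.
  by move=> N N2; apply: hc => k; case: (hM N N2 k).
exists (Num.max c e); move: near2; apply: filterS2 hc => N h N2 M' hM'.
split; first by apply: opbd_ge (hc0 N N2); rewrite (le_trans _ hM') // le_max lexx.
by apply: le_trans h _; rewrite (le_trans _ hM') // le_max lexx orbT.
Qed.

Lemma goodw_fword s : (forall x, x \in s -> fpsi x = 0) ->
  exists2 M : R, 1 <= M & \forall N \near \oo, goodw M (map (fword N) s).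
Proof.
elim: s => [|x s IH] h; first by exists 1 => //; apply: filterE.
have [|M M1 hM] := IH; first by move=> y ys; apply: h; rewrite inE ys orbT.
have [|c hc] := good_fword (x := x); first by apply: h; rewrite inE eqxx.
exists (Num.max M c); first by rewrite le_max M1.
move: hM; apply: filterS2 hc => N h1 h2; apply/goodw_cons; split.
  by apply: h1; rewrite le_max lexx orbT.
by apply: goodw_ge h2; rewrite le_max lexx.
Qed.

Lemma phi_fword x : S0 (fun N => dotc (v N) (lmx (fword N x) *m v N) - fphi x).
Proof.
have e (D : forall N, K -> 'M[C]_N) p N : phi_mx (v N) (D N) p = dotc (v N) (mxeval (D N) p *m v N).
  by rewrite /phi_mx -mulmxA mxtrace_mulC -mulmxA /dotc /mxtrace big_ord1.
case: x => [a|b] /=.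
  by apply: (error_near hS (phiA_lim a)); apply: filterE => N; rewrite e.
by apply: (error_near hS (phiB_lim b)); apply: filterE => N; rewrite e.
Qed.

Definition Etr N (s : seq factor) : C :=
  expectationC (Pr N) (fun t => \tr (wev (U t) (map (fword N) s))).

Lemma Etr_alternating s : sorted (@alt pA pA) s -> (0 < size s)%N -> ~~ odd (size s) ->
  (forall x, x \in s -> fpsi x = 0) ->
  S0 (fun N => Etr N s - \prod_(x <- s) fphi x).
Proof.
move=> as_ s0 es h; have [M M1 hM] := goodw_fword h.
have [c c0 hc] := trace_alternating (size s) M1.
pose q N := \prod_(x <- s) dotc (v N) (lmx (fword N x) *m v N).
apply: (error_near hS (f := fun N => (Etr N s - q N) + (q N - \prod_(x <- s) fphi x))); last first.
  by apply: filterE => N; rewrite addrA subrK.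
apply: (errorD hS); last exact: (error_prod hS s phi_fword).
apply: (error_inv_le hS (c := c)).
move: hM; apply: filterS2 near2 => N N2 gw.
have := hc (model N2) (map (fword N) s); rewrite size_map s0 leqnn es big_map.
apply=> //; rewrite sorted_map; apply: sub_sorted as_ => x y.
by case: x => ?; case: y.
Qed.

Definition join N (u : 'M[C]_N) : (K + K)%type -> 'M[C]_N :=
  joinfam (A N) (conjfam u (B N)).

Definition EtrP (p : pF) N : C :=
  expectationC (Pr N) (fun t => psi_mx (join (U t)) p).

Lemma mxeval_factor N (u : 'M[C]_N) x : u \is unitarymx ->
  mxeval (join u) (inj x) = lev u (fword N x).
Proof.
move=> uu; case: x => [a|b]; first exact: (mxeval_ncmap (@inl K K) (join u) a).
transitivity (mxeval (conjfam u (B N)) b).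
  exact: (mxeval_ncmap (@inr K K) (join u) b).
exact: mxeval_conj.
Qed.

Lemma mxeval_fprod N (u : 'M[C]_N) s : u \is unitarymx ->
  mxeval (join u) (fprod s) = wev u (map (fword N) s).
Proof.
move=> uu; elim: s => [|x s IH].
  by rewrite /fprod big_nil mxeval1 wev_nil.
by rewrite fprod_cons mxevalM [map _ _]/= wev_cons -IH (mxeval_factor x uu).
Qed.

Lemma bmC_psi_mx N (N2 : (2 <= N)%N) p :
  bmC (m := model N2) (fun u => psi_mx (join u) p).
Proof.
elim/ncpoly_ind: p => [m a|p q hp hq]; last first.
  have -> : (fun u : 'M[C]_N => psi_mx (join u) (p + q))
      = (fun u => psi_mx (join u) p + psi_mx (join u) q).
    by apply/funext => u; rewrite /psi_mx mxevalD mxtraceD mulrDr.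
  exact: bmCD hp hq.
pose f k : 'M[C]_N + 'M[C]_N :=
  match k with inl k => inl (A N k) | inr k => inr (B N k) end.
have e u : psi_mx (join u) (ncmonom m a) = N%:R^-1 * a * \tr (wev u (map f m)).
  rewrite /psi_mx mxevalU mxtraceZ mulrA; congr (_ * \tr _).
  elim: (m : seq _) => [|k t IH]; first by rewrite mxmonom_nil wev_nil.
  by rewrite mxmonom_cons [map _ _]/= wev_cons IH; case: k.
have -> : (fun u : 'M[C]_N => psi_mx (join u) (ncmonom m a))
    = (fun u => N%:R^-1 * a * \tr (wev u (map f m))) by apply/funext => u; exact: e.
by apply: bmCM; [exact: bmC_cst | exact: (bmC_trw (m := model N2))].
Qed.

Lemma EtrP_E N (N2 : (2 <= N)%N) p :
  EtrP p N = E (m := model N2) (fun u => psi_mx (join u) p).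
Proof. by []. Qed.

Definition small (p : pF) : Prop :=
  S0 (fun N => N%:R * (EtrP p N - (psi p + N%:R^-1 * omega p))).

Lemma smallD p q : small p -> small q -> small (p + q).
Proof.
move=> hp hq; apply: (error_near hS (errorD hS hp hq)); apply: filterS near2 => N N2.
have -> : EtrP (p + q) N = EtrP p N + EtrP q N.
  rewrite !(EtrP_E N2) -ED; [|exact: bmC_psi_mx|exact: bmC_psi_mx].
  by apply: eq_E => u _; rewrite /psi_mx mxevalD mxtraceD mulrDr.
rewrite (linearD psi p q) (linearD omega p q); ring.
Qed.

Lemma smallZ (z : C) p : small p -> small (z *: p).
Proof.
move=> hp; apply: (error_near hS (errorZ hS z hp)); apply: filterS near2 => N N2.
have -> : EtrP (z *: p) N = z * EtrP p N.
  rewrite !(EtrP_E N2) -EZ; last exact: bmC_psi_mx.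
  by apply: eq_E => u _; rewrite /psi_mx mxevalZ mxtraceZ mulrCA.
rewrite (linearZ_LR psi z p) (linearZ_LR omega z p); ring.
Qed.

Lemma psi_inj x : psi (inj x) = fpsi x.
Proof.
case: x => [a|b]; first by case: (ccfree_extends1 product_triple a).
by case: (ccfree_extends2 product_triple b).
Qed.

Lemma phi_inj x : phi (inj x) = fphi x.
Proof.
case: x => [a|b]; first by case: (ccfree_extends1 product_triple a).
by case: (ccfree_extends2 product_triple b).
Qed.

Lemma small_factor x : small (inj x).
Proof.
have tr N (N2 : (2 <= N)%N) : EtrP (inj x) N = N%:R^-1 * \tr (lmx (fword N x)).
  rewrite (EtrP_E N2) -[RHS](E_cst (model N2)); apply: eq_E => u [uu _].
  rewrite /psi_mx mxeval_factor //; congr (_ * _).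
  by case: (fword N x) => b //=; rewrite mxtrace_mulC mulmxA trC_unitary ?mul1mx.
case: x tr => [a|b] tr.
  apply: (error_near hS (psiA_lim a)); apply: filterS near2 => N N2; rewrite (tr N N2).
  by have [-> _ ->] := ccfree_extends1 product_triple a.
apply: (error_near hS (psiB_lim b)); apply: filterS near2 => N N2; rewrite (tr N N2).
by have [-> _ ->] := ccfree_extends2 product_triple b.
Qed.

Lemma EtrP_fprod N (N2 : (2 <= N)%N) s : EtrP (fprod s) N = N%:R^-1 * Etr N s.
Proof.
rewrite (EtrP_E N2) -[Etr N s]/(E (m := model N2) (fun u => \tr (wev u (map (fword N) s)))).
rewrite -EZ; last exact: bmC_trw.
by apply: eq_E => u [uu _]; rewrite /psi_mx mxeval_fprod.
Qed.

Lemma small_cyc s : cyclically_alternating s ->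
  centered (ncmap inl) (ncmap inr) psi s -> small (fprod s).
Proof.
case: s => [//|x s] /andP[_]; rewrite /cycle rcons_path => /andP[hs hl] cs.
have os : odd (size s).
  have := alt_last (hs : sorted (@alt pA pA) (x :: s)).
  by move: hl; rewrite /other_factor => /negbTE; case: (odd _) => //; rewrite addbF => + e; rewrite e eqxx.
have hw : Defs.alternating (x :: s) by rewrite /Defs.alternating /= hs.
have hc : cyclically_alternating (x :: s).
  by rewrite /cyclically_alternating /= rcons_path hs hl.
have psi0 : psi (fprod (x :: s)) = 0 by exact: (ccfree_psi product_triple hw cs).
have om : omega (fprod (x :: s)) = \prod_(y <- x :: s) fphi y.
  rewrite (ccfree_omega product_triple hc cs); apply: eq_bigr => y _; exact: phi_inj.
have ev : ~~ odd (size (x :: s)) by rewrite /= os.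
have p0 y : y \in x :: s -> fpsi y = 0.
  by move=> ys; rewrite -psi_inj; apply/eqP; exact: (allP cs).
apply: (error_near hS (Etr_alternating (s := x :: s) hs isT ev p0)).
apply: filterS near2 => N N2; rewrite psi0 om add0r (EtrP_fprod N2) mulrBr.
by rewrite !(mulVKf (nat_unit N2)).
Qed.

Lemma psi_unit : psi 1 = 1.
Proof.
have -> : psi 1 = psiA 1.
  by have [+ _ _] := ccfree_extends1 product_triple 1; rewrite ncmap1.
have hb : \forall N \near \oo, nc (N%:R * (1 - psiA 1)) <= 1 + nc (omegaA 1).
  apply: (error_bounded_at hS); apply: (error_near hS (psiA_lim 1)).
  apply: filterS near2 => N N2; rewrite /psi_mx mxeval1 mxtrace1 mulVf ?nat_unit //.
  by rewrite opprD addrA [RHS]mulrBr (mulVKf (nat_unit N2)).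
apply/eqP; rewrite eq_sym -subr_eq0; apply/negPn/negP => z0.
set z := 1 - psiA 1 in z0 hb; set c := 1 + _ in hb.
have zp : 0 < nc z by rewrite lt_def nc_ge0 andbT; apply: contra z0 => /eqP/nc_eq0 ->.
have c0 : 0 < c by rewrite ltr_pwDl ?nc_ge0.
have e0 : 0 < nc z / (2 * c) by rewrite divr_gt0 // mulr_gt0.
have [N [[h1 N2] h3]] := filter_ex (filterI (filterI hb near2) (near_inv_le e0)).
have N0 : 0 < N%:R :> R by rewrite ltr0n (leq_trans _ N2).
move: h1; rewrite ncM nc_nat => h1.
have h4 : 2 * c <= N%:R * nc z.
  move: h3; rewrite ler_pdivlMr ?mulr_gt0 // mulrC ler_pdivrMr //.
  by rewrite [nc z * _]mulrC.
have : 2 * c <= c by exact: le_trans h4 h1.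
by rewrite mulr_natl mulr2n -lerBrDr subrr leNgt c0.
Qed.

Lemma fprod_rotate (f : pF -> C) : (forall p q, f (p * q) = f (q * p)) ->
  forall x y s, is_inl x = is_inl y ->
  f (fprod (x :: rcons s y)) = f (fprod (fmulr y x :: s)).
Proof.
move=> hf x y s xy; rewrite -rcons_cons fprod_rcons hf (fprod_cons x) mulrA.
by rewrite (fprod_cons (fmulr y x)) (inj_fmul (esym xy)).
Qed.

Lemma EtrP_tracial N (N2 : (2 <= N)%N) p q : EtrP (p * q) N = EtrP (q * p) N.
Proof.
have e u : psi_mx (join u) (p * q) = psi_mx (join (N := N) u) (q * p).
  have e' : \tr (mxeval (join (N := N) u) (p * q)) = \tr (mxeval (join (N := N) u) (q * p)).
    apply: (etrans (congr1 mxtrace (mxevalM _ p q))).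
    exact: (etrans (mxtrace_mulC _ _) (esym (congr1 mxtrace (mxevalM _ q p)))).
  exact: (congr1 ( *%R N%:R^-1) e').
exact: (eq_E (m := model N2) (fun u _ => e u)).
Qed.

(** The traces and [omega] do not change when the last factor is moved to the
    front, and [psi] vanishes both before and after that. *)
Lemma small_ends x y s : is_inl x = is_inl y -> (0 < size s)%N ->
  Defs.alternating (x :: rcons s y) -> centered (ncmap inl) (ncmap inr) psi (x :: rcons s y) ->
  small (fprod (fmulr y x :: s)) -> small (fprod (x :: rcons s y)).
Proof.
move=> xy s0 ha hc hs.
have psi0 : psi (fprod (x :: rcons s y)) = 0 by exact: (ccfree_psi product_triple ha hc).
have [_ as_] := andP ha.
have as1 : sorted (@alt pA pA) (x :: s) by move: as_; rewrite -rcons_cons -cats1 => /cat_sorted2 [].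
have cs : centered (ncmap inl) (ncmap inr) psi s.
  by move: hc; rewrite /centered /= all_rcons => /andP[_ /andP[_ ->]].
have as2 : sorted (@alt pA pA) s by exact: path_sorted as1.
pose z := fmulr y x; pose z0 := fcenter psi z.
have iz : is_inl z0 = is_inl x by rewrite /z0 is_inl_fcenter is_inl_fmul.
have psi0' : psi (fprod (z :: s)) = 0.
  have -> : fprod (z :: s) = fprod (z0 :: s) + psi (inj z) *: fprod s.
    rewrite (fprod_cons z) (fprod_cons z0) [X in X * _](inj_center psi z).
    by rewrite mulrDl -scalerAl mul1r.
  rewrite (linearD psi) (linearZ_LR psi).
  have -> : psi (fprod s) = 0 by apply: (ccfree_psi product_triple) cs; rewrite /Defs.alternating s0.
  rewrite mulr0 addr0; apply: (ccfree_psi product_triple).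
    rewrite /Defs.alternating /=; move: as1; case: (s) => //= w r /andP[h1 ->].
    by rewrite andbT; move: h1; rewrite /alt /other_factor iz.
  by rewrite /centered /= (psi_center psi_unit) eqxx.
apply: (error_near hS hs); apply: filterS near2 => N N2.
rewrite psi0 psi0' (fprod_rotate (f := omega) (ccfree_tracial product_triple) s xy).
by rewrite (fprod_rotate (f := EtrP^~ N) (EtrP_tracial N2) s xy).
Qed.

(** By [S_all], single factors, cyclically alternating words and words with
    two ends of the same kind are all that has to be examined. *)
Lemma small_all p : small p.
Proof.
exact: (S_all psi_unit smallD smallZ small_factor small_cyc small_ends).
Qed.

Definition pair_word (s : nat) (p q : 'I_s -> pA) (r : seq 'I_s) : seq factor :=
  flatten [seq [:: inl (p i); inr (q i)] | i <- r].

Lemma error_pairs (s : nat) (p q : 'I_s -> pA) : (1 <= s)%N ->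
  (forall i, psiA (p i) = 0 /\ psiB (q i) = 0) ->
  S0 (fun N => expectationC (Pr N) (fun t =>
      \tr (\big[mulmx/1%:M]_(i < s)
             (mxeval (A N) (p i) *m mxeval (conjfam (U t) (B N)) (q i))))
    - \prod_(i < s) (phiA (p i) * phiB (q i))).
Proof.
move=> s1 h; pose r := index_enum 'I_s.
have wE N (u : 'M[C]_N) r' : u \is unitarymx ->
    \big[mulmx/1%:M]_(i <- r') (mxeval (A N) (p i) *m mxeval (conjfam u (B N)) (q i))
      = wev u (map (fword N) (pair_word p q r')).
  move=> uu; elim: r' => [|i r' IH]; first by rewrite big_nil wev_nil.
  by rewrite big_cons IH /= !wev_cons /= (mxeval_conj _ _ uu) !mulmxA.
have pw i r' : pair_word p q (i :: r') = [:: inl (p i), inr (q i) & pair_word p q r'] by [].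
have pE r' : \prod_(x <- pair_word p q r') fphi x = \prod_(i <- r') (phiA (p i) * phiB (q i)).
  elim: r' => [|i r' IH]; first by rewrite !big_nil.
  by rewrite pw !big_cons IH mulrA.
have aw r' : sorted (@alt pA pA) (pair_word p q r').
  by elim: r' => [//|i [|j r'] IH].
have ew r' : size (pair_word p q r') = (size r').*2.
  by elim: r' => [//|i r' IH]; rewrite /= -/(pair_word _ _ _) IH.
have zw x r' : x \in pair_word p q r' -> fpsi x = 0.
  elim: r' => [//|i r' IH] /=; rewrite !inE => /or3P[/eqP ->|/eqP ->|/IH //].
    by case: (h i).
  by case: (h i).
have r0 : (0 < size r)%N.
  by have := mem_index_enum (Ordinal s1); rewrite -/r; case: (r).
have hw := Etr_alternating (aw r).
have := hw; rewrite ew double_gt0 r0 odd_double => /(_ isT isT (zw ^~ r)) => hE.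
apply: (error_near hS hE); apply: filterS near2 => N N2.
rewrite pE; congr (_ - _); rewrite /Etr; congr (expectationC (Pr N) _).
apply/funext => t; rewrite (wE N (U t) r) //.
by case: (uuf_stabilizer (U_haar N2) t).
Qed.

End Core.
Theorem theorem4p2p1 (R : realType) (K : choiceType)
    (v : forall N : nat, 'cV[R[i]]_N)
    (A B : forall N : nat, K -> 'M[R[i]]_N)
    (psiA omegaA phiA psiB omegaB phiB : {scalar ncpoly R K})
    (d : nat -> measure_display) (T : forall N : nat, measurableType (d N))
    (Pr : forall N : nat, probability (T N) R)
    (U : forall N : nat, T N -> 'M[R[i]]_N)
    (psi phi omega : {scalar ncpoly R (K + K)%type})
    (v_unit : forall N, (2 <= N)%N -> l2norm (v N) = 1)
    (AB_bounded : exists M : R, forall N, (2 <= N)%N -> forall k,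
       opnorm (A N k) <= M /\ opnorm (B N k) <= M)
    (psiA_lim : forall p : ncpoly R K,
       is_o_invpow 1 (fun N : nat => psi_mx (A N) p - (psiA p + N%:R^-1 * omegaA p)))
    (psiB_lim : forall p : ncpoly R K,
       is_o_invpow 1 (fun N : nat => psi_mx (B N) p - (psiB p + N%:R^-1 * omegaB p)))
    (phiA_lim : forall p : ncpoly R K,
       is_o_invpow 0 (fun N : nat => phi_mx (v N) (A N) p - phiA p))
    (phiB_lim : forall p : ncpoly R K,
       is_o_invpow 0 (fun N : nat => phi_mx (v N) (B N) p - phiB p))
    (U_haar : forall N, (2 <= N)%N -> uniform_unitary_fixing (Pr N) (v N) (U N))
    (product_triple : is_cyclic_cfree_product (ncmap inl) (ncmap inr)
       psiA phiA omegaA psiB phiB omegaB psi phi omega) :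
  let EtrP (p : ncpoly R (K + K)%type) (N : nat) : R[i] :=
    expectationC (Pr N) (fun t =>
      psi_mx (joinfam (A N) (conjfam (U N t) (B N))) p) in
  let EtrPQ (s : nat) (p q : 'I_s -> ncpoly R K) (N : nat) : R[i] :=
    expectationC (Pr N) (fun t =>
      \tr (\big[mulmx/1%:M]_(i < s)
             (mxeval (A N) (p i) *m mxeval (conjfam (U N t) (B N)) (q i)))) in
  let centered_pair (s : nat) (p q : 'I_s -> ncpoly R K) : Prop :=
    forall i, psiA (p i) = 0 /\ psiB (q i) = 0 in
  (* error terms of the same nature as the ones in the assumptions *)
  ((forall p,
      is_o_invpow 1 (fun N : nat => EtrP p N - (psi p + N%:R^-1 * omega p))) /\
   (forall (s : nat) (p q : 'I_s -> ncpoly R K),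
      (1 <= s)%N -> centered_pair s p q ->
      is_o_invpow 0 (fun N : nat => EtrPQ s p q N - \prod_(i < s) (phiA (p i) * phiB (q i))))) /\
  (* quantitative error terms *)
  ((forall p : ncpoly R K,
      [/\ is_O_invpow 2 (fun N : nat => psi_mx (A N) p - (psiA p + N%:R^-1 * omegaA p)),
          is_O_invpow 2 (fun N : nat => psi_mx (B N) p - (psiB p + N%:R^-1 * omegaB p)),
          is_O_invpow 1 (fun N : nat => phi_mx (v N) (A N) p - phiA p) &
          is_O_invpow 1 (fun N : nat => phi_mx (v N) (B N) p - phiB p)]) ->
   (forall p,
      is_O_invpow 2 (fun N : nat => EtrP p N - (psi p + N%:R^-1 * omega p))) /\
   (forall (s : nat) (p q : 'I_s -> ncpoly R K),
      (1 <= s)%N -> centered_pair s p q ->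
      is_O_invpow 1 (fun N : nat => EtrPQ s p q N - \prod_(i < s) (phiA (p i) * phiB (q i))))).
Proof.
move=> EtrP0 EtrPQ centered_pair; split; last first.
  move=> hO.
  have h1 q := (is_O_shift 1 _).1 (let: And4 h _ _ _ := hO q in h).
  have h2 q := (is_O_shift 1 _).1 (let: And4 _ h _ _ := hO q in h).
  have h3 q := let: And4 _ _ h _ := hO q in h.
  have h4 q := let: And4 _ _ _ h := hO q in h.
  split=> [p|s p q s1 hpq].
    apply/is_O_shift.
    exact: (small_all v_unit AB_bounded U_haar product_triple (@O_error R) h1 h2 h3 h4).
  exact: (error_pairs v_unit AB_bounded U_haar (@O_error R) h1 h2 h3 h4 s1 hpq).
have h1 q := (is_o_shift 0 _).1 (psiA_lim q).
have h2 q := (is_o_shift 0 _).1 (psiB_lim q).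
split=> [p|s p q s1 hpq].
  apply/is_o_shift.
  exact: (small_all v_unit AB_bounded U_haar product_triple (@o_error R) h1 h2 phiA_lim phiB_lim).
exact: (error_pairs v_unit AB_bounded U_haar (@o_error R) h1 h2 phiA_lim phiB_lim s1 hpq).
Qed.
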